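(* Let $X=\{(X_1(t),\dots,X_d(t)):t\in\mathbb{R}^n\}$ be a Gaussian random field in $\mathbb{R}^d$ such that $X_1,\dots,X_d$ are independent, centered Gaussian random fields with almost surely continuous sample paths. Let $f\colon\mathbb{R}^n\to\mathbb{R}^d$ be a Borel map and let $A\subset\mathbb{R}^n$ be an analytic set on which $X$ is regular. If $Z=X+f$ or $Z=(X+f)^*$ then, almost surely, $\dim_P Z(A)\le\dim_{P,Z}A$.
   Context: $\dim_P$ denotes packing dimension; $h^*(t)=(t,h(t))$. $\mathcal{P}_c(A)$: Borel probability measures with compact support in $A$; $\mu_Z=\mu\circ Z^{-1}$; $B(x,r)$ closed Euclidean ball. For a jointly measurable random map $Z$ and $\mu\in\mathcal{P}_c(\mathbb{R}^n)$, $\dim_{P,Z}\mu=\sup\{\gamma: \liminf_{r\to0+}r^{-\gamma}\mathbb{E}(\mu_Z(B(Z(t),r)))=0 \text{ for }\mu\text{-a.e. } t\}$ and $\dim_{P,Z}A=\sup\{\dim_{P,Z}\mu:\mu\in\mathcal{P}_c(A)\}$. $\rho_i(t,s)=\sqrt{\mathbb{E}(X_i(t)-X_i(s))^2}$. $X$ is regular on $A$ if $A=\bigcup_k A_k$ where for all $k,N\in\mathbb{N}^+$ there is $c>0$ with $\rho_i(t,s)\le c\log^{-N}(1/|t-s|)$ for all $t,s\in A_k$ and $1\le i\le d$. *)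

(* Defs.v *)
From HB Require Import structures.
From mathcomp Require Import all_boot all_order all_algebra.
From mathcomp Require Import all_classical all_reals all_analysis.

Set Implicit Arguments.
Unset Strict Implicit.
Unset Printing Implicit Defensive.

Import Order.TTheory GRing.Theory Num.Theory.
Import numFieldNormedType.Exports.

Local Open Scope classical_set_scope.
Local Open Scope ring_scope.

Section Defs.
Variable R : realType.

(** Euclidean space R^m is represented by row vectors 'rV[R]_m
    (its topology is the product = Euclidean topology). *)

Definition enorm (m : nat) (x : 'rV[R]_m) : R :=
  Num.sqrt (\sum_(i < m) x ord0 i ^+ 2).

Definition eball (m : nat) (x : 'rV[R]_m) (r : R) : set 'rV[R]_m :=
  [set y | enorm (y - x) <= r].

Definition borelRV (m : nat) := g_sigma_algebraType (@open 'rV[R]_m).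

(** Packing dimension (Tricot / Taylor–Tricot), via the packing measure.
    Packing premeasure:
      P^s_0(E) = lim_{delta -> 0} sup { sum_i (2 r_i)^s :
                     {B(x_i,r_i)} disjoint closed balls, x_i in E, 0<r_i<=delta }.
    Countable packings give the same supremum as finite ones (the terms are
    nonnegative and every finite subfamily of a packing is a packing), so we
    take the supremum over finite packings; the limit in delta is the
    infimum since the quantity is nondecreasing in delta. *)
Definition is_packing (m : nat) (E : set 'rV[R]_m) (delta : R)
    (ps : seq ('rV[R]_m * R)) : Prop :=
  (forall p, p \in ps -> E p.1 /\ 0 < p.2 <= delta) /\
  (forall i j, (i < j < size ps)%N ->
     eball (nth (0, 0) ps i).1 (nth (0, 0) ps i).2
       `&` eball (nth (0, 0) ps j).1 (nth (0, 0) ps j).2 = set0).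

Definition packing_premeasure (m : nat) (s : R) (E : set 'rV[R]_m) : \bar R :=
  ereal_inf [set ereal_sup
      [set (\sum_(p <- ps) (powR (2 * p.2) s)%:E)%E | ps in is_packing E delta]
    | delta in [set delta : R | 0 < delta]].

Definition packing_measure (m : nat) (s : R) (E : set 'rV[R]_m) : \bar R :=
  ereal_inf [set (\sum_(0 <= i <oo) packing_premeasure s (F i))%E
    | F in [set F : nat -> set 'rV[R]_m | E `<=` \bigcup_i F i]].

Definition dimP (m : nat) (E : set 'rV[R]_m) : \bar R :=
  ereal_sup [set s%:E | s in [set s : R | packing_measure s E = +oo%E]].

(** Centered Gaussian real random variable (variance 0 allowed, i.e. the
    law is either the Dirac mass at 0 or N(0, s^2) with s > 0). *)
Definition centered_gaussian (dO : measure_display) (Omega : measurableType dO)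
    (P : probability Omega R) (Y : Omega -> R) : Prop :=
  measurable_fun [set: Omega] Y /\
  ((forall B : set R, measurable B -> P (Y @^-1` B) = \d_(0 : R) B) \/
   (exists s : R, 0 < s /\
      forall B : set R, measurable B -> P (Y @^-1` B) = normal_prob 0 s B)).

(** Centered Gaussian random field indexed by R^n: every finite linear
    combination of its values is a centered Gaussian random variable
    (all finite-dimensional distributions are centered Gaussian). *)
Definition centered_gaussian_field (dO : measure_display)
    (Omega : measurableType dO) (P : probability Omega R) (n : nat)
    (Y : Omega -> 'rV[R]_n -> R) : Prop :=
  forall (k : nat) (ts : 'I_k -> 'rV[R]_n) (a : 'I_k -> R),
    centered_gaussian P (fun w => \sum_(j < k) a j * Y w (ts j)).

(** The coordinate fields X_1, ..., X_d are (mutually) independent: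
    product rule on the generating cylinder events. *)
Definition independent_components (dO : measure_display)
    (Omega : measurableType dO) (P : probability Omega R) (n d : nat)
    (X : Omega -> 'rV[R]_n -> 'rV[R]_d) : Prop :=
  forall (k : nat) (ts : 'I_k -> 'rV[R]_n) (B : 'I_d -> 'I_k -> set R),
    (forall i j, measurable (B i j)) ->
    P (\bigcap_(i in [set: 'I_d]) \bigcap_(j in [set: 'I_k])
         [set w | B i j (X w (ts j) ord0 i)])
    = (\prod_(i < d)
         P (\bigcap_(j in [set: 'I_k]) [set w | B i j (X w (ts j) ord0 i)]))%E.

Definition rho (dO : measure_display) (Omega : measurableType dO)
    (P : probability Omega R) (n d : nat)
    (X : Omega -> 'rV[R]_n -> 'rV[R]_d) (i : 'I_d) (t s : 'rV[R]_n) : R :=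
  Num.sqrt (fine (\int[P]_w ((X w t ord0 i - X w s ord0 i) ^+ 2)%:E)%E).

Definition regular_on (dO : measure_display) (Omega : measurableType dO)
    (P : probability Omega R) (n d : nat)
    (X : Omega -> 'rV[R]_n -> 'rV[R]_d) (A : set 'rV[R]_n) : Prop :=
  exists Ak : nat -> set 'rV[R]_n,
    A = \bigcup_k Ak k /\
    forall (k N : nat), (0 < N)%N ->
      exists c : R, 0 < c /\
        forall t s, Ak k t -> Ak k s -> forall i : 'I_d,
          rho P X i t s <= c * (ln ((enorm (t - s))^-1)) ^- N.

(** Analytic (Suslin) sets: results of the Suslin operation on a
    family of closed sets indexed by finite sequences of naturals. *)
Definition analytic (m : nat) (A : set 'rV[R]_m) : Prop :=
  exists F : seq nat -> set 'rV[R]_m,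
    (forall s, closed (F s)) /\
    A = [set x | exists sigma : nat -> nat, forall k, F (mkseq sigma k.+1) x].

Definition msupport (m : nat) (mu : set (borelRV m) -> \bar R) : set 'rV[R]_m :=
  [set x | forall U : set 'rV[R]_m, open U -> U x -> (0 < mu U)%E].

Definition Pc (n : nat) (A : set 'rV[R]_n) : set (probability (borelRV n) R) :=
  [set mu | compact (msupport mu) /\ msupport mu `<=` A].

Definition dimPZ_mu (dO : measure_display) (Omega : measurableType dO)
    (P : probability Omega R) (n k : nat)
    (Z : Omega -> 'rV[R]_n -> 'rV[R]_k) (mu : probability (borelRV n) R)
    : \bar R :=
  ereal_sup [set g%:E | g in [set g : R |
    {ae mu, forall t : borelRV n,
       limf_einf (fun r : R =>
          ((powR r (- g))%:E *
           \int[P]_w (mu [set s : borelRV n | eball (Z w t) r (Z w s)]))%E)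
         (0 : R)^'+ = 0%E}]].

Definition dimPZ (dO : measure_display) (Omega : measurableType dO)
    (P : probability Omega R) (n k : nat)
    (Z : Omega -> 'rV[R]_n -> 'rV[R]_k) (A : set 'rV[R]_n) : \bar R :=
  ereal_sup [set dimPZ_mu P Z mu | mu in Pc A].

End Defs.

(* Main.v *)
(** By chaining, almost every path [w] satisfies, at each scale [r] and for large
    [T] (a small power of [1 / r]),
      [|X_i(w,t) - X_i(w,u)| <= T max(r, rho_i(t,u))].
    Fix such a path. The probability that [Z(t)] and [Z(u)] are [r]-close is at
    most a constant times the product over [i] of [r / max(r, rho_i(t,u))]; if the
    drift [f] moves further than [T max(r, rho_i)] in some coordinate it is a
    Gaussian tail instead. In both cases it is bounded, up to a negligible error,
    by the product kernel of width about [T r] evaluated at the deterministic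
    increment [Z(w,t) - Z(w,u)].

    If the packing dimension of [Z_w(A)] exceeds [g], the graph of [Z_w] over [A] is
    a Suslin set with large image. After freezing a maximal set of coordinates,
    hyperplane slices have small image, so a Cantor tree can be built in the graph
    whose children are many, separated and pairwise distinct in each free
    coordinate. The average of the kernel over this tree is [o(r^g)] along a
    sequence of scales at every limit point. Fatou's lemma transfers this to the
    expectation of [mu_Z (B (Z t, r))] for the uniform measure [mu] of the tree,
    hence [g <= dim_{P,Z} A]. Graphs reduce to images by adding zero components
    to [X]. *)

Require Import Defs.
From HB Require Import structures.
From mathcomp Require Import all_boot all_order all_algebra.
From mathcomp Require Import all_classical all_reals all_analysis.
From mathcomp Require Import measurable_realfun.
From mathcomp Require Import ring lra zify.

Set Implicit Arguments.
Unset Strict Implicit.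
Unset Printing Implicit Defensive.

Import Order.TTheory GRing.Theory Num.Theory.
Import numFieldNormedType.Exports.

Local Open Scope classical_set_scope.
Local Open Scope ring_scope.

(** * Packing dimension and separated sets *)

Section Smallness.
Variable R : realType.

(** Two scales are tied by an integer [b]: balls have radius about [2^-((b+1)k)], the kernel has
    width [2^-(bk)]. Their quotient [2^k] is the factor [T] by which a path may exceed its typical
    increment. It costs only the inequality [(b+1) g < b s], which holds for large [b] as soon as
    [g < s].

    Regularity of every logarithmic order makes this factor sufficient. At distance [exp(-2^k)] a
    bounded set has nets of [exp(C 2^k)] points, the Gaussian tails are [exp(-c 4^k)], and [rho] is
    below every power [2^-(Nk)], hence below the radius.

    The drift is only Borel, so limits in the tree cannot rest on continuity of [Z]. They are taken
    in the closed set above the Suslin graph, where the values of [Z_w] converge together with the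
    points; any other good path differs from this one by a continuous function.

    A frozen coordinate contributes the factor 1 to the kernel. All decay must come from the free
    ones, which is why children have to be apart in each of them. *)

Definition separated (m : nat) (e : R) (zs : seq 'rV[R]_m) : bool :=
  pairwise (fun x y => e <= enorm (x - y)) zs.

(* The scales are restricted to powers of [2^-b], so that all radii below are
   exact powers of two. *)
Definition box_small (m b : nat) (s : R) (F : set 'rV[R]_m) : Prop :=
  exists k0, forall k, (k0 <= k)%N -> forall zs,
    (forall z, z \in zs -> F z) -> separated (2 ^- (b * k)) zs ->
    (size zs)%:R <= 2 `^ ((b * k)%:R * s).

(** Packing dimension seen as modified upper box dimension: countably many pieces, each with its own
    threshold beyond which separated subsets are few. *)
Definition sigma_small (m b : nat) (s : R) (E : set 'rV[R]_m) : Prop :=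
  exists F : nat -> set 'rV[R]_m, E `<=` \bigcup_j F j /\
    forall j, box_small b s (F j).

Lemma sigma_smallS m b s (E F : set 'rV[R]_m) :
  E `<=` F -> sigma_small b s F -> sigma_small b s E.
Proof. by move=> EF [G [FG h]]; exists G; split => //; apply: subset_trans FG. Qed.

Lemma box_small_sigma m b s (E : set 'rV[R]_m) :
  box_small b s E -> sigma_small b s E.
Proof. by move=> h; exists (fun=> E); split => // z Ez; exists 0%N. Qed.

Lemma box_small0 m b s : @box_small m b s set0.
Proof.
exists 0%N => k _ [|z zs] /=; first by rewrite powR_ge0.
by move=> h; case: (h z); rewrite inE eqxx.
Qed.

Lemma sigma_small_bigcup m b s (E : nat -> set 'rV[R]_m) :
  (forall i, sigma_small b s (E i)) -> sigma_small b s (\bigcup_i E i).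
Proof.
move=> /choice[G hG].
exists (fun j => if (unpickle j : option (nat * nat)) is Some ij then G ij.1 ij.2 else set0).
split=> [z [i _ Eiz]|j].
  have [j _ Gz] := (hG i).1 z Eiz.
  by exists (pickle (i, j)) => //; rewrite pickleK.
by case: unpickle => [[i k]|]; [exact: (hG i).2|exact: box_small0].
Qed.

Lemma sigma_small_countable m b s (I : countType) (E : I -> set 'rV[R]_m) :
  (forall i, sigma_small b s (E i)) -> sigma_small b s (\bigcup_i E i).
Proof.
move=> h; apply: (@sigma_smallS _ _ _ _
  (\bigcup_j (if (unpickle j : option I) is Some i then E i else set0))).
  by move=> z [i _ Ez]; exists (pickle i) => //; rewrite pickleK.
apply: sigma_small_bigcup => j; case: unpickle => // *.
exact/box_small_sigma/box_small0.
Qed.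

Lemma exp2_ge1 k : 1 <= 2 ^+ k :> R.
Proof. by rewrite exprn_ege1// ler1n. Qed.

Lemma exp2_gt0 k : 0 < 2 ^+ k :> R.
Proof. by rewrite exprn_gt0. Qed.
Hint Resolve exp2_gt0 : core.

Lemma ltr_nat_exp2 k : k%:R < 2 ^+ k :> R.
Proof. by rewrite -natrX ltr_nat ltn_expl. Qed.

Lemma powR2_gt0 x : 0 < 2 `^ x :> R.
Proof. by rewrite powR_gt0. Qed.

Lemma powR2_lt1 x : x < 0 -> 2 `^ x < 1 :> R.
Proof.
move=> x0; rewrite /powR (negbTE (_ : 2 != 0 :> R)) ?pnatr_eq0// expR_lt1.
by rewrite nmulr_rlt0// ln_gt0 ?ltr1n.
Qed.

Lemma powR2D x y : 2 `^ (x + y) = 2 `^ x * 2 `^ y :> R.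
Proof. by rewrite powRD// pnatr_eq0 implybT. Qed.

Lemma exp2_powR k : 2 ^+ k = 2 `^ k%:R :> R.
Proof. by rewrite powR_mulrn. Qed.

Lemma exp2N_powR k : 2 ^- k = 2 `^ (- k%:R) :> R.
Proof. by rewrite powRN exp2_powR. Qed.

Lemma dyadic_scale b (r : R) : (0 < b)%N -> 0 < r <= 1 ->
  exists k, 2 ^- (b * k.+1) < r <= 2 ^- (b * k).
Proof.
move=> b0 /andP[r0 r1].
have ex : exists k, 2 ^- (b * k.+1) < r.
  exists (Num.bound r^-1); rewrite invf_plt ?posrE//.
  apply: (@lt_trans _ _ (Num.bound r^-1)%:R).
    by apply: archi_boundP; rewrite invr_ge0 ltW.
  apply: (lt_le_trans (ltr_nat_exp2 _)); rewrite ler_eXn2l ?ltr1n//.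
  by apply: (leq_trans (leqnSn _)); rewrite leq_pmull.
exists (ex_minn ex); case: ex_minnP => -[|k] h1 h2; rewrite h1 /=.
  by rewrite muln0 expr0 invr1.
by rewrite leNgt; apply/negP => /h2; rewrite ltnn.
Qed.

Lemma powR_abs_le (c x y s : R) : 0 < x -> x <= y <= c * x ->
  y `^ s <= c `^ `|s| * x `^ s.
Proof.
move=> x0 /andP[xy yx].
have y0 : 0 < y by apply: lt_le_trans xy.
have -> : y `^ s = (y / x) `^ s * x `^ s.
  by rewrite -powRM ?divr_ge0 ?ltW// divfK// gt_eqF.
rewrite ler_wpM2r ?powR_ge0//.
have h1 : 1 <= y / x by rewrite ler_pdivlMr// mul1r.
have h2 : y / x <= c by rewrite ler_pdivrMr.
apply: (@le_trans _ _ ((y / x) `^ `|s|)); first by rewrite ler_powR// ler_norm.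
by rewrite ge0_ler_powR// nnegrE; lra.
Qed.

Lemma enorm_ge0 m (x : 'rV[R]_m) : 0 <= enorm x.
Proof. exact: sqrtr_ge0. Qed.

Lemma enormN m (x : 'rV[R]_m) : enorm (- x) = enorm x.
Proof.
by congr Num.sqrt; apply: eq_bigr => i _; rewrite mxE sqrrN.
Qed.

(** A centre at distance at most [p.2] from [p.1] would lie in both of two disjoint balls. *)
Lemma packing_pairwise m (E : set 'rV[R]_m) (delta : R) ps :
  is_packing E delta ps ->
  pairwise (fun p q : 'rV[R]_m * R => p.2 < enorm (p.1 - q.1)) ps.
Proof.
move=> [h1 h2]; apply/(pairwiseP (0, 0)) => i j ilt jlt ij /=.
set p := nth _ _ _; set q := nth _ _ _; rewrite ltNge; apply/negP => h.
have jlt' : (j < size ps)%N by [].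
have := h2 i j; rewrite ij jlt' => /(_ isT).
have [_ /andP[q0 _]] := h1 q (mem_nth _ jlt).
move/seteqP => -[/(_ q.1) + _]; apply; split; rewrite /eball /=.
  by rewrite -opprB enormN.
by rewrite subrr /enorm big1 ?sqrtr0 ?ltW// => l _; rewrite mxE expr0n.
Qed.

Lemma sum_const_count (I : Type) (r : seq I) (P : pred I) (x : R) :
  \sum_(i <- r | P i) x = (count P r)%:R * x.
Proof.
by elim: r => [|i r IH]; rewrite ?big_nil ?mul0r// big_cons/= IH; case: (P i);
  rewrite /= ?add0n// natrD mulrDl mul1r.
Qed.

(** Balls are grouped by the level [k] with [2^-(b(k+1)) < r <= 2^-(bk)]. The centres of one level
    are separated, hence few, and a ball contributes at most [(2^(b+1))^|s'|] times [2^-(b(k+1)s')];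
    as [s < s'], a geometric series of ratio [q] is left. The absolute value allows [s'] of either
    sign. *)
Lemma packing_sum_le m b (s s' : R) (F : set 'rV[R]_m) k0 :
  (0 < b)%N -> s < s' ->
  (forall k, (k0 <= k)%N -> forall zs,
    (forall z, z \in zs -> F z) -> separated (2 ^- (b * k)) zs ->
    (size zs)%:R <= 2 `^ ((b * k)%:R * s)) ->
  let q := 2 `^ (- (b%:R * (s' - s))) in
  forall K ps, (k0 <= K)%N -> is_packing F (2 ^- (b * K)) ps ->
  \sum_(p <- ps) (2 * p.2) `^ s' <= (2 ^+ b.+1) `^ `|s'| * (q ^+ K / (1 - q)).
Proof.
move=> b0 ss' hF q K ps k0K pk.
have q0 : 0 < q by exact: powR2_gt0.
have q1 : q < 1.
  rewrite powR2_lt1// oppr_lt0 mulr_gt0 ?ltr0n//; lra.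
have /= levP (p : 'rV[R]_m * R) : exists k, p \in ps ->
    (K <= k)%N && (2 ^- (b * k.+1) < p.2 <= 2 ^- (b * k)).
  have [pps|] := boolP (p \in ps); last by exists 0%N.
  have [_ /andP[p0 pK]] := pk.1 p pps.
  have [|k hk] := @dyadic_scale b p.2 b0.
    by rewrite p0 (le_trans pK)// invf_le1 ?exp2_ge1.
  exists k => _; rewrite hk andbT leqNgt; apply/negP => kK.
  move: hk => /andP[hk _].
  have := lt_le_trans hk pK; rewrite ltf_pV2 ?posrE// ltr_eXn2l ?ltr1n//.
  by rewrite ltn_pmul2l// ltnNge kK.
have [lev hlev] := choice levP.
pose M := (\max_(p <- ps) lev p).+1.
have levM p : p \in ps -> (lev p < M)%N by move=> h; rewrite ltnS leq_bigmax_seq.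
have -> : \sum_(p <- ps) (2 * p.2) `^ s' =
    \sum_(K <= k < M) \sum_(p <- ps | lev p == k) (2 * p.2) `^ s'.
  under [RHS]eq_bigr do rewrite big_mkcond.
  rewrite exchange_big/=; rewrite !big_seq; apply: eq_bigr => p pps.
  have /andP[Kp _] := hlev p pps.
  rewrite -big_mkcond/=; under eq_bigl do rewrite eq_sym.
  by rewrite big_nat1_eq Kp levM.
apply: (@le_trans _ _ (\sum_(K <= k < M) (2 ^+ b.+1) `^ `|s'| * q ^+ k)).
  rewrite !big_nat; apply: ler_sum => k /andP[Kk _].
  have hx : 0 < 2 ^- (b * k.+1) :> R by rewrite invr_gt0.
  apply: (@le_trans _ _ (\sum_(p <- ps | lev p == k)
      (2 ^+ b.+1) `^ `|s'| * (2 ^- (b * k.+1)) `^ s')).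
    rewrite big_seq_cond [leRHS]big_seq_cond; apply: ler_sum => p /andP[pps /eqP pk'].
    have := hlev p pps; rewrite pk' => /andP[_ /andP[h1 h2]].
    apply: powR_abs_le => //; apply/andP; split; first lra.
    have -> : 2 ^+ b.+1 * 2 ^- (b * k.+1) = 2 * 2 ^- (b * k) :> R.
      by rewrite mulnS exprD exprS invfM; field; rewrite !gt_eqF.
    lra.
  rewrite sum_const_count mulrCA ler_wpM2l ?powR_ge0//.
  pose zs := [seq p.1 | p <- ps & lev p == k].
  have -> : count (fun p => lev p == k) ps = size zs.
    by rewrite size_map size_filter.
  apply: (@le_trans _ _ (2 `^ ((b * k.+1)%:R * s) * (2 ^- (b * k.+1)) `^ s')).
    rewrite ler_wpM2r ?powR_ge0//; apply: hF.
    - by rewrite (leq_trans k0K)// (leq_trans Kk).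
    - move=> z /mapP[p]; rewrite mem_filter => /andP[_ /pk.1[Fp _]] ->; exact: Fp.
    - rewrite /separated /zs pairwise_map.
      apply: (@sub_in_pairwise _ (fun p : 'rV_m * R => 2 ^- (b * k.+1) < p.2)
        (fun p q : 'rV[R]_m * R => p.2 < enorm (p.1 - q.1))).
      + by move=> p p' hp _ /= /(lt_trans hp)/ltW.
      + apply/allP => p; rewrite mem_filter => /andP[/eqP lp /hlev].
        by rewrite lp => /and3P[].
      + exact/pairwise_filter/(packing_pairwise pk).
  rewrite exp2N_powR -powRrM -powR2D.
  rewrite -powR_mulrn ?(ltW q0)// /q -powRrM.
  rewrite ler_powR ?ler1n// natrM -natr1.
  have : 0 < b%:R * (s' - s) by rewrite mulr_gt0 ?ltr0n//; lra.
  have : 0 <= k%:R :> R by [].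
  nra.
rewrite -mulr_sumr ler_wpM2l ?powR_ge0//.
have [KM|/ltnW MK] := leqP K M; last first.
  rewrite big_geq// divr_ge0 ?exprn_ge0 ?ltW//; lra.
rewrite -{1}(add0n K) big_addn.
under eq_bigr do rewrite exprD mulrC.
rewrite -mulr_sumr ler_wpM2l ?exprn_ge0 ?(ltW q0)//.
have := @geometric_le_lim R (M - K)%N 1 q ler01 q0.
rewrite gtr0_norm// => /(_ q1); rewrite div1r; apply: le_trans.
by rewrite seriesEnat/=; apply: ler_sum => i _; rewrite mul1r.
Qed.

Lemma packing_premeasure_ge0 m s (E : set 'rV[R]_m) :
  (0 <= packing_premeasure s E)%E.
Proof.
apply: le_ereal_inf_tmp => _ [delta _ <-]; apply: ereal_sup_ubound.
by exists [::]; [split => // i j; rewrite ltn0 andbF|rewrite big_nil].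
Qed.

Lemma box_small_premeasure m b (s s' : R) (F : set 'rV[R]_m) :
  (0 < b)%N -> s < s' -> box_small b s F -> packing_premeasure s' F = 0%E.
Proof.
move=> b0 ss' [k0 hF]; apply/eqP; rewrite eq_le packing_premeasure_ge0 andbT.
have := packing_sum_le b0 ss' hF; set q := 2 `^ _; set C := _ `^ `|s'|.
move=> /= hK.
have q0 : 0 < q by exact: powR2_gt0.
have q1 : q < 1.
  rewrite powR2_lt1// oppr_lt0 mulr_gt0 ?ltr0n//; lra.
apply/lee_addgt0Pr => e e0; rewrite add0e.
have /cvgrPdist_lt/(_ (e / (C / (1 - q) + 1))) : q ^+ K @[K --> \oo] --> (0 : R).
  by apply: cvg_expr; rewrite gtr0_norm.
have C0 : 0 <= C / (1 - q) by rewrite divr_ge0 ?powR_ge0//; lra.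
have D0 : 0 < C / (1 - q) + 1 by lra.
move=> /(_ (divr_gt0 e0 D0)) [K0 _ hK0].
pose K := maxn k0 K0.
apply: (@le_trans _ _ (ereal_sup [set (\sum_(p <- ps) ((2 * p.2) `^ s')%:E)%E |
    ps in is_packing F (2 ^- (b * K))])).
  by apply: ereal_inf_lbound; exists (2 ^- (b * K)) => //=; rewrite invr_gt0.
apply: ge_ereal_sup => _ [ps pk <-]; rewrite sumEFin lee_fin.
apply: (le_trans (hK K ps (leq_maxl _ _) pk)).
have qK : 0 <= q ^+ K by rewrite exprn_ge0 ?(ltW q0).
have := hK0 K (leq_maxr _ _); rewrite /= sub0r normrN ger0_norm//.
rewrite ltr_pdivlMr// => h.
have -> : C * (q ^+ K / (1 - q)) = q ^+ K * (C / (1 - q)) by ring.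
lra.
Qed.

Lemma sigma_small_packing m b (s s' : R) (E : set 'rV[R]_m) :
  (0 < b)%N -> s < s' -> sigma_small b s E -> (packing_measure s' E < +oo)%E.
Proof.
move=> b0 ss' [F [EF hF]].
apply: (@le_lt_trans _ _ 0%E); last exact: ltry.
apply: ereal_inf_lbound; exists F => //.
by apply: eseries0 => i _ _; exact: (box_small_premeasure b0 ss').
Qed.

End Smallness.
#[global] Hint Resolve exp2_gt0 : core.

(** * Suslin sets *)

Section Suslin.
Implicit Types (T U : topologicalType) (sg : nat -> nat).

Definition prefix_eq (k : nat) (sg' sg : nat -> nat) : Prop :=
  forall j, (j < k)%N -> sg' j = sg j.

(* [Q] is a closed subset of the product of the Baire space and [T]. *)
Definition baire_closed T (Q : (nat -> nat) -> set T) : Prop :=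
  forall sg t, (forall k V, nbhs t V ->
    exists sg' t', [/\ prefix_eq k sg' sg, V t' & Q sg' t']) -> Q sg t.

(** The projection of a closed subset of the product with the Baire space. The witness [sg] will be
    a coordinate of the points of the tree, so that they converge inside a closed set. *)
Definition suslin T (S : set T) : Prop :=
  exists2 Q, baire_closed Q & S = [set t | exists sg, Q sg t].

Lemma suslin_closed T (C : set T) : closed C -> suslin C.
Proof.
move=> cC; exists (fun=> C).
  move=> sg t h; apply: cC => V /(h 0%N)[sg' [t' [_ Vt Ct]]]; by exists t'.
by apply/seteqP; split=> [t Ct|t [sg]//]; exists (fun=> 0%N).
Qed.

(** Entry 0 of the sequence names the member of the union, the shifted sequence is the witness for
    it. *)
Lemma suslin_bigcup T (S : nat -> set T) :
  (forall i, suslin (S i)) -> suslin (\bigcup_i S i).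
Proof.
move=> h; have /choice[Q hQ] i : exists Q, baire_closed Q /\
    S i = [set t | exists sg, Q sg t] by have [Q] := h i; exists Q.
exists (fun sg t => Q (sg 0%N) (fun j => sg j.+1) t).
  move=> sg t ht; apply: (hQ _).1 => k V /(ht k.+1)[sg' [t' [hp Vt]]].
  rewrite (hp 0%N)// => Qt; exists (fun j => sg' j.+1), t'; split => // j jk.
  exact: hp.
apply/seteqP; split=> [t [i _]|t [sg Qt]].
  rewrite (hQ i).2 => -[sg Qt].
  by exists (fun j => if j is j'.+1 then sg j' else i).
by exists (sg 0%N) => //; rewrite (hQ _).2; exists (fun j => sg j.+1).
Qed.

(** One sequence carries countably many witnesses: entry [j] of the witness for [S i] sits at
    position [pickle (i, j)]. *)
Lemma suslin_bigcap T (S : nat -> set T) :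
  (forall i, suslin (S i)) -> suslin (\bigcap_i S i).
Proof.
move=> h; have /choice[Q hQ] i : exists Q, baire_closed Q /\
    S i = [set t | exists sg, Q sg t] by have [Q] := h i; exists Q.
exists (fun sg t => forall i, Q i (fun j => sg (pickle (i, j))) t).
  move=> sg t ht i; apply: (hQ _).1 => k V.
  move=> /(ht (\max_(j < k) pickle (i, nat_of_ord j)).+1)[sg' [t' [hp Vt Qt]]].
  exists (fun j => sg' (pickle (i, j))), t'; split => // j jk.
  apply: hp; rewrite ltnS.
  exact: (@leq_bigmax _ (fun j : 'I_k => pickle (i, nat_of_ord j)) (Ordinal jk)).
apply/seteqP; split=> [t St|t [sg Qt] i _].
  have /choice[sg Qt] i : exists sg, Q i sg t.
    by have := St i I; rewrite (hQ i).2.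
  exists (fun c => if unpickle c is Some (i, j) then sg i j else 0%N) => i.
  rewrite (_ : (fun _ => _) = sg i)//; apply/funext => j; by rewrite pickleK.
by rewrite (hQ i).2; exists (fun j => sg (pickle (i, j))).
Qed.

Lemma suslin_setU T (A B : set T) : suslin A -> suslin B -> suslin (A `|` B).
Proof.
move=> sA sB; rewrite (_ : _ `|` _ = \bigcup_i (if i is 0%N then A else B)).
  by apply: suslin_bigcup => -[|i].
apply/seteqP; split=> [t [At|Bt]|t [[|i] _]]; [by exists 0%N|by exists 1%N|..].
  by left.
by right.
Qed.

Lemma suslin_setI T (A B : set T) : suslin A -> suslin B -> suslin (A `&` B).
Proof.
move=> sA sB; rewrite (_ : _ `&` _ = \bigcap_i (if i is 0%N then A else B)).
  by apply: suslin_bigcap => -[|i].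
by apply/seteqP; split=> [t [At Bt] [|i]|t h]//; split; [exact: (h 0%N)|exact: (h 1%N)].
Qed.

Lemma suslin_countable_bigcap T (I : countType) (S : I -> set T) :
  (forall i, suslin (S i)) -> suslin (\bigcap_i S i).
Proof.
move=> h; rewrite (_ : \bigcap_i _ =
    \bigcap_j (if (unpickle j : option I) is Some i then S i else setT)).
  apply: suslin_bigcap => j; case: unpickle => // *.
  exact/suslin_closed/closedT.
apply/seteqP; split=> [t St j _|t St i _].
  by case: unpickle => // i; exact: St.
by have := St (pickle i) Logic.I; rewrite pickleK.
Qed.

Lemma suslin_preimage T U (g : T -> U) (S : set U) :
  continuous g -> suslin S -> suslin (g @^-1` S).
Proof.
move=> cg [Q cQ ->]; exists (fun sg t => Q sg (g t)) => //.
move=> sg t ht; apply: cQ => k V Vg; have [sg' [t' [? ? ?]]] := ht k _ (cg t V Vg).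
by exists sg', (g t').
Qed.

End Suslin.

Section SuslinBorel.
Variable R : realType.

(** Membership in [F (mkseq sg k.+1)] depends on [k.+1] entries of [sg] only, so each such condition
    is closed in the product. *)
Lemma analytic_suslin m (A : set 'rV[R]_m) : analytic A -> suslin A.
Proof.
move=> [F [cF ->]]; exists (fun sg x => forall k, F (mkseq sg k.+1) x) => //.
move=> sg t ht k; apply: cF => V /(ht k.+1)[sg' [t' [hp Vt /(_ k) Ft]]].
exists t'; split => //; rewrite (_ : mkseq sg _ = mkseq sg' k.+1)//.
by apply/eq_in_map => j; rewrite mem_iota add0n => /andP[_ /hp].
Qed.

Lemma open_suslin m (O : set 'rV[R]_m) : open O -> suslin O.
Proof.
move=> oO.
rewrite (_ : O = \bigcup_k [set t | forall y, ~ O y -> k.+1%:R^-1 <= `|t - y|]).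
  apply: suslin_bigcup => k; apply: suslin_closed.
  move=> t ct y Oy; rewrite leNgt; apply/negP => ty.
  have : nbhs t [set z | `|z - y| < k.+1%:R^-1].
    apply/nbhs_ballP; exists (k.+1%:R^-1 - `|t - y|); rewrite /= ?subr_gt0// => z.
    rewrite -ball_normE/= => h; apply: le_lt_trans (ler_distD t z y) _.
    by rewrite (distrC z t) -ltrBrDr.
  by move=> /ct[z [/(_ y Oy) h /=]]; rewrite ltNge h.
apply/seteqP; split=> [t Ot|t [k _ h]]; last first.
  apply: contrapT => /h; rewrite subrr normr0 leNgt => /negP; apply.
  by rewrite invr_gt0.
have /nbhs_ballP[e e0 he] : nbhs t O by exact: open_nbhs_nbhs.
have [k hk] : exists k, k.+1%:R^-1 < e.
  exists (Num.bound e^-1); rewrite invf_plt ?posrE//.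
  apply: (@lt_trans _ _ (Num.bound e^-1)%:R); last by rewrite ltr_nat.
  by apply: archi_boundP; rewrite invr_ge0 ltW.
exists k => // y Oy; rewrite leNgt; apply/negP => ty; apply: Oy; apply: he.
by rewrite -ball_normE /=; apply: lt_trans hk.
Qed.

(** The sets that are Suslin together with their complement form a sigma-algebra containing the open
    sets. *)
Lemma borel_suslin m (B : set 'rV[R]_m) :
  <<s (@open 'rV[R]_m) >> B -> suslin B.
Proof.
suff h : <<s (@open 'rV[R]_m) >> `<=` [set B | suslin B /\ suslin (~` B)].
  by move=> /h[].
apply: smallest_sub; last first.
  move=> O oO; split; first exact: open_suslin.
  exact/suslin_closed/open_closedC.
split.
- split; last by rewrite setC0; exact/suslin_closed/closedT.
  exact/suslin_closed/closed0.
- by move=> A [sA sC]; rewrite /= setTD setCK.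
- move=> F hF; split; first by apply: suslin_bigcup => i; exact: (hF i).1.
  by rewrite setC_bigcup; apply: suslin_bigcap => i; exact: (hF i).2.
Qed.

Lemma coord_continuousR m (i : 'I_m) : continuous (fun x : 'rV[R]_m => x ord0 i).
Proof. exact: coord_continuous. Qed.

(** [y = f t] holds iff no rational separates a coordinate of [y] from that of [f t]: for each [q],
    either both are at most [q], or that of [f t] exceeds [q] and that of [y] is at least [q]. *)
Lemma graph_suslin n d (f : 'rV[R]_n -> 'rV[R]_d) :
  measurable_fun [set: borelRV R n] (f : borelRV R n -> borelRV R d) ->
  suslin [set p : 'rV[R]_n * 'rV[R]_d | p.2 = f p.1].
Proof.
move=> mf.
pose lo (iq : 'I_d * rat) := [set y : 'rV[R]_d | y ord0 iq.1 <= ratr iq.2].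
pose hi (iq : 'I_d * rat) := [set y : 'rV[R]_d | ratr iq.2 <= y ord0 iq.1].
have clo iq : closed (lo iq).
  by apply: closed_comp (@closed_le _ _) => // x _; exact: coord_continuousR.
have chi iq : closed (hi iq).
  by apply: closed_comp (@closed_ge _ _) => // x _; exact: coord_continuousR.
have bs B : closed B -> suslin (f @^-1` B) /\ suslin (f @^-1` (~` B)).
  move=> cB; have oB : open (~` B) by exact: closed_openC.
  have mB : <<s (@open 'rV[R]_n) >> (f @^-1` (~` B)).
    have := mf measurableT (~` B); rewrite setTI; apply.
    exact: sub_sigma_algebra.
  split; last exact: borel_suslin.
  rewrite -(setCK B) preimage_setC; apply: borel_suslin.
  exact: (sigma_algebraC mB).
have sfst S : suslin S -> suslin (fst @^-1` S : set ('rV[R]_n * 'rV[R]_d)).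
  by apply: suslin_preimage => p; exact: cvg_fst.
have ssnd S : suslin S -> suslin (snd @^-1` S : set ('rV[R]_n * 'rV[R]_d)).
  by apply: suslin_preimage => p; exact: cvg_snd.
rewrite (_ : [set p | _] = \bigcap_iq
  ((fst @^-1` (f @^-1` lo iq) `&` snd @^-1` lo iq) `|`
   (fst @^-1` (f @^-1` (~` lo iq)) `&` snd @^-1` hi iq))).
  apply: suslin_countable_bigcap => iq; apply: suslin_setU; apply: suslin_setI.
  - exact/sfst/(bs _ _).1.
  - exact/ssnd/suslin_closed.
  - exact/sfst/(bs _ _).2.
  - exact/ssnd/suslin_closed.
apply/seteqP; split=> [[t y] /= -> [i q] _|[t y] /= h].
  have [h|h] := leP (f t ord0 i) (ratr q); [left|right]; split => //=.
    by rewrite /lo/=; apply/negP; rewrite -ltNge.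
  exact: ltW.
apply/rowP => i; apply/eqP; rewrite eq_le; apply/andP; split; rewrite leNgt.
- apply/negP => /rat_in_itvoo[q]; rewrite in_itv/= => /andP[h1 h2].
  case: (h (i, q) I) => -[]; rewrite /lo/hi/=.
    by move=> _; rewrite leNgt h2.
  by move=> /negP; rewrite -ltNge => /(lt_trans h1); rewrite ltxx.
- apply/negP => /rat_in_itvoo[q]; rewrite in_itv/= => /andP[h1 h2].
  case: (h (i, q) I) => -[]; rewrite /lo/hi/=.
    by rewrite leNgt h2.
  by move=> _; rewrite leNgt h1.
Qed.

End SuslinBorel.

(** * The product kernel *)

Section Kernel.
Variable R : realType.

(** Each factor is [min(1, th / |z_l|)], the shape of the Gaussian small ball estimate in one
    coordinate; independence turns the estimate into a product. *)
Definition hkernel (d : nat) (th : R) (z : 'rV[R]_d) : R :=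
  \prod_(l < d) (th / Num.max th `|z ord0 l|).

Lemma hkernel_ge0 d th (z : 'rV[R]_d) : 0 <= th -> 0 <= hkernel th z.
Proof.
by move=> h; apply: prodr_ge0 => l _; rewrite divr_ge0// le_max h.
Qed.

Lemma hkernelN d th (z : 'rV[R]_d) : hkernel th (- z) = hkernel th z.
Proof. by apply: eq_bigr => l _; rewrite mxE normrN. Qed.

Lemma enorm_coord_le d (z : 'rV[R]_d) l : `|z ord0 l| <= enorm z.
Proof.
rewrite /enorm -sqrtr_sqr ler_sqrt ?sumr_ge0// => [|i _]; last exact: sqr_ge0.
rewrite (bigD1 l)//= lerDl sumr_ge0// => i _; exact: sqr_ge0.
Qed.

Lemma enorm_le_coord d (z : 'rV[R]_d) (e : R) : 0 <= e ->
  (forall l, `|z ord0 l| <= e) -> enorm z <= d.+1%:R * e.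
Proof.
move=> e0 h; have h0 : 0 <= d.+1%:R * e by rewrite mulr_ge0.
rewrite /enorm -[leRHS](ger0_norm h0) -sqrtr_sqr ler_sqrt ?sqr_ge0//.
apply: (@le_trans _ _ (\sum_(l < d) e ^+ 2)).
  by apply: ler_sum => l _; rewrite -[leLHS]real_normK ?num_real// lerXn2r// nnegrE.
rewrite sumr_const card_ord -[leLHS]mulr_natl exprMn ler_wpM2r ?sqr_ge0//.
by rewrite expr2 -natrM ler_nat; lia.
Qed.

(** The terms with index in [[2^a, 2^(a+1)[] sum to at most 1. *)
Lemma harmonic_exp2 a :
  \sum_(n < 2 ^ a) (maxn 1 n)%:R^-1 <= a.+1%:R :> R.
Proof.
elim: a => [|a IH]; first by rewrite big_ord1 /= invr1.
rewrite -(big_mkord xpredT (fun n => (maxn 1 n)%:R^-1 : R)).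
rewrite (big_cat_nat (n := (2 ^ a)%N)) ?leq_exp2l//= big_mkord.
rewrite -[a.+2%:R]natr1 lerD//.
apply: (@le_trans _ _ (\sum_(2 ^ a <= i < 2 ^ a.+1) (2 ^ a)%:R^-1)).
  rewrite !big_nat; apply: ler_sum => i /andP[ai _].
  rewrite lef_pV2 ?posrE ?ltr0n ?expn_gt0// ?ler_nat; last by rewrite leq_max.
  by rewrite leq_max ai orbT.
rewrite sumr_const_nat expnS mul2n -addnn addnK -[leLHS]mulr_natr mulVf//.
Qed.

(* Separated points occupy distinct cells of a slightly finer grid, so the kernel
   sums to at most a product of harmonic sums. *)
Lemma hkernel_sum_le d e q (zs : seq 'rV[R]_d) (z0 : 'rV[R]_d) :
  (4 * d.+1 * d.+1 <= 2 ^ e)%N ->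
  (forall z, z \in zs -> forall l, `|z ord0 l - z0 ord0 l| <= 2) ->
  separated (2 ^- q / (2 * d.+1%:R)) zs ->
  \sum_(z <- zs) hkernel (2 ^- q) (z - z0) <=
  (2 * 2 ^+ e * (e + q + 3)%:R) ^+ d.
Proof.
move=> he hb hs; set th := 2 ^- q : R.
have th0 : 0 < th by rewrite invr_gt0.
pose M : R := 2 ^+ e; have M0 : 0 < M by exact: exp2_gt0.
pose L := (2 ^ (e + q + 2))%N.
have L0 : (0 < L)%N by rewrite expn_gt0.
pose fl (x : R) : nat := Num.truncn (`|x| * (M / th)).
have Mth : 0 < M / th by rewrite divr_gt0.
have flP (x : R) : (fl x)%:R * (th / M) <= `|x| < (fl x).+1%:R * (th / M).
  have : 0 <= `|x| * (M / th) by rewrite mulr_ge0 ?(ltW Mth).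
  move=> /truncn_itv /andP[h1 h2]; apply/andP; split.
    rewrite -[th / M]invrK invf_div ler_pdivrMr//.
  by rewrite -[th / M]invrK invf_div ltr_pdivlMr.
(* Cells have width [th / M]. The sign is recorded because the integer part is taken of the absolute
   value. *)
pose idx (z : 'rV[R]_d) : {ffun 'I_d -> bool * 'I_L} :=
  [ffun l => (0 <= (z - z0) ord0 l, insubd (Ordinal L0) (fl ((z - z0) ord0 l)))].
(* On a cell of index [n] the kernel factor is at most [M / n], and at most [1 <= M] if [n = 0]. *)
pose g (c : bool * 'I_L) : R := M * (maxn 1 c.2)%:R^-1.
have flL (z : 'rV[R]_d) : z \in zs -> forall l, (fl ((z - z0)%R ord0 l) < L)%N.
  move=> zzs l; have H := hb z zzs l.
  rewrite -(ltr_nat R).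
  apply: (@le_lt_trans _ _ (`|(z - z0) ord0 l| * (M / th))).
    by have /andP[h _] := flP ((z - z0) ord0 l); rewrite -ler_pdivrMr// invf_div.
  rewrite !mxE.
  apply: (@le_lt_trans _ _ (2 * (M / th))); first by rewrite ler_wpM2r ?(ltW Mth).
  rewrite /M /th invrK -exprD -exprS /L natrX ltr_eXn2l ?ltr1n//; lia.
have idxE (z : 'rV[R]_d) l : z \in zs -> (idx z l).2 = fl ((z - z0) ord0 l) :> nat.
  by move=> zzs; rewrite ffunE /= val_insubd flL.
have d0 (x y : 'rV[R]_d) : x \in zs -> y \in zs -> idx x = idx y -> enorm (x - y) < th / (2 * d.+1%:R).
  move=> xzs yzs xy.
  apply: (@le_lt_trans _ _ (d.+1%:R * (th / M))).
    apply: enorm_le_coord; first by rewrite divr_ge0 ?(ltW th0) ?(ltW M0).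
    move=> l; have := congr1 (fun u : {ffun _} => (u l).1) xy.
    have := congr1 (fun u : {ffun _} => nat_of_ord (u l).2) xy.
    rewrite /= !idxE// !ffunE /=.
    have := flP ((x - z0) ord0 l); have := flP ((y - z0) ord0 l).
    set a := (x - z0) ord0 l; set c := (y - z0) ord0 l.
    have -> : (x - y) ord0 l = a - c by rewrite /a /c !mxE; ring.
    move=> /andP[h1 h2] /andP[h3 h4] h5; rewrite h5 in h3 h4.
    rewrite -natr1 in h2 h4.
    have [a0|a0] := leP 0 a; have [c0|c0] := leP 0 c => //= _.
      rewrite !ger0_norm// in h1 h2 h3 h4.
      by rewrite ler_norml; apply/andP; split; lra.
    rewrite !ltr0_norm// in h1 h2 h3 h4.
    by rewrite ler_norml; apply/andP; split; lra.
  rewrite mulrCA ltr_pM2l// ltr_pdivrMr// mulrC ltr_pdivlMr ?mulr_gt0//.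
  have : (4 * d.+1 * d.+1)%:R <= M by rewrite /M -natrX ler_nat.
  rewrite !natrM => h; have : 0 < d.+1%:R :> R by [].
  nra.
have uidx : uniq [seq idx z | z <- zs].
  rewrite uniq_pairwise pairwise_map; move: hs; rewrite /separated => hs.
  apply: (@sub_in_pairwise _ (mem zs) _ _ _ zs _ hs); last exact/allP.
  move=> x y xzs yzs /= h; apply/eqP => /d0 -/(_ xzs yzs); rewrite ltNge h//.
apply: (@le_trans _ _ (\sum_(z <- zs) \prod_l g (idx z l))).
  rewrite big_seq [leRHS]big_seq; apply: ler_sum => z zzs; apply: ler_prod => l _.
  have mx0 : 0 < Num.max th `|(z - z0) ord0 l| by rewrite lt_max th0.
  rewrite divr_ge0 ?(ltW th0) ?(ltW mx0)//= /g idxE// ler_pdivrMr//.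
  have := flP ((z - z0) ord0 l); move: (fl _) => [|k] /andP[h1 _].
    rewrite invr1 mulr1.
    apply: (@le_trans _ _ (M * th)); last by rewrite ler_pM2l// le_max lexx.
    by rewrite ler_peMl ?(ltW th0)// exp2_ge1.
  have -> : maxn 1 k.+1 = k.+1 by lia.
  apply: (@le_trans _ _ (M / k.+1%:R * `|(z - z0) ord0 l|)).
    rewrite mulrAC ler_pdivlMr//.
    by move: h1; rewrite mulrA ler_pdivrMr// [th * _]mulrC [M * _]mulrC.
  by rewrite ler_wpM2l ?divr_ge0 ?(ltW M0)// le_max lexx orbT.
have -> : \sum_(z <- zs) \prod_l g (idx z l) =
    \sum_(u <- [seq idx z | z <- zs]) \prod_l g (u l) by rewrite big_map.
apply: (@le_trans _ _ (\sum_(u : {ffun 'I_d -> bool * 'I_L}) \prod_l g (u l))).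
  rewrite big_uniq//= [leRHS](bigID (mem [seq idx z | z <- zs]))/= lerDl.
  apply: sumr_ge0 => u _; apply: prodr_ge0 => l _.
  by rewrite mulr_ge0 ?(ltW M0)// invr_ge0.
(* The sum over all cells factors into [d] copies of one harmonic sum, doubled by the signs. *)
rewrite -(bigA_distr_bigA (fun (l : 'I_d) c => g c)) prodr_const card_ord.
rewrite lerXn2r ?nnegrE//.
  by apply: sumr_ge0 => c _; rewrite mulr_ge0 ?(ltW M0)// invr_ge0.
rewrite -(pair_bigA _ (fun (x : bool) (y : 'I_L) => g (x, y)))/= big_bool /=.
rewrite /g /= -mulr_sumr -mulr2n -[leLHS]mulr_natl -mulrA ler_pM2l// ler_pM2l//.
by apply: le_trans (harmonic_exp2 _) _; rewrite addn3 addn2.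
Qed.

End Kernel.

Section Growth.
Variable R : realType.

Lemma exp2_decay (x K e : R) : 0 < x -> 0 < e -> exists k0, forall k,
  (k0 <= k)%N -> K * 2 `^ (- x * k%:R) <= e.
Proof.
move=> x0 e0; pose q : R := 2 `^ (- x).
have q0 : 0 < q by exact: powR2_gt0.
have q1 : q < 1 by rewrite powR2_lt1// oppr_lt0.
have /cvgrPdist_lt : q ^+ k @[k --> \oo] --> (0 : R).
  by apply: cvg_expr; rewrite gtr0_norm.
have K0 : 0 < `|K| + 1 by rewrite ltr_wpDl.
move=> /(_ _ (divr_gt0 e0 K0)) [k0 _ hk]; exists k0 => k /hk /=.
have qk : 0 <= q ^+ k by rewrite exprn_ge0 ?(ltW q0).
rewrite sub0r normrN ger0_norm// ltr_pdivlMr// => /ltW; apply: le_trans.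
rewrite powRrM powR_mulrn ?(ltW q0)// mulrC ler_wpM2l//.
by rewrite (le_trans (ler_norm _))// lerDl.
Qed.

Lemma polynomial_exp2_decay (C x e : R) (d : nat) : 0 <= C -> 0 < x -> 0 < e ->
  exists k0, forall k, (k0 <= k)%N ->
  (C * k.+1%:R) ^+ d * 2 `^ (- x * k%:R) <= e.
Proof.
(* [y] is so small that the [d]-th power of [2^(y k)] uses at most half of the decay rate [x]. *)
move=> C0 x0 e0; pose y := x / (2 * d.+1%:R).
have d0 : 0 < d.+1%:R :> R by [].
have y0 : 0 < y by rewrite divr_gt0// mulr_gt0.
have yd : y * d%:R <= x / 2.
  have : y * (2 * (d%:R + 1)) = x by rewrite natr1 /y divfK// gt_eqF// mulr_gt0.
  clearbody y; lra.
clearbody y.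
have ln20 : 0 < ln 2 :> R by rewrite ln_gt0 ?ltr1n.
have yl : 0 < y * ln 2 by rewrite mulr_gt0.
pose D := C / (y * ln 2).
have D0 : 0 <= D by rewrite divr_ge0 ?(ltW yl).
have hlin k : C * k.+1%:R <= D * 2 `^ (y * k.+1%:R).
  have -> : C * k.+1%:R = D * (y * ln 2 * k.+1%:R).
    by rewrite /D mulrA divfK// gt_eqF.
  rewrite ler_wpM2l// /powR pnatr_eq0/=.
  have := expR_ge1Dx (y * k.+1%:R * ln 2); rewrite mulrAC; lra.
have x2 : 0 < x / 2 by lra.
have [k0 hk0] := exp2_decay (D ^+ d * 2 `^ (x / 2)) x2 e0.
exists k0 => k /hk0; apply: le_trans.
apply: (@le_trans _ _ ((D * 2 `^ (y * k.+1%:R)) ^+ d * 2 `^ (- x * k%:R))).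
  rewrite ler_wpM2r ?powR_ge0//; apply: lerXn2r; last exact: hlin.
    by rewrite nnegrE mulr_ge0.
  by rewrite nnegrE mulr_ge0 ?powR_ge0.
rewrite exprMn -!mulrA ler_wpM2l ?exprn_ge0//.
rewrite -powR_mulrn ?powR_ge0// -powRrM -!powR2D ler_powR ?ler1n//.
have := ler_wpM2r (ler0n R k.+1) yd; rewrite -[k.+1%:R]natr1.
lra.
Qed.

End Growth.

(** * The tree of a Suslin set *)

Section Cells.
Variables (R : realType) (n d b : nat) (s : R).

Definition point := ((nat -> nat) * ('rV[R]_n * 'rV[R]_d))%type.
Implicit Types (p q : point).

Definition celltype := (nat * ('rV[int]_n * 'rV[int]_d))%type.

Definition fl (j : nat) (x : R) : int := Num.floor (2 ^+ j * x).

Definition cell (j : nat) (p : point) : celltype :=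
  (p.1 j, (map_mx (fl j) p.2.1, map_mx (fl j) p.2.2)).

(** Codes are words over a countable type, so there are only countably many neighbourhoods. The
    first [k.+1] cells fix [k.+1] entries of the witness and all real coordinates up to [2^-k]. *)
Definition code (k : nat) p : seq celltype := mkseq (cell^~ p) k.

Lemma code_le k k' p p' : (k <= k')%N -> code k' p = code k' p' ->
  code k p = code k p'.
Proof.
move=> kk' /(congr1 (take k)); rewrite /code /mkseq -!map_take take_iota.
by rewrite (minn_idPl kk').
Qed.

Lemma code_cell k j p p' : (j < k)%N -> code k p = code k p' ->
  cell j p = cell j p'.
Proof.
move=> jk /(congr1 (nth (cell 0 p) ^~ j)).
by rewrite !nth_mkseq.
Qed.

Lemma code_prefix k p p' : code k p = code k p' -> prefix_eq k p.1 p'.1.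
Proof. by move=> h j jk; have := code_cell jk h => -[]. Qed.

Lemma fl_dist j (x y : R) : fl j x = fl j y -> `|x - y| < 2 ^- j.
Proof.
rewrite /fl => h; have := floor_itv (2 ^+ j * x); have := floor_itv (2 ^+ j * y).
rewrite h intrD; set c := (_%:~R); move=> /andP[h1 h2] /andP[h3 h4].
rewrite -(mulr1 (2 ^- j)) -ltr_pdivrMl ?invr_gt0// invrK.
rewrite -[X in X * _]gtr0_norm// -normrM mulrBr ltr_norml.
by apply/andP; split; lra.
Qed.

Lemma code_dist1 k p p' : code k.+1 p = code k.+1 p' ->
  forall i, `|p.2.1 ord0 i - p'.2.1 ord0 i| < 2 ^- k.
Proof.
move=> /(code_cell (ltnSn k))[_ /matrixP h _] i; apply: fl_dist.
by have := h ord0 i; rewrite !mxE.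
Qed.

Lemma code_dist2 k p p' : code k.+1 p = code k.+1 p' ->
  forall l, `|p.2.2 ord0 l - p'.2.2 ord0 l| < 2 ^- k.
Proof.
move=> /(code_cell (ltnSn k))[_ _ /matrixP h] l; apply: fl_dist.
by have := h ord0 l; rewrite !mxE.
Qed.

Variable Dom : set point.

Definition img (E : set point) : set 'rV[R]_d := [set p.2.2 | p in E].

Definition psmall (E : set point) : Prop := sigma_small b s (img E).

Lemma psmallS E F : E `<=` F -> psmall F -> psmall E.
Proof. by move=> EF; apply: sigma_smallS => _ [p /EF Fp <-]; exists p. Qed.

Lemma psmall_countable (I : countType) (E : I -> set point) :
  (forall i, psmall (E i)) -> psmall (\bigcup_i E i).
Proof.
move=> h; apply: (@sigma_smallS _ _ _ _ _ (\bigcup_i img (E i))).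
  by move=> _ [p [i _ Ep] <-]; exists i => //; exists p.
exact: sigma_small_countable.
Qed.

Lemma psmall_setU E F : psmall E -> psmall F -> psmall (E `|` F).
Proof.
move=> hE hF; apply: (@psmallS _ (\bigcup_(i in [set: bool]) if i then E else F)).
  by move=> p [Ep|Fp]; [exists true|exists false].
by apply: psmall_countable => -[].
Qed.

Definition nbh (k : nat) (p : point) : set point :=
  [set p' | Dom p' /\ code k p' = code k p].

(* The points none of whose neighbourhoods has a small image. *)
Definition kernel : set point := [set p | Dom p /\ forall k, ~ psmall (nbh k p)].

(** The points of [E] outside the kernel lie in small neighbourhoods. Each of these is given by a
    finite code, so they are countably many and their union is small. *)
Lemma kernel_full (E : set point) : E `<=` Dom -> ~ psmall E ->
  ~ psmall (E `&` kernel).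
Proof.
move=> ED hE hEK; apply: hE.
pose G (c : seq celltype) : set point :=
  if `[< psmall [set p | Dom p /\ code (size c) p = c] >]
  then [set p | Dom p /\ code (size c) p = c] else set0.
apply: (@psmallS _ ((E `&` kernel) `|` \bigcup_c G c)); last first.
  apply: psmall_setU => //; apply: psmall_countable => c; rewrite /G.
  case: asboolP => // _; apply: (@sigma_smallS _ _ _ _ _ set0) => [_ [p []]//|].
  exact/box_small_sigma/box_small0.
move=> p Ep; have [kp|nk] := pselect (kernel p); [by left|right].
move: nk => /not_andP[/(_ (ED p Ep))//|/existsNP[k /contrapT hk]].
exists (code k p) => //; rewrite /G size_mkseq.
by case: asboolP => // _; split => //; exact: ED.
Qed.

Lemma kernel_nbh k p : kernel p -> ~ psmall (nbh k p `&` kernel).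
Proof. by move=> [_ h]; apply: kernel_full (h k) => q []. Qed.

Variable I : {pred 'I_d}.
Hypothesis I_small : forall l c, l \in I ->
  psmall (Dom `&` [set p : point | p.2.2 ord0 l = c]).

Definition apart (p q : point) : Prop := forall l, l \in I -> p.2.2 ord0 l != q.2.2 ord0 l.

(** The points are replaced one at a time. The next one has to avoid countably many hyperplane
    slices, all small by [I_small], whereas by [kernel_nbh] the kernel has no small part near any of
    its points. *)
Lemma perturb_apart (N k : nat) (ps : nat -> point) :
  (forall i, (i < N)%N -> kernel (ps i)) ->
  exists ps' : nat -> point, [/\
    forall i, (i < N)%N -> kernel (ps' i) /\ code k (ps' i) = code k (ps i) &
    forall i j, (i < j < N)%N -> apart (ps' i) (ps' j)].
Proof.
elim: N => [|N IH] hps.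
  by exists ps; split => // i j; rewrite ltn0 andbF.
have [|ps' [h1 h2]] := IH; first by move=> i iN; apply: hps; rewrite ltnW.
have [q [[[Dq cq] kq] hq]] : exists q, (nbh k (ps N) `&` kernel) q /\
    forall i, (i < N)%N -> apart (ps' i) q.
  apply: contrapT => hno; apply: (@kernel_nbh k (ps N)); first exact: hps.
  apply: (@psmallS _ (\bigcup_(il in [set: nat * 'I_d])
    (if il.2 \in I then Dom `&` [set p : point | p.2.2 ord0 il.2 = (ps' il.1).2.2 ord0 il.2]
     else set0))).
    move=> q hq; apply: contrapT => hq'; apply: hno; exists q; split => // i iN l lI.
    apply/eqP => e; apply: hq'; exists (i, l) => //=; rewrite lI; split => //.
    by case: hq => -[].
  apply: psmall_countable => -[i l] /=; case: ifPn => [lI|_]; first exact: I_small.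
  apply: (@sigma_smallS _ _ _ _ _ set0) => [_ [p []]//|].
  exact/box_small_sigma/box_small0.
exists (fun i => if i == N then q else ps' i); split.
  move=> i; rewrite ltnS leq_eqVlt; case: eqVneq => [->//|_ /= iN].
  exact: h1.
move=> i j /andP[ij]; rewrite ltnS leq_eqVlt; case: eqVneq => [jN _|jN /= hj].
  by rewrite jN in ij; rewrite ltn_eqF//; exact: hq.
by rewrite ltn_eqF ?(ltn_trans ij hj)//; apply: h2; rewrite ij.
Qed.

End Cells.

(** * Comparison of kernel values *)

Section KernelBounds.
Variables (R : realType) (d : nat).

Lemma hkernel_comp th (z w : 'rV[R]_d) : 0 < th ->
  (forall l, `|w ord0 l - z ord0 l| <= th) ->
  hkernel th z <= 2 ^+ d * hkernel th w.
Proof.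
move=> th0 h; rewrite -[2 ^+ d](_ : \prod_(l < d) (2 : R) = _); last first.
  by rewrite prodr_const card_ord.
rewrite /hkernel -big_split/=; apply: ler_prod => l _.
have m1 : 0 < Num.max th `|z ord0 l| by rewrite lt_max th0.
have m2 : 0 < Num.max th `|w ord0 l| by rewrite lt_max th0.
rewrite divr_ge0 ?(ltW th0) ?(ltW m1)//= ler_pdivrMr//.
rewrite [leRHS](_ : _ = th * (2 * Num.max th `|z ord0 l| / Num.max th `|w ord0 l|));
  last by ring.
rewrite ler_peMr ?(ltW th0)// ler_pdivlMr// mul1r.
rewrite ge_max; apply/andP; split.
  have : th <= Num.max th `|z ord0 l| by rewrite le_max lexx.
  lra.
have h1 : `|w ord0 l| <= th + `|z ord0 l|.
  rewrite -[w ord0 l](subrK (z ord0 l)); apply: (le_trans (ler_normD _ _)).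
  by rewrite lerD2r.
have : th <= Num.max th `|z ord0 l| by rewrite le_max lexx.
have : `|z ord0 l| <= Num.max th `|z ord0 l| by rewrite le_max lexx orbT.
lra.
Qed.

Variable I : {pred 'I_d}.

Lemma hkernel_far th eta (z : 'rV[R]_d) : 0 < th -> 0 < eta ->
  (forall l, l \in I -> eta <= `|z ord0 l|) ->
  hkernel th z <= (th / eta) ^+ #|I|.
Proof.
move=> th0 eta0 h; rewrite -prodr_const [leRHS]big_mkcond/=.
apply: ler_prod => l _.
have m1 : 0 < Num.max th `|z ord0 l| by rewrite lt_max th0.
rewrite divr_ge0 ?(ltW th0) ?(ltW m1)//=; case: ifPn => [/h lI|_].
  by rewrite ler_pM2l// lef_pV2 ?posrE// le_max lI orbT.
by rewrite ler_pdivrMr// mul1r le_max lexx.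
Qed.

(** A bound from below: [N] times [(th / 2) ^ #|I|] is then at most the kernel sum over [N]
    children, so the estimate of that sum also controls the kernel across distant subtrees. This
    stands in for a comparison of [#|I|] with [s]. *)
Lemma hkernel_near th (z : 'rV[R]_d) : 0 < th <= 2 ->
  (forall l, `|z ord0 l| <= 2) -> (forall l, l \notin I -> z ord0 l = 0) ->
  (th / 2) ^+ #|I| <= hkernel th z.
Proof.
move=> /andP[th0 th2] h hI; rewrite -prodr_const [leLHS]big_mkcond/=.
apply: ler_prod => l _.
have m1 : 0 < Num.max th `|z ord0 l| by rewrite lt_max th0.
case: ifPn => [lI|/hI ->]; last first.
  by rewrite ler01/= normr0 (max_idPl (ltW th0)) divff// gt_eqF.
rewrite divr_ge0 ?(ltW th0)//= ler_pM2l// lef_pV2 ?posrE//.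
by rewrite ge_max th2 h.
Qed.

End KernelBounds.

(** * One step of the tree construction *)

Section NodeStep.
Variables (R : realType) (n d b : nat) (s g : R).
Variables (Dom : set (point R n d)) (I : {pred 'I_d}).
Hypothesis I_small : forall l c, l \in I ->
  psmall b s (Dom `&` [set p : point R n d | p.2.2 ord0 l = c]).
Hypothesis I_const : forall p q, Dom p -> Dom q ->
  forall l, l \notin I -> p.2.2 ord0 l = q.2.2 ord0 l.
Hypothesis gs : b.+1%:R * g < b%:R * s.

(** This is [r ^ g] for [r = 2^-((b+1)k)], the radius that goes with the kernel width [2^-(bk)]. *)
Definition rate (k : nat) : R := 2 `^ (- (b.+1%:R * g * k%:R)).

Record step := Step {
  st_N : nat; st_ch : nat -> point R n d; st_k : nat; st_eta : R; st_scale : nat;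
  st_B : nat -> nat -> R }.

(* The node at [p] consists of the points with the same [k] first cells. Its
   [st_N] children refine it to [k'] cells and are pairwise [eta']-apart in every
   coordinate of [I]. At the scale [kap] the kernel is negligible on average over
   the children, and also between points that are [eta]-apart, i.e. that lie in
   subtrees split earlier. *)
Definition step_spec (p : point R n d) (k : nat) (eta : R) (j : nat) (S : step) :=
  let: Step N ch k' eta' kap B := S in
  let th := 2 ^- (b * kap) : R in
  [/\ [/\ (0 < N)%N, (k < k')%N, 0 < eta' <= eta & (j <= kap)%N],
   (forall i, (i < N)%N -> kernel b s Dom (ch i) /\ code k (ch i) = code k p),
   (forall i i', (i < N)%N -> (i' < N)%N -> i <> i' -> forall a c,
      nbh Dom k' (ch i) a -> nbh Dom k' (ch i') c ->
      forall l, l \in I -> eta' <= `|(a.2.2 - c.2.2) ord0 l|),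
   ((forall i i' a c, (i < N)%N -> (i' < N)%N ->
       nbh Dom k' (ch i) a -> nbh Dom k' (ch i') c ->
       hkernel th (a.2.2 - c.2.2) <= B i i') /\
    forall i, (i < N)%N -> N%:R^-1 * \sum_(i' < N) B i i' <= 2 ^- j * rate kap) &
   (forall a c : point R n d, (forall l, l \in I -> eta <= `|(a.2.2 - c.2.2) ord0 l|) ->
      hkernel th (a.2.2 - c.2.2) <= 2 ^- j * rate kap)].

(** The gain from the number of children is [rate k] times a factor that decays exponentially by
    [gs]; this factor absorbs constants and polynomials in [k]. *)
Lemma rateE k : 2 `^ (- ((b * k)%:R * s)) =
  2 `^ (- (b%:R * s - b.+1%:R * g) * k%:R) * rate k.
Proof. by rewrite /rate -powR2D natrM; congr (_ `^ _); ring. Qed.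

Lemma apart_gap (N : nat) (ps : nat -> point R n d) :
  (forall i j, (i < j < N)%N -> apart I (ps i) (ps j)) ->
  exists2 e : R, 0 < e & forall i j, (i < N)%N -> (j < N)%N -> i <> j ->
    forall l, l \in I -> e <= `|(ps i).2.2 ord0 l - (ps j).2.2 ord0 l|.
Proof.
move=> h.
pose D (x : 'I_N * 'I_N * 'I_d) : R :=
  if (x.1.1 != x.1.2) && (x.2 \in I)
  then `|(ps x.1.1).2.2 ord0 x.2 - (ps x.1.2).2.2 ord0 x.2| else 1.
exists (\big[Num.min/1]_x D x).
  apply: lt_bigmin => // -[[i j] l] _; rewrite /D /=.
  case: ifPn => // /andP[ij lI]; rewrite normr_gt0 subr_eq0.
  move: ij; rewrite neq_ltn => /orP[] ij.
    by apply: h => //; rewrite ij ltn_ord.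
  by rewrite eq_sym; apply: h => //; rewrite ij ltn_ord.
move=> i j iN jN /eqP ij l lI.
have := @bigmin_le_cond _ _ _ 1 (Ordinal iN, Ordinal jN, l) xpredT D isT.
by rewrite {2}/D /= lI andbT -val_eqE /= ij.
Qed.

(** As [p] lies in the kernel, the image of its neighbourhood is not box small: at some scale as
    fine as desired it has more than [2^(b kap s)] separated values. Moved into general position,
    the corresponding points are the children. The kernel sum over them is polynomial in [kap], so
    its average is of order [2^-j * rate kap]. *)
Lemma node_step p k eta j : kernel b s Dom p -> 0 < eta ->
  exists S, step_spec p k eta j S.
Proof.
move=> kp eta0.
(* [2^e >= 4 (d+1)^2] serves both the grid of the kernel sum and the size of the perturbation. *)
pose e := (4 * d.+1 * d.+1)%N.
have he : (4 * d.+1 * d.+1 <= 2 ^ e)%N by rewrite ltnW// ltn_expl.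
clearbody e.
pose C : R := 2 * 2 ^+ e * (e + b + 3)%:R.
have C0 : 0 <= C by rewrite !mulr_ge0.
pose A kap := (C * kap.+1%:R) ^+ d.
have A0 kap : 0 <= A kap by rewrite exprn_ge0// mulr_ge0.
have hA kap : (2 * 2 ^+ e * (e + b * kap + 3)%:R) ^+ d <= A kap.
  rewrite /A /C lerXn2r ?nnegrE ?mulr_ge0//.
  rewrite -!mulrA ler_pM2l// ler_pM2l// -natrM ler_nat.
  rewrite !mulnDl mulnS; lia.
(* The two terms pay for passing from the children to arbitrary points below them, and for points
   that are [eta]-apart. *)
pose K : R := 2 ^+ d + (2 / eta) ^+ #|I|.
have K1 : 2 ^+ d <= K by rewrite lerDl exprn_ge0// divr_ge0// ltW.
have K2 : (2 / eta) ^+ #|I| <= K by rewrite lerDr.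
have K0 : 0 < K by apply: lt_le_trans K1.
have x0 : 0 < b%:R * s - b.+1%:R * g by rewrite subr_gt0.
have ej : 0 < 2 ^- j / K :> R by rewrite divr_gt0// invr_gt0.
have [kap0 hkap0] := polynomial_exp2_decay d C0 x0 ej.
have hrate kap : (kap0 <= kap)%N ->
    K * (A kap * 2 `^ (- ((b * kap)%:R * s))) <= 2 ^- j * rate kap.
  move=> /hkap0 h; rewrite rateE (mulrA (A kap)) mulrA ler_wpM2r ?powR_ge0//.
  by rewrite mulrC -ler_pdivlMr.
(* Level [k.+1] instead of [k]: even for [k = 0] every coordinate of a value then differs by less
   than 1 from that of [p]. *)
pose W := nbh Dom k.+1 p `&` kernel b s Dom.
have nW : ~ box_small b s (img W).
  by move=> /box_small_sigma; exact: kernel_nbh.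
have [kap [hkap [zs [hzs szs Nzs]]]] : exists kap, [/\ (maxn j kap0 <= kap)%N &
    exists zs, [/\ forall z, z \in zs -> img W z,
      separated (2 ^- (b * kap)) zs &
      2 `^ ((b * kap)%:R * s) < (size zs)%:R]].
  apply: contrapT => hno; apply: nW; exists (maxn j kap0) => kap hk zs h1 h2.
  rewrite leNgt; apply/negP => h3; apply: hno; exists kap; split => //.
  by exists zs.
have {hkap}[jkap /hrate hK] : (j <= kap)%N /\ (kap0 <= kap)%N.
  by move: hkap; rewrite geq_max => /andP[].
set th := 2 ^- (b * kap) : R in szs *.
have th0 : 0 < th by rewrite invr_gt0.
have th1 : th <= 1 by rewrite invf_le1// exp2_ge1.
pose N := size zs.
have N0 : 0 < N%:R :> R by apply: lt_trans Nzs; exact: powR2_gt0.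
have /choice[ps hps] : forall i, exists q : point R n d, (i < N)%N ->
    W q /\ q.2.2 = nth 0 zs i.
  move=> i; have [iN|_] := ltnP i N; last by exists p.
  by have [q Wq qz] := hzs _ (mem_nth 0 iN); exists q.
have d1 : 1 <= d.+1%:R :> R by rewrite ler1n.
(* The perturbation moves each coordinate by less than [th / (4 (d+1))], so that of the separation
   [th] at least [th / (2 (d+1))] survives. *)
pose k1 := (k + b * kap + e)%N.
have hk1 : 2 ^- k1 <= th / (4 * d.+1%:R) :> R.
  rewrite /k1 /th -invfM lef_pV2 ?posrE ?mulr_gt0//.
  apply: (@le_trans _ _ (2 ^+ (b * kap) * 2 ^+ e)).
    by rewrite ler_pM2l// -natrM -natrX ler_nat (leq_trans _ he)// leq_pmulr.
  by rewrite -exprD ler_eXn2l ?ltr1n// leq_add2r leq_addl.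
have [|ps' [kps' aps']] := @perturb_apart R n d b s Dom I I_small N k1.+1 ps.
  by move=> i /hps[[]].
have ps'_code i : (i < N)%N -> code k.+1 (ps' i) = code k.+1 p.
  move=> iN; have [_ h] := kps' i iN; have [[[_ <-] _] _] := hps i iN.
  by apply: (code_le _ h); rewrite ltnS /k1 -addnA leq_addr.
have ps'_near i : (i < N)%N ->
    forall l, `|(ps' i).2.2 ord0 l - p.2.2 ord0 l| < 1.
  move=> iN l; have := code_dist2 (code_le (isT : (1 <= k.+1)%N) (ps'_code i iN)) l.
  by rewrite expr0 invr1.
pose zs' := mkseq (fun i => (ps' i).2.2) N.
have szs' : separated (th / (2 * d.+1%:R)) zs'.
  apply/(pairwiseP 0) => i i'; rewrite !inE size_mkseq => iN i'N ii'.
  rewrite !nth_mkseq// leNgt; apply/negP => h.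
  have := (pairwiseP 0 szs) i i' iN i'N ii'; rewrite leNgt => /negP; apply.
  set c := enorm _ in h.
  apply: (@le_lt_trans _ _ (d.+1%:R * (c + 2 * 2 ^- k1))).
    apply: enorm_le_coord => [|l].
      by rewrite addr_ge0 ?enorm_ge0// mulr_ge0// invr_ge0 ltW.
    have [_ <-] := hps i iN; have [_ <-] := hps i' i'N; rewrite !mxE.
    have := code_dist2 (kps' i iN).2 l; have := code_dist2 (kps' i' i'N).2 l.
    have := enorm_coord_le ((ps' i).2.2 - (ps' i').2.2) l; rewrite -/c !mxE.
    rewrite !ler_norml !ltr_norml => /andP[h1 h2] /andP[h3 h4] /andP[h5 h6].
    by apply/andP; split; lra.
  rewrite mulrC -ltr_pdivlMr//.
  have e1 : th / (2 * d.+1%:R) = (th / d.+1%:R) / 2.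
    by rewrite [2 * _]mulrC invfM mulrA.
  have e2 : th / (4 * d.+1%:R) = (th / d.+1%:R) / 4.
    by rewrite [4 * _]mulrC invfM mulrA.
  move: hk1 h; rewrite e1 e2.
  have : 0 < th / d.+1%:R by rewrite divr_gt0.
  move: (th / d.+1%:R) (2 ^- k1) => u v; lra.
have Hsum i : (i < N)%N ->
    \sum_(i' < N) hkernel th ((ps' i').2.2 - (ps' i).2.2) <= A kap.
  move=> iN; apply: le_trans (hA kap).
  have := @hkernel_sum_le R d e (b * kap)%N zs' (ps' i).2.2 he.
  rewrite -/th [X in X <= _](_ : _ =
      \sum_(i' < N) hkernel th ((ps' i').2.2 - (ps' i).2.2)); last first.
    by rewrite /zs' /mkseq big_map -{1}(subn0 N) big_mkord.
  apply => // z /mapP[i']; rewrite mem_iota add0n => /andP[_ i'N] -> l.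
  have := ps'_near i iN l; have := ps'_near i' i'N l.
  rewrite !ltr_norml ler_norml => /andP[h1 h2] /andP[h3 h4].
  by apply/andP; split; lra.
have NA x : 0 <= x -> x * N%:R <= A kap -> x <= A kap * 2 `^ (- ((b * kap)%:R * s)).
  move=> x0' hx; rewrite powRN ler_pdivlMr ?powR2_gt0//; apply: le_trans hx.
  by rewrite ler_wpM2l// ltW.
have AK0 : 0 <= A kap * 2 `^ (- ((b * kap)%:R * s)) by rewrite mulr_ge0 ?powR_ge0.
have [eps eps0 heps] := apart_gap aps'.
(* Points below two children are within [2^-k2] of them in each coordinate; as
   [2^-k2 <= 2^-m <= eps / 3], a gap of [2^-k2] remains. *)
pose m := Num.bound (3 / eps).
have hm : 3 * 2 ^- m <= eps.
  rewrite ler_pdivrMr// mulrC -ler_pdivrMr//.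
  apply: (@le_trans _ _ m%:R); last by rewrite ltW// ltr_nat_exp2.
  by rewrite ltW// archi_boundP// divr_ge0// ltW.
pose k2 := (k + b * kap + 1 + m)%N.
have k2th : 2 * 2 ^- k2 <= th.
  rewrite /k2 /th ler_pdivrMr// mulrC ler_pdivlMr// mulrC -exprSr.
  by rewrite ler_eXn2l ?ltr1n// addn1 (leq_trans _ (leq_addr _ _))// ltnS leq_addl.
have k2m : 2 ^- k2 <= 2 ^- m :> R.
  by rewrite lef_pV2 ?posrE// ler_eXn2l ?ltr1n// leq_addl.
exists (Step N ps' k2.+1 (Num.min eta (2 ^- k2)) kap
  (fun i i' => 2 ^+ d * hkernel th ((ps' i).2.2 - (ps' i').2.2))).
split.
- split => //; first by rewrite -(ltr_nat R).
    by rewrite ltnS /k2 -!addnA leq_addr.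
  by rewrite lt_min eta0 invr_gt0 exp2_gt0 ge_min lexx.
- move=> i iN; split; first by have [] := kps' i iN.
  exact: code_le (leqnSn k) (ps'_code i iN).
- move=> i i' iN i'N ii' a c [_ ha] [_ hc] l lI.
  apply: (@le_trans _ _ (2 ^- k2)); first by rewrite ge_min lexx orbT.
  have := heps i i' iN i'N ii' l lI.
  have := code_dist2 ha l; have := code_dist2 hc l; rewrite !mxE.
  rewrite !ltr_norml => /andP[h1 h2] /andP[h3 h4] h5.
  move: h5; rewrite !ler_normr => /orP[h5|h5]; apply/orP; [left|right]; lra.
- split.
    move=> i i' a c iN i'N [_ ha] [_ hc]; apply: hkernel_comp => // l.
    have := code_dist2 ha l; have := code_dist2 hc l; move: k2th; rewrite !mxE -/th.
    move: (2 ^- k2) (th) => u v k2th.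
    rewrite !ltr_norml ler_norml => /andP[h1 h2] /andP[h3 h4].
    by apply/andP; split; lra.
  move=> i iN; apply: le_trans hK; rewrite -mulr_sumr mulrCA.
  apply: (@le_trans _ _ (2 ^+ d * (A kap * 2 `^ (- ((b * kap)%:R * s))))); last first.
    by rewrite ler_wpM2r.
  rewrite ler_pM2l//; apply: NA.
    rewrite mulr_ge0 ?invr_ge0 ?(ltW N0)// sumr_ge0// => i' _.
    by rewrite hkernel_ge0// ltW.
  rewrite mulrAC mulVf ?gt_eqF// mul1r; apply: le_trans (Hsum i iN).
  by apply: ler_sum => i' _; rewrite -hkernelN opprB.
(* The far bound [(th / eta) ^ #|I|] is a constant times [(th / 2) ^ #|I|], which is at most every
   term of the kernel sum and hence at most [A kap / N]. *)
- move=> a c h; apply: le_trans (hkernel_far th0 eta0 h) _; apply: le_trans hK.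
  have -> : (th / eta) ^+ #|I| = (2 / eta) ^+ #|I| * (th / 2) ^+ #|I|.
    by rewrite -exprMn; congr (_ ^+ _); field; rewrite gt_eqF.
  apply: (@le_trans _ _ ((2 / eta) ^+ #|I| * (A kap * 2 `^ (- ((b * kap)%:R * s))))); last first.
    by rewrite ler_wpM2r.
  have e20 : 0 < (2 / eta) ^+ #|I| by rewrite exprn_gt0// divr_gt0.
  rewrite ler_pM2l//; apply: NA; first by rewrite exprn_ge0// divr_ge0// ltW.
  have N0' : (0 < N)%N by rewrite -(ltr_nat R).
  apply: le_trans (Hsum 0%N N0').
  rewrite mulrC mulr_natl -{1}(card_ord N) -sumr_const; apply: ler_sum => i' _.
  apply: hkernel_near => [|l|l lI].
  + rewrite th0/=; lra.
  + have := ps'_near 0%N N0' l; have := ps'_near i' (ltn_ord i') l; rewrite !mxE.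
    rewrite !ltr_norml ler_norml => /andP[h1 h2] /andP[h3 h4].
    by apply/andP; split; lra.
  + rewrite !mxE (@I_const (ps' i') (ps' 0%N)) ?subrr//.
      by have [[]] := kps' i' (ltn_ord i').
    by have [[]] := kps' 0%N N0'.
Qed.

End NodeStep.

Section CauchyDyadic.
Variable R : realType.

(** The intervals of radius [2^-m] around [u m] meet pairwise, so the supremum of their left ends
    lies in all of them. *)
Lemma dyadic_cauchy (u : nat -> R) :
  (forall m m', (m <= m')%N -> `|u m' - u m| <= 2 ^- m) ->
  exists l, forall m, `|l - u m| <= 2 ^- m.
Proof.
move=> h; pose S := [set u m - 2 ^- m | m in [set: nat]].
have ubS m : ubound S (u m + 2 ^- m).
  move=> _ [m' _ <-].
  have [mm'|/ltnW m'm] := leqP m m'.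
    have := h _ _ mm'; rewrite ler_norml => /andP[_].
    have : 0 < 2 ^- m' :> R by rewrite invr_gt0.
    lra.
  have := h _ _ m'm; rewrite ler_norml => /andP[+ _].
  have : 0 < 2 ^- m :> R by rewrite invr_gt0.
  lra.
have hS : has_sup S.
  by split; [exists (u 0%N - 2 ^- 0), 0%N|exists (u 0%N + 2 ^- 0); exact: ubS].
exists (sup S) => m; rewrite ler_norml; apply/andP; split.
  have : u m - 2 ^- m <= sup S by apply: sup_upper_bound => //; exists m.
  lra.
have : sup S <= u m + 2 ^- m by apply: sup_le_ub => //; case: hS.
lra.
Qed.

End CauchyDyadic.

Section Branch.
Variables (R : realType) (n d : nat).
Variable Q : (nat -> nat) -> set ('rV[R]_n * 'rV[R]_d).
Hypothesis cQ : baire_closed Q.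

Definition dom : set (point R n d) := [set p | Q p.1 p.2].

Definition close (m : nat) (p q : point R n d) : Prop :=
  (forall i, `|q.2.1 ord0 i - p.2.1 ord0 i| <= 2 ^- m) /\
  (forall l, `|q.2.2 ord0 l - p.2.2 ord0 l| <= 2 ^- m).

Lemma exp2N_lt (e : R) : 0 < e -> exists m, 2 ^- m < e.
Proof.
move=> e0; exists (Num.bound e^-1); rewrite invf_plt ?posrE//.
apply: lt_trans (ltr_nat_exp2 _ _); apply: archi_boundP.
by rewrite invr_ge0 ltW.
Qed.

(** Entry [j] of the witness is stable from level [j.+1] on, which defines the witness of the limit;
    closedness of [Q] keeps the limit in [dom]. *)
Lemma branch_limit (p : nat -> point R n d) :
  (forall m, dom (p m)) ->
  (forall m m', (m <= m')%N -> code m (p m') = code m (p m)) ->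
  exists q, dom q /\ forall m, close m (p m.+1) q.
Proof.
move=> Dp hp.
have h1 i m m' : (m <= m')%N ->
    `|(p m'.+1).2.1 ord0 i - (p m.+1).2.1 ord0 i| <= 2 ^- m.
  by move=> mm'; apply/ltW/code_dist1/hp.
have h2 i m m' : (m <= m')%N ->
    `|(p m'.+1).2.2 ord0 i - (p m.+1).2.2 ord0 i| <= 2 ^- m.
  by move=> mm'; apply/ltW/code_dist2/hp.
have /choice[t ht] i := dyadic_cauchy (h1 i).
have /choice[y hy] i := dyadic_cauchy (h2 i).
exists (fun j => (p j.+1).1 j, (\row_i t i, \row_i y i)).
have cl m : close m (p m.+1) (fun j => (p j.+1).1 j, (\row_i t i, \row_i y i)).
  by split=> i; rewrite !mxE; [exact: ht|exact: hy].
split => //; apply: cQ => k V /nbhs_ballP[e e0 he].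
have [m0 hm0] := exp2N_lt e0.
pose m := maxn m0 k.
have me : 2 ^- m < e.
  by apply: le_lt_trans hm0; rewrite lef_pV2 ?posrE// ler_eXn2l ?ltr1n// leq_maxl.
exists (p m.+1).1, (p m.+1).2; split; last exact: Dp.
  move=> j jk; have jm : (j.+1 <= m.+1)%N.
    by rewrite ltnS ltnW// (leq_trans jk)// leq_maxr.
  exact: (code_prefix (hp j.+1 m.+1 jm) (ltnSn j)).
apply: he; split; split=> // i j; rewrite /ball /= ord1;
  [have := (cl m).1 j|have := (cl m).2 j]; rewrite !mxE => h;
  exact: le_lt_trans h me.
Qed.

End Branch.

(** * The infinite tree and its averages *)

Section Tree.
Variables (R : realType) (n d b : nat) (s g : R).
Variable Q : (nat -> nat) -> set ('rV[R]_n * 'rV[R]_d).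
Hypothesis cQ : baire_closed Q.
Notation Dom := (dom Q).
Variable I : {pred 'I_d}.
Hypothesis I_small : forall l c, l \in I ->
  psmall b s (Dom `&` [set p : point R n d | p.2.2 ord0 l = c]).
Hypothesis I_const : forall p q, Dom p -> Dom q ->
  forall l, l \notin I -> p.2.2 ord0 l = q.2.2 ord0 l.
Hypothesis gs : b.+1%:R * g < b%:R * s.

(** The real number is a gap: points below the node differ by at least this much, in each coordinate
    of [I], from points of subtrees that were split off earlier. *)
Definition node := (point R n d * nat * R)%type.
Implicit Types v u : node.

Definition valid v := kernel b s Dom v.1.1 /\ 0 < v.2.

Definition below v : set (point R n d) := nbh Dom v.1.2 v.1.1.

Lemma tree_step_ex : exists S : nat -> node -> step R n d,
  forall j v, valid v -> step_spec b s g Dom I v.1.1 v.1.2 v.2 j (S j v).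
Proof.
have /choice[S hS] : forall jv : nat * node, exists S, valid jv.2 ->
    step_spec b s g Dom I jv.2.1.1 jv.2.1.2 jv.2.2 jv.1 S.
  move=> [j v] /=; have [[kv v0]|nv] := pselect (valid v).
    by have [S hS] := node_step I_small I_const gs v.1.2 j kv v0; exists S.
  by exists (Step 0 (fun=> v.1.1) 0 0 0 (fun _ _ => 0)).
by exists (fun j v => S (j, v)) => j v /(hS (j, v)).
Qed.

Definition tstep := projT1 (cid tree_step_ex).
Lemma tstepP j v : valid v -> step_spec b s g Dom I v.1.1 v.1.2 v.2 j (tstep j v).
Proof. exact: (projT2 (cid tree_step_ex)). Qed.

Definition arity j v := st_N (tstep j v).
Definition child j v i : node := (st_ch (tstep j v) i, st_k (tstep j v), st_eta (tstep j v)).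
Definition scale j v := st_scale (tstep j v).

Lemma arity_gt0 j v : valid v -> (0 < arity j v)%N.
Proof. by rewrite /arity => /tstepP-/(_ j); case: (tstep j v) => ? ? ? ? ? ? [[]]. Qed.

Lemma childP j v i : valid v -> (i < arity j v)%N ->
  [/\ valid (child j v i), code v.1.2 (child j v i).1.1 = code v.1.2 v.1.1,
      (v.1.2 < (child j v i).1.2)%N & (child j v i).2 <= v.2].
Proof.
rewrite /arity /child => /tstepP-/(_ j).
case: (tstep j v) => N ch k eta kap B /= [[_ h1 /andP[h2 h3] _] h4 _ _ _] iN.
by have [h5 h6] := h4 i iN.
Qed.

Lemma child_below j v i : valid v -> (i < arity j v)%N ->
  below (child j v i) `<=` below v.
Proof.
move=> vv iN q [Dq hq]; have [_ h1 h2 _] := childP vv iN.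
by split => //; rewrite -h1; apply: code_le hq; exact: ltnW.
Qed.

Lemma below_refl v : valid v -> below v v.1.1.
Proof. by move=> [[Dv _] _]. Qed.

Lemma child_apart j v i i' a c : valid v -> (i < arity j v)%N ->
  (i' < arity j v)%N -> i <> i' -> below (child j v i) a ->
  below (child j v i') c -> forall l, l \in I ->
  (child j v i).2 <= `|(a.2.2 - c.2.2) ord0 l|.
Proof.
rewrite /arity /below /child => /tstepP-/(_ j).
case: (tstep j v) => N ch k eta kap B /= [_ _ h _ _] iN i'N ii' ba bc l lI.
exact: (h i i' iN i'N ii' a c ba bc l lI).
Qed.

Lemma scale_ge j v : valid v -> (j <= scale j v)%N.
Proof. by rewrite /scale => /tstepP-/(_ j); case: (tstep j v) => ? ? ? ? ? ? [[]]. Qed.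

Lemma scale_far j v (a c : point R n d) : valid v ->
  (forall l, l \in I -> v.2 <= `|(a.2.2 - c.2.2) ord0 l|) ->
  hkernel (2 ^- (b * scale j v)) (a.2.2 - c.2.2) <= 2 ^- j * rate b g (scale j v).
Proof.
rewrite /scale => /tstepP-/(_ j).
case: (tstep j v) => N ch k eta kap B /= [_ _ _ _ h] hac; exact: (h a c hac).
Qed.

Lemma scale_sum j v : valid v -> exists B : nat -> nat -> R,
  (forall i i' a c, (i < arity j v)%N -> (i' < arity j v)%N ->
    below (child j v i) a -> below (child j v i') c ->
    hkernel (2 ^- (b * scale j v)) (a.2.2 - c.2.2) <= B i i') /\
  forall i, (i < arity j v)%N ->
    (arity j v)%:R^-1 * \sum_(i' < arity j v) B i i' <= 2 ^- j * rate b g (scale j v).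
Proof.
rewrite /arity /scale /below /child => /tstepP-/(_ j).
by case: (tstep j v) => N ch k eta kap B /= [_ _ _ h _]; exists B.
Qed.

Fixpoint leaves (m j : nat) v : seq (R * node) :=
  if m is m'.+1 then
    flatten [seq [seq ((arity j v)%:R^-1 * wu.1, wu.2) | wu <- leaves m' j.+1 (child j v i)]
            | i <- iota 0 (arity j v)]
  else [:: (1, v)].

(** The integral of [F] against the probability on the nodes [m] levels below [v] that splits mass
    equally at every node. The depth [j] of [v] sets the accuracy required of its step. *)
Definition avg (m j : nat) v (F : node -> R) : R :=
  \sum_(wu <- leaves m j v) wu.1 * F wu.2.

Lemma avg0 j v F : avg 0 j v F = F v.
Proof. by rewrite /avg big_seq1 mul1r. Qed.

Lemma avgS m j v F : avg m.+1 j v F =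
  (arity j v)%:R^-1 * \sum_(i < arity j v) avg m j.+1 (child j v i) F.
Proof.
rewrite /avg /= big_flatten big_map.
have -> : iota 0 (arity j v) = index_iota 0 (arity j v) by rewrite /index_iota subn0.
rewrite big_mkord mulr_sumr.
apply: eq_bigr => i _; rewrite big_map mulr_sumr.
by apply: eq_bigr => -[w u] _ /=; rewrite mulrA.
Qed.

Lemma avg_le m j v F c : valid v ->
  (forall u, valid u -> below v u.1.1 -> F u <= c) -> avg m j v F <= c.
Proof.
elim: m j v => [|m IH] j v vv h.
  by rewrite avg0; apply: h => //; exact: below_refl.
have N0 : 0 < (arity j v)%:R :> R by rewrite ltr0n arity_gt0.
rewrite avgS ler_pdivrMl//.
apply: (@le_trans _ _ (\sum_(i < arity j v) c)).
  apply: ler_sum => i _; have [vc _ _ _] := childP vv (ltn_ord i).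
  apply: IH => // u vu /(child_below vv (ltn_ord i)); exact: h.
by rewrite sumr_const card_ord mulr_natl.
Qed.

Lemma leaves_ge0 m j v wu : wu \in leaves m j v -> 0 <= wu.1.
Proof.
elim: m j v wu => [|m IH] j v wu; first by rewrite inE => /eqP ->.
move=> /flatten_mapP[i _ /mapP[[w u] /IH /= w0 ->]] /=.
by rewrite mulr_ge0// invr_ge0.
Qed.

Lemma leaves_below m j v wu : valid v -> wu \in leaves m j v ->
  valid wu.2 /\ below v wu.2.1.1.
Proof.
elim: m j v wu => [|m IH] j v wu vv.
  by rewrite inE => /eqP -> /=; split => //; exact: below_refl.
move=> /flatten_mapP[i]; rewrite mem_iota add0n => /andP[_ iN].
move=> /mapP[[w u] hw ->] /=; have [vc _ _ _] := childP vv iN.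
by have [vu bu] := IH _ _ _ vc hw; split => //; exact: child_below bu.
Qed.

Lemma avg_mono m j v F G : valid v ->
  (forall u, valid u -> below v u.1.1 -> F u <= G u) -> avg m j v F <= avg m j v G.
Proof.
move=> vv h; rewrite /avg big_seq [leRHS]big_seq; apply: ler_sum => wu hwu.
have [vu bu] := leaves_below vv hwu.
by apply: ler_wpM2l; [exact: (leaves_ge0 hwu)|exact: h].
Qed.

Lemma avgZ m j v F c : avg m j v (fun u => c * F u) = c * avg m j v F.
Proof. by rewrite /avg mulr_sumr; apply: eq_bigr => wu _; rewrite mulrCA. Qed.

Variable root : node.
Hypothesis vroot : valid root.

Fixpoint branch (x : nat -> nat) (m : nat) : node :=
  if m is m'.+1 then child m' (branch x m') (x m') else root.

Definition admissible (x : nat -> nat) := forall m, (x m < arity m (branch x m))%N.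

Section OneBranch.
Variable x : nat -> nat.
Hypothesis ax : admissible x.

Lemma branch_valid m : valid (branch x m).
Proof. by elim: m => //= m vm; have [] := childP vm (ax m). Qed.

Lemma branch_below m m' : (m <= m')%N -> below (branch x m') `<=` below (branch x m).
Proof.
move=> /subnK <-; elim: (m' - m)%N => //= k IH.
exact: subset_trans (child_below (branch_valid _) (ax _)) IH.
Qed.

Lemma branch_eta m m' : (m <= m')%N -> (branch x m').2 <= (branch x m).2.
Proof.
move=> /subnK <-; elim: (m' - m)%N => //= k IH; apply: le_trans IH.
by have [_ _ _] := childP (branch_valid (k + m)%N) (ax _).
Qed.

Lemma branch_level m : (m <= (branch x m).1.2)%N.
Proof.
elim: m => // m IH; have [_ _ h _] := childP (branch_valid m) (ax m).
exact: leq_ltn_trans h.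
Qed.

Lemma branch_code m m' : (m <= m')%N ->
  code m (branch x m').1.1 = code m (branch x m).1.1.
Proof.
move=> mm'; have [_] := branch_below mm' (below_refl (branch_valid m')).
exact/code_le/branch_level.
Qed.

Lemma branch_lim : exists q, Dom q /\ forall m, close m (branch x m.+1).1.1 q.
Proof.
apply: (branch_limit cQ (p := fun m => (branch x m).1.1)).
- by move=> m; have [[]] := branch_valid m.
- exact: branch_code.
Qed.

(** Leaves are sorted by where they part from the branch. Those that leave at a level [i < j] are
    apart from [a] by the gap of node [j], so [scale_far] applies; for those that stay, [scale_sum]
    controls the average over the children of node [j]. An average of quantities at most [c] is at
    most [c], so the cases combine by a maximum, uniformly in [m]. *)
Lemma avg_branch m j (a : point R n d) : (j < m)%N ->
  below (branch x j.+1) a ->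
  avg m 0 root (fun u => hkernel (2 ^- (b * scale j (branch x j))) (a.2.2 - u.1.1.2.2))
  <= 2 ^- j * rate b g (scale j (branch x j)).
Proof.
move=> jm ba; set v := branch x j; set th := 2 ^- _; set c := _ * _.
set F := fun u : node => _.
have vv : valid v by exact: branch_valid.
have [B [hB1 hB2]] := scale_sum j vv.
have avgj : avg (m - j) j v F <= c.
  rewrite -(subnSK jm) avgS; apply: le_trans (hB2 _ (ax j)).
  rewrite ler_wpM2l ?invr_ge0//; apply: ler_sum => i _.
  have [vc _ _ _] := childP vv (ltn_ord i).
  by apply: avg_le => // u vu bu; apply: hB1 => //; exact: ax.
suff h i : (i <= j)%N -> avg m 0 root F <= Num.max c (avg (m - i) i (branch x i) F).
  by apply: le_trans (h j (leqnn j)) _; rewrite ge_max lexx.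
elim: i => [|i IH] ij; first by rewrite subn0 le_max lexx orbT.
apply: le_trans (IH (ltnW ij)) _; rewrite ge_max le_max lexx /=.
have vi := branch_valid i.
have im : (i < m)%N by rewrite (leq_trans ij)// ltnW.
rewrite -(subnSK im) avgS.
have N0 : 0 < (arity i (branch x i))%:R :> R by rewrite ltr0n arity_gt0.
rewrite ler_pdivrMl// -[X in X%:R](card_ord (arity i (branch x i))) mulr_natl.
rewrite -sumr_const; apply: ler_sum => i' _.
have [e|e] := pselect (x i = i').
  by rewrite -e le_max lexx orbT.
rewrite le_max; apply/orP; left.
have [vc _ _ _] := childP vi (ltn_ord i').
apply: avg_le => // u vu bu; apply: scale_far => // l lI.
have ba' : below (child i (branch x i) (x i)) a.
  by have := @branch_below i.+1 j.+1 (leqW ij) a ba.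
apply: le_trans (child_apart vi (ax i) (ltn_ord i') e ba' bu lI).
exact: (@branch_eta i.+1 j ij).
Qed.

Lemma avg_limit q m j : (forall m, close m (branch x m.+1).1.1 q) -> (j < m)%N ->
  avg m 0 root (fun u =>
    hkernel (2 ^- (b * scale j (branch x j))) (q.2.2 - u.1.1.2.2))
  <= 2 ^+ d * (2 ^- j * rate b g (scale j (branch x j))).
Proof.
move=> hq jm; set kap := scale _ _.
(* At depth [M.+1] the branch is within the kernel width of [q] and still below its node of depth
   [j.+1], as [avg_branch] requires. *)
pose M := (j + b * kap)%N.
have [hq1 hq2] := hq M.
pose a := (branch x M.+1).1.1.
apply: (@le_trans _ _ (2 ^+ d * avg m 0 root (fun u => hkernel (2 ^- (b * kap)) (a.2.2 - u.1.1.2.2)))).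
  rewrite -avgZ; apply: avg_mono => // u vu _; apply: hkernel_comp.
    by rewrite invr_gt0.
  move=> l; rewrite !mxE.
  have -> : a.2.2 ord0 l - u.1.1.2.2 ord0 l - (q.2.2 ord0 l - u.1.1.2.2 ord0 l) =
    - (q.2.2 ord0 l - a.2.2 ord0 l) by ring.
  rewrite normrN; apply: le_trans (hq2 l) _.
  by rewrite lef_pV2 ?posrE// ler_eXn2l ?ltr1n// leq_addl.
rewrite ler_pM2l//; apply: avg_branch => //.
apply: (@branch_below j.+1 M.+1); first by rewrite ltnS leq_addr.
exact/below_refl/branch_valid.
Qed.

End OneBranch.
End Tree.

(** * The measure carried by the tree *)

Section LebesgueImage.
Variables (R : realType) (n : nat).
Local Open Scope ereal_scope.

Lemma le_lebesgue_measure (A B : set R) : A `<=` B ->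
  lebesgue_measure A <= lebesgue_measure B.
Proof.
move=> AB; rewrite /lebesgue_measure /lebesgue_stieltjes_measure /measure_extension.
exact: le_mu_ext.
Qed.

Variable phi : R -> borelRV R n.
Hypothesis mphi : measurable_fun [set: R] phi.

Definition lebesgue_image (S : set (borelRV R n)) : \bar R :=
  lebesgue_measure (phi @^-1` S `&` `[0%R, 1%R[%classic).

Let image0 : lebesgue_image set0 = 0.
Proof. by rewrite /lebesgue_image preimage_set0 set0I measure0. Qed.

Let image_ge0 A : 0 <= lebesgue_image A.
Proof. exact: measure_ge0. Qed.

Let image_sigma_additive : semi_sigma_additive lebesgue_image.
Proof.
move=> F mF tF mUF; rewrite /lebesgue_image preimage_bigcup setI_bigcupl.
have mpre i : measurable (phi @^-1` F i `&` `[0%R, 1%R[%classic).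
  by apply: measurableI => //; rewrite -[X in measurable X]setTI; exact: mphi.
apply: measure_semi_sigma_additive => //.
- apply/trivIsetP => /= i j _ _ ij; rewrite setIACA -preimage_setI.
  by move/trivIsetP : tF => /(_ _ _ _ _ ij) ->//; rewrite preimage_set0 set0I.
- exact: bigcupT_measurable.
Qed.

HB.instance Definition _ := isMeasure.Build _ _ _
  lebesgue_image image0 image_ge0 image_sigma_additive.

Let image_setT : lebesgue_image setT = 1%E.
Proof.
rewrite /lebesgue_image preimage_setT setTI lebesgue_measure_itv/= lte01.
by rewrite oppr0 adde0.
Qed.

HB.instance Definition _ :=
  @Measure_isProbability.Build _ _ R lebesgue_image image_setT.

Lemma lebesgue_image_prob : exists mu : probability (borelRV R n) R,
  forall S, mu S = lebesgue_measure (phi @^-1` S `&` `[0%R, 1%R[%classic).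
Proof. by exists lebesgue_image. Qed.

End LebesgueImage.

Section Coding.
Variables (R : realType) (T : Type) (arity : nat -> T -> nat).
Variables (child : nat -> T -> nat -> T) (valid : T -> Prop).
Hypothesis arity_gt0 : forall j v, valid v -> (0 < arity j v)%N.
Hypothesis child_valid : forall j v i, valid v -> (i < arity j v)%N ->
  valid (child j v i).
Variable avg : nat -> nat -> T -> (T -> R) -> R.
Hypothesis avg0 : forall j v F, avg 0 j v F = F v.
Hypothesis avgS : forall m j v F, avg m.+1 j v F =
  (arity j v)%:R^-1 * \sum_(i < arity j v) avg m j.+1 (child j v i) F.

(* [(v, L, W)] : the node [v] owns the interval [[L, L + W[], which is cut into
   [arity j v] equal pieces owned by the children of [v]. *)
Let state := (T * R * R)%type.
Let dig j (st : state) (r : R) : nat :=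
  Num.truncn ((r - st.1.2) * ((arity j st.1.1)%:R / st.2)).
Let adv j (st : state) (r : R) : state :=
  (child j st.1.1 (dig j st r),
   st.1.2 + (dig j st r)%:R * (st.2 / (arity j st.1.1)%:R),
   st.2 / (arity j st.1.1)%:R).
Fixpoint run (m j : nat) (st : state) (r : R) : state :=
  if m is m'.+1 then run m' j.+1 (adv j st r) r else st.

Let good (st : state) (r : R) :=
  [/\ valid st.1.1, 0 < st.2 & st.1.2 <= r < st.1.2 + st.2].

Let dig_eq j v (L W r : R) i : valid v -> 0 < W -> (i < arity j v)%N ->
  L + i%:R * (W / (arity j v)%:R) <= r <
    L + i%:R * (W / (arity j v)%:R) + W / (arity j v)%:R ->
  dig j (v, L, W) r = i.
Proof.
move=> vv W0 iN h; have N0 : 0 < (arity j v)%:R :> R by rewrite ltr0n arity_gt0.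
have WN : 0 < W / (arity j v)%:R by rewrite divr_gt0.
apply/eqP; rewrite /dig /= -[_ / W]invf_div truncn_eq; last first.
  rewrite mulr_ge0 ?invr_ge0 ?(ltW WN)// subr_ge0.
  move: h => /andP[+ _]; apply: le_trans; rewrite lerDl mulr_ge0 ?(ltW WN)//.
rewrite ler_pdivlMr// ltr_pdivrMr// -natr1 mulrDl mul1r.
by move: h => /andP[h1 h2]; apply/andP; split; lra.
Qed.

Let dig_lt j st r : good st r -> (dig j st r < arity j st.1.1)%N /\
  st.1.2 + (dig j st r)%:R * (st.2 / (arity j st.1.1)%:R) <= r <
    st.1.2 + (dig j st r)%:R * (st.2 / (arity j st.1.1)%:R) +
    st.2 / (arity j st.1.1)%:R.
Proof.
case: st => [[v L] W] [/= vv W0 /andP[h1 h2]].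
have N0 : 0 < (arity j v)%:R :> R by rewrite ltr0n arity_gt0.
have WN : 0 < W / (arity j v)%:R by rewrite divr_gt0.
have x0 : 0 <= (r - L) * ((arity j v)%:R / W).
  by rewrite mulr_ge0 ?divr_ge0 ?(ltW N0) ?(ltW W0)// subr_ge0.
have := truncn_itv x0; rewrite -/(dig j (v, L, W) r).
set i := dig _ _ _; rewrite -[_ / W]invf_div ler_pdivlMr// ltr_pdivrMr//.
rewrite -natr1 mulrDl mul1r => /andP[h3 h4]; split; last first.
  by apply/andP; split; lra.
rewrite -(ltr_nat R); have : i%:R * (W / (arity j v)%:R) < W by lra.
by rewrite mulrCA gtr_pMr// ltr_pdivrMr// mul1r.
Qed.

Let adv_good j st r : good st r -> good (adv j st r) r.
Proof.
move=> gst; have [h1 h2] := dig_lt j gst; case: gst => vv W0 _.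
split => /=; [exact: child_valid| |exact: h2].
by rewrite divr_gt0// ltr0n arity_gt0.
Qed.

Let runS m j st r : run m.+1 j st r = adv (j + m) (run m j st r) r.
Proof.
elim: m j st => [|m IH] j st; first by rewrite addn0.
by rewrite -[RHS]/(adv _ (run m j.+1 (adv j st r) r) r) addnS -addSn -IH.
Qed.

Let run_good m j st r : good st r -> good (run m j st r) r.
Proof. by elim: m j st => //= m IH j st /(adv_good j)/IH. Qed.

Let owned m j v (L W : R) (Pr : T -> Prop) : set R :=
  [set r | L <= r < L + W /\ Pr (run m j (v, L, W) r).1.1].

Let ind (Pr : T -> Prop) (u : T) : R := (`[< Pr u >])%:R.

Let ownedP m j v (L W : R) (Pr : T -> Prop) : valid v -> 0 < W ->
  measurable (owned m j v L W Pr) /\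
  lebesgue_measure (owned m j v L W Pr) = (W * avg m j v (ind Pr))%:E.
Proof.
elim: m j v L W => [|m IH] j v L W vv W0.
  have [Pv|nPv] := pselect (Pr v).
    have -> : owned 0 j v L W Pr = `[L, (L + W)[%classic.
      by apply/seteqP; split=> r; rewrite /owned /= in_itv/=; [case|split].
    split => //; rewrite lebesgue_measure_itv/= lte_fin ltrDl W0 avg0 /ind.
    by rewrite asboolT// mulr1 -EFinB addrC addKr.
  have -> : owned 0 j v L W Pr = set0.
    by apply/seteqP; split=> r //= -[].
  by split => //; rewrite measure0 avg0 /ind asboolF// mulr0.
have N0 : 0 < (arity j v)%:R :> R by rewrite ltr0n arity_gt0.
have WN : 0 < W / (arity j v)%:R by rewrite divr_gt0.
pose E (i : 'I_(arity j v)) := owned m j.+1 (child j v i)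
  (L + i%:R * (W / (arity j v)%:R)) (W / (arity j v)%:R) Pr.
have hE (i : 'I_(arity j v)) := IH j.+1 (child j v i) (L + i%:R * (W / (arity j v)%:R))
   (W / (arity j v)%:R) (child_valid vv (ltn_ord i)) WN.
have advE (i : 'I_(arity j v)) r : L + i%:R * (W / (arity j v)%:R) <= r <
    L + i%:R * (W / (arity j v)%:R) + W / (arity j v)%:R ->
    adv j (v, L, W) r = (child j v i, L + i%:R * (W / (arity j v)%:R), W / (arity j v)%:R).
  by move=> h; rewrite /adv (dig_eq vv W0 (ltn_ord i) h).
have -> : owned m.+1 j v L W Pr = \big[setU/set0]_(i < arity j v) E i.
  apply/seteqP; split=> r.
    move=> -[rLW Pr_r]; have gr : good (v, L, W) r by [].
    have [h1 h2] := dig_lt j gr; rewrite -bigcup_seq.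
    by exists (Ordinal h1); [exact: mem_index_enum|split].
  rewrite -bigcup_seq => -[i _] [h1 h2]; split; last by rewrite /= (advE i r h1).
  have := ltn_ord i; rewrite -(ler_nat R) -natr1 => iN.
  have e : (arity j v)%:R * (W / (arity j v)%:R) = W by rewrite mulrC divfK// gt_eqF.
  have := ler_wpM2r (ltW WN) iN; rewrite e mulrDl mul1r.
  have : 0 <= i%:R * (W / (arity j v)%:R) by rewrite mulr_ge0 ?(ltW WN).
  move: h1 => /andP[h1 h3] h4 h5.
  by apply/andP; split; lra.
split.
  by apply: bigsetU_measurable => i _; have [] := hE i.
rewrite measure_semi_additive_ord//.
- rewrite avgS mulrA mulr_sumr -sumEFin; apply: eq_bigr => i _.
  exact: (hE i).2.
- by move=> i; have [] := hE i.
- apply/trivIsetP => i i' _ _ ii'; apply/seteqP; split=> [r [[h1 _] [h2 _]]|r []].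
  have /(congr1 (fun st : state => st.1.2)) := advE i r h1.
  rewrite (advE i' r h2) /= => /addrI.
  move=> /(mulIf (lt0r_neq0 WN)) /eqP; rewrite eqr_nat => /eqP e.
  by move/eqP: ii'; apply; apply/val_inj.
- by apply: bigsetU_measurable => i _; have [] := hE i.
Qed.

Variable root : T.
Hypothesis vroot : valid root.

Fixpoint tree_branch (x : nat -> nat) (m : nat) : T :=
  if m is m'.+1 then child m' (tree_branch x m') (x m') else root.

(** An expansion in variable base: at each node [r] selects the child whose subinterval contains it.
    The numbers that lead to a node fill the interval it owns, whose length is its weight in
    [avg]. *)
Lemma tree_coding : exists x : R -> nat -> nat,
  (forall r, 0 <= r < 1 -> forall m, (x r m < arity m (tree_branch (x r) m))%N) /\
  forall m (Pr : T -> Prop),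
    let E := [set r | 0 <= r < 1 /\ Pr (tree_branch (x r) m)] in
    measurable E /\
    lebesgue_measure E = (avg m 0 root (fun u => (`[< Pr u >])%:R))%:E.
Proof.
pose st0 : state := (root, 0, 1).
pose x r m := dig m (run m 0 st0 r) r.
have xE r m : tree_branch (x r) m = (run m 0 st0 r).1.1.
  by elim: m => // m IH; rewrite runS add0n /= IH.
exists x; split=> [r r01 m|m Pr].
  rewrite xE; apply: (dig_lt _ _).1; apply: run_good; split => //=.
  by rewrite add0r.
have [h1 h2] := @ownedP m 0 root 0 1 Pr vroot ltr01.
have e : [set r | 0 <= r < 1 /\ Pr (tree_branch (x r) m)] = owned m 0 root 0 1 Pr.
  by apply/seteqP; split=> r /=; rewrite /owned /= add0r xE.
by rewrite e; split => //; rewrite h2 mul1r.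
Qed.

End Coding.

Section LiminfSets.
Variable R : realType.
Local Open Scope ereal_scope.

(** [S] may be any set: [lebesgue_measure] is monotone as an outer measure, and continuity from
    below is applied to the measurable sets [G M]. *)
Lemma lebesgue_liminf (E : nat -> set R) (S : set R) :
  (forall m, measurable (E m)) ->
  S `<=` \bigcup_M \bigcap_(m in [set m | (M <= m)%N]) E m ->
  lebesgue_measure S <= limn_einf (fun m => lebesgue_measure (E m)).
Proof.
move=> mE hS.
pose G M := \bigcap_(m in [set m | (M <= m)%N]) E m.
have mG M : measurable (G M).
  by apply: bigcap_measurable => [|k _ //]; exists M => /=.
apply: (le_trans (le_lebesgue_measure hS)).
have ndG : nondecreasing_seq G.
  move=> M M' MM'; apply/subsetPset => r Gr m /= M'm; apply: Gr.
  exact: leq_trans M'm.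
have cG : lebesgue_measure (G M) @[M --> \oo] --> lebesgue_measure (\bigcup_M G M).
  by apply: nondecreasing_cvg_mu => //; exact: bigcupT_measurable.
rewrite limn_einf_lim -(cvg_lim _ cG)//.
apply: lee_lim; [by apply/cvg_ex; eexists; exact: cG|exact: is_cvg_einfs|].
apply: nearW => M; apply: le_ereal_inf_tmp => _ [m /= Mm <-].
by apply: le_lebesgue_measure => r; apply.
Qed.

Lemma limn_einf_le (u : nat -> \bar R) (c : \bar R) M :
  (forall m, (M <= m)%N -> u m <= c) -> limn_einf u <= c.
Proof.
move=> h; rewrite limn_einf_lim; apply: lime_le; first exact: is_cvg_einfs.
apply: nearW => k; apply: (@le_trans _ _ (u (maxn M k))); last first.
  by apply: h; rewrite leq_maxl.
by apply: ereal_inf_lbound; exists (maxn M k) => //=; rewrite leq_maxr.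
Qed.

End LiminfSets.

Section Weighted.
Variables (R : realType) (n d : nat).

Definition weighted (F : 'rV[R]_n -> R) (ws : seq (R * 'rV[R]_n)) : R :=
  \sum_(wu <- ws) wu.1 * F wu.2.

Definition hits (z : 'rV[R]_n -> 'rV[R]_d) (y : 'rV[R]_d) (e : R)
    (u : 'rV[R]_n) : bool :=
  [forall l, `|z u ord0 l - y ord0 l| <= e].

End Weighted.

Section TreeMeasure.
Variables (R : realType) (n d b : nat) (s g : R).
Variable Q : (nat -> nat) -> set ('rV[R]_n * 'rV[R]_d).
Hypothesis cQ : baire_closed Q.
Notation Dom := (dom Q).
Variable I : {pred 'I_d}.
Hypothesis I_small : forall l c, l \in I ->
  psmall b s (Dom `&` [set p : point R n d | p.2.2 ord0 l = c]).
Hypothesis I_const : forall p q, Dom p -> Dom q ->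
  forall l, l \notin I -> p.2.2 ord0 l = q.2.2 ord0 l.
Hypothesis gs : b.+1%:R * g < b%:R * s.
Variables (A : set 'rV[R]_n) (z0 : 'rV[R]_n -> 'rV[R]_d).
Hypothesis domA : forall p, Dom p -> A p.2.1 /\ p.2.2 = z0 p.2.1.

Notation node := (node R n d).
Notation valid := (@valid R n d b s Q).
Notation arity := (arity I_small I_const gs).
Notation child := (child I_small I_const gs).
Notation avg := (avg I_small I_const gs).
Notation leaves := (leaves I_small I_const gs).
Notation scale := (scale I_small I_const gs).
Variable root : node.
Hypothesis vroot : valid root.
Hypothesis root1 : root.1.2 = 1%N.
Notation branch := (branch I_small I_const gs root).
Notation admissible := (admissible I_small I_const gs root).

Definition branch_point (y : nat -> nat) (q : point R n d) : Prop :=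
  [/\ admissible y, Dom q & forall m, close m (branch y m.+1).1.1 q].

Definition limit_set : set 'rV[R]_n :=
  [set t | exists y q, branch_point y q /\ q.2.1 = t].

Lemma branch_eq y y' m : (forall k, (k < m)%N -> y k = y' k) ->
  branch y m = branch y' m.
Proof.
elim: m => //= m IH h; rewrite (h m)// IH// => k km.
by apply: h; rewrite ltnS ltnW.
Qed.

(* By Koenig's lemma: some child of each node is passed by limits accumulating
   at [t]. *)
Lemma limit_set_closed : closed limit_set.
Proof.
move=> t ct.
(* The invariant of the construction: branches that follow [y] for [m] steps have limits arbitrarily
   near [t]. *)
pose near (y : nat -> nat) m k := exists y' q, [/\ branch_point y' q,
  (forall i, (i < m)%N -> y' i = y i) &
  forall i, `|q.2.1 ord0 i - t ord0 i| <= 2 ^- k].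
pose upd (y : nat -> nat) m i := fun k => if k == m then i else y k.
have step y m : (forall k, near y m k) -> exists i, forall k, near (upd y m i) m.+1 k.
  move=> h; apply: contrapT => /forallNP hno.
  have /choice[kk hkk] i : exists k, ~ near (upd y m i) m.+1 k.
    exact/existsNP/hno.
  pose N := arity m (branch y m).
  (* The node has finitely many children, so a single [k] refutes all of them. *)
  pose k := (\max_(i < N) kk (nat_of_ord i)).
  have [y' [q [bq yy' hq]]] := h k.
  have y'N : (y' m < N)%N.
    by have [ay' _ _] := bq; rewrite /N -(branch_eq yy').
  apply: (hkk (y' m)); exists y', q; split => //.
    move=> i im; rewrite /upd; case: eqVneq => [->//|im'].
    by apply: yy'; move: im; rewrite ltnS leq_eqVlt (negbTE im').
  move=> i; apply: (le_trans (hq i)); rewrite lef_pV2 ?posrE// ler_eXn2l ?ltr1n//.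
  exact: (@leq_bigmax _ (fun i : 'I_N => kk i) (Ordinal y'N)).
have /choice[F hF] : forall ym : (nat -> nat) * nat, exists i,
    (forall k, near ym.1 ym.2 k) -> forall k, near (upd ym.1 ym.2 i) ym.2.+1 k.
  move=> [y m] /=; have [h|nh] := pselect (forall k, near y m k); last by exists 0%N.
  by have [i hi] := step y m h; exists i.
pose ys := fix ys m := if m is m'.+1 then upd (ys m') m' (F (ys m', m')) else fun=> 0%N.
have near_ys m : forall k, near (ys m) m k.
  elim: m => [k|m IH]; last exact: (hF (ys m, m)).
  have nb : nbhs t [set u : 'rV[R]_n | forall i, `|u ord0 i - t ord0 i| <= 2 ^- k].
    apply/nbhs_ballP; exists (2 ^- k); rewrite /= ?invr_gt0//.
    move=> u [_ hu] i; have := hu ord0 i; rewrite /ball /= => h.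
    by rewrite distrC ltW.
  have [u [[y [q [bq qu]]] hu]] := ct _ nb.
  by exists y, q; split => //; rewrite qu.
pose y k := ys k.+1 k.
have ysE m k : (k < m)%N -> ys m k = y k.
  elim: m => // m IH; rewrite ltnS leq_eqVlt => /orP[/eqP -> //|km].
  by rewrite -(IH km) -[LHS]/(if k == m then F (ys m, m) else ys m k) ltn_eqF.
have ay : admissible y.
  move=> m; have [y' [q [[ay' _ _] h _]]] := near_ys m.+1 0%N.
  have h' k : (k < m.+1)%N -> y k = y' k by move=> km; rewrite h// ysE.
  rewrite (h' m)// (@branch_eq y y') => [|k km]; first exact: ay'.
  by apply: h'; rewrite ltnS ltnW.
have [q [Dq hq]] := branch_lim cQ vroot ay.
exists y, q; split => //; apply/rowP => i; apply/eqP; rewrite -subr_eq0 -normr_le0.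
apply/ler_addgt0Pr => e e0; rewrite add0r.
have [m hm] := @exp2N_lt R (e / 3) (divr_gt0 e0 (ltr0n _ 3)).
have [y' [q' [[ay' _ hq'] h hk]]] := near_ys m.+1 m.
have h' k : (k < m.+1)%N -> y k = y' k by move=> km; rewrite h// ysE.
have := (hq m).1 i; rewrite (branch_eq h').
have := (hq' m).1 i; have := hk i; rewrite !ler_norml.
move=> /andP[h1 h2] /andP[h3 h4] /andP[h5 h6]; apply/andP; split; lra.
Qed.

Lemma limit_set_sub : limit_set `<=` A.
Proof. by move=> t [y [q [[_ Dq _] <-]]]; have [] := domA Dq. Qed.

(** By [root1] the root fixes a cell of side 1, which confines the tree and makes the support of its
    measure compact. *)
Lemma limit_set_near t : limit_set t -> forall i,
  `|t ord0 i - root.1.1.2.1 ord0 i| <= 2.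
Proof.
move=> [y [q [[ay _ hq] <-]]] i; have := (hq 0%N).1 i.
have : below Q root (branch y 1).1.1.
  apply: (@branch_below _ _ _ _ _ _ _ _ I_small I_const gs root vroot y ay 0 1) => //.
  exact/below_refl/(branch_valid vroot ay).
rewrite /below root1 => -[_ /code_dist1 /(_ i)]; rewrite expr0 invr1.
rewrite ltr_norml !ler_norml => /andP[h1 h2] /andP[h3 h4].
by apply/andP; split; lra.
Qed.

Lemma limit_set_bounded : bounded_set limit_set.
Proof.
exists (2 + `|root.1.1.2.1|); split; first by rewrite realD.
move=> x hx t /limit_set_near ht; apply: le_trans (ltW hx).
rewrite -[t](subrK root.1.1.2.1); apply: (le_trans (ler_normD _ _)).
rewrite lerD2r {1}/Num.Def.normr /= mx_normrE; apply/bigmax_leP; split => //.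
by move=> [i j] _ /=; rewrite ord1 !mxE.
Qed.

Definition leaf_points (m : nat) : seq (R * 'rV[R]_n) :=
  [seq (wu.1, wu.2.1.1.2.1) | wu <- leaves m 0 root].

Lemma leaf_points_ge0 m wu : wu \in leaf_points m -> 0 <= wu.1.
Proof. by move=> /mapP[wv /leaves_ge0 ? ->]. Qed.

Lemma leaf_points_le1 m : weighted (fun=> 1) (leaf_points m) <= 1.
Proof.
have := @avg_le _ _ _ _ _ _ _ _ I_small I_const gs m 0 root (fun=> 1) 1 vroot.
by rewrite /weighted /leaf_points big_map; apply.
Qed.

Lemma leaf_points_dom m wu : wu \in leaf_points m ->
  exists2 p, Dom p & p.2.1 = wu.2.
Proof.
move=> /mapP[wv /(leaves_below vroot)[[[Dw _] _] _] ->].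
by exists wv.2.1.1.
Qed.

Lemma leaf_points_bound t j : limit_set t -> exists2 k, (j <= k)%N & forall m,
  (j < m)%N -> weighted (fun u => hkernel (2 ^- (b * k)) (z0 t - z0 u))
    (leaf_points m) <= 2 ^+ d * (2 ^- j * rate b g k).
Proof.
move=> [y [q [[ay Dq hq] <-]]]; exists (scale j (branch y j)).
  exact/scale_ge/(branch_valid vroot ay).
move=> m jm; apply: le_trans (avg_limit vroot ay hq jm).
rewrite /weighted /leaf_points big_map /avg big_seq [leRHS]big_seq; apply: ler_sum => wv hwv /=.
have [[[Dw _] _] _] := leaves_below vroot hwv.
by rewrite -(domA Dq).2 -(domA Dw).2.
Qed.

(** [mu] is the law of the limit of the branch coded by a uniform number in [[0, 1[]. In the last
    clause [z] and [z0] may be discontinuous, but all leaves lie in [Dom], so [z0] at the leaves of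
    a branch converges to [z0] at its limit, and [z - z0] is continuous. Thus a limit point counted
    on the left is hit by the leaves of its branch from some depth on. *)
Lemma tree_measure_root : exists mu : probability (borelRV R n) R,
  [/\ Pc A mu, {ae mu, forall t, limit_set t} &
   forall z : 'rV[R]_n -> 'rV[R]_d, continuous (fun t => z t - z0 t) ->
   forall (zt : 'rV[R]_d) (e : R), 0 < e ->
   (mu [set t : borelRV R n | (enorm (z t - zt) <= e)%R] <=
    limn_einf (fun m => (weighted (fun u => (hits z zt (2 * e) u)%:R)
      (leaf_points m))%:E))%E].
Proof.
have [x [ax hx]] := @tree_coding R _ arity child valid
  (fun j v => @arity_gt0 _ _ _ _ _ _ _ _ I_small I_const gs j v)
  (fun j v i vv iN => let: And4 h _ _ _ := childP vv iN in h)
  avg (avg0 I_small I_const gs) (avgS I_small I_const gs) root vroot.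
have brE r m : tree_branch child root (x r) m = branch (x r) m.
  by elim: m => //= m ->.
have {}ax r : 0 <= r < 1 -> admissible (x r).
  by move=> r01 m; have := ax r r01 m; rewrite brE.
have {}hx m (Pr : node -> Prop) : measurable [set r | 0 <= r < 1 /\ Pr (branch (x r) m)] /\
    lebesgue_measure [set r | 0 <= r < 1 /\ Pr (branch (x r) m)] =
    (avg m 0 root (fun u => (`[< Pr u >])%:R))%:E.
  have e : [set r | 0 <= r < 1 /\ Pr (tree_branch child root (x r) m)] =
      [set r | 0 <= r < 1 /\ Pr (branch (x r) m)].
    by apply/seteqP; split=> r /=; rewrite brE.
  by have := hx m Pr; rewrite /= e.
have /choice[q hq] r : exists q, 0 <= r < 1 -> branch_point (x r) q.
  have [r01|nr] := pselect (0 <= r < 1); last by exists root.1.1.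
  by have [q [Dq hq]] := branch_lim cQ vroot (ax r r01); exists q => _; split => //; exact: ax.
(* The value outside [[0, 1[] is a default that carries no mass. *)
pose phi r : borelRV R n := if 0 <= r < 1 then (q r).2.1 else root.1.1.2.1.
have itvE : `[0, 1[%classic = [set r : R | 0 <= r < 1].
  by apply/seteqP; split => r; rewrite /= in_itv.
have mC C : closed C -> measurable (phi @^-1` C).
  move=> cC.
  (* As [C] is closed, [phi r] lies in it iff [C] comes within [2^-m] of every branch point of depth
     [m.+1], a condition on a finite part of the branch for each [m]. *)
  pose Pr m (u : node) := exists2 c, C c &
    forall i, `|c ord0 i - u.1.1.2.1 ord0 i| <= 2 ^- m.
  have -> : phi @^-1` C =
      (\bigcap_m [set r | 0 <= r < 1 /\ Pr m (branch (x r) m.+1)]) `|`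
      ((if `[< C root.1.1.2.1 >] then setT else set0) `\` `[0, 1[%classic).
    apply/seteqP; split=> r /=; rewrite /phi.
      case: ifPn => [r01 Cr|r01 Cr].
        left=> m _; split => //; exists (q r).2.1 => // i.
        by have [_ _ hc] := hq r r01; have [] := hc m.
      by right; rewrite asboolT// in_itv /=; split => //; apply/negP.
    move=> [h|[]]; last first.
      rewrite in_itv /= => + /negP/negbTE ->; by case: asboolP.
    have r01 := (h 0%N Logic.I).1; rewrite r01; apply: cC => V /nbhs_ballP[e e0 he].
    have [m hm] := @exp2N_lt R (e / 2) (divr_gt0 e0 (ltr0n _ 2)).
    have [_ [c Cc hc]] := h m Logic.I; exists c; split => //; apply: he.
    split => // i i'; rewrite /ball /= ord1.
    have [_ _ hcl] := hq r r01; have := (hcl m).1 i'; have := hc i'.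
    rewrite !ler_norml ltr_norml => /andP[h1 h2] /andP[h3 h4].
    by apply/andP; split; lra.
  apply: measurableU.
    by apply: bigcapT_measurable => m; exact: (hx m.+1 (Pr m)).1.
  by apply: measurableD => //; case: ifP.
have mphi : measurable_fun [set: R] phi.
  apply: (measurability (@open 'rV[R]_n : set (set (borelRV R n)))) => //.
  move=> _ [U oU <-]; rewrite setTI -[U]setCK preimage_setC.
  exact: (measurableC (mC _ (open_closedC oU))).
have [mu hmu] := lebesgue_image_prob mphi.
have phiK r : 0 <= r < 1 -> limit_set (phi r).
  by move=> r01; rewrite /phi r01; exists (x r), (q r); split => //; exact: hq.
have muK : mu (~` limit_set) = 0%E.
  rewrite hmu (_ : _ `&` _ = set0) ?measure0//; apply/seteqP; split=> // r [].
  by rewrite itvE => + /phiK.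
have oK : open (~` limit_set) by apply: closed_openC; exact: limit_set_closed.
exists mu; split.
- have sK : msupport mu `<=` limit_set.
    move=> t ht; apply: contrapT => nK; have := ht _ oK nK; by rewrite muK ltxx.
  split; last exact: subset_trans sK limit_set_sub.
  apply: bounded_closed_compact.
    have [M [Mr hM]] := limit_set_bounded.
    by exists M; split => // x0 Mx t /sK; exact: hM.
  move=> t ct U oU Ut; have [t' [ht' Ut']] := ct U (open_nbhs_nbhs (conj oU Ut)).
  exact: ht'.
- exists (~` limit_set); split => //; exact: sub_sigma_algebra.
- move=> z cz zt e e0; rewrite hmu.
  pose Pr (u : node) := hits z zt (2 * e) u.1.1.2.1.
  have -> : (fun m => (weighted (fun u => (hits z zt (2 * e) u)%:R)
      (leaf_points m))%:E) =
      (fun m => lebesgue_measure [set r | 0 <= r < 1 /\ Pr (branch (x r) m)]).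
    apply/funext => m; rewrite (hx m Pr).2 /weighted /leaf_points big_map /avg.
    by congr (_%:E); apply: eq_bigr => wu _; rewrite asboolb.
  apply: lebesgue_liminf => [m|r]; first exact: (hx m Pr).1.
  rewrite itvE => -[/= + r01]; rewrite /phi r01 => hr.
  have [ar Dq hcl] := hq r r01.
  (* The radius [2 e] of [hits] is spent as [e] for the ball, [e / 2] for [z - z0] and [e / 2] for
     [z0] along the branch. *)
  have e2 : 0 < e / 2 by lra.
  have := cz (q r).2.1 _ (nbhsx_ballx (z (q r).2.1 - z0 (q r).2.1) (e / 2) e2).
  move=> /nbhs_ballP[dl dl0 hdl].
  have [m0 hm0] := exp2N_lt dl0; have [m1 hm1] := exp2N_lt e2.
  exists (maxn m0 m1).+1 => // -[|m] //=; rewrite ltnS geq_max => /andP[m0m m1m].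
  split => //; apply/forallP => l; set u := child _ _ _.
  have hu : close m u.1.1 (q r) by exact: hcl.
  have Du : Dom u.1.1 by have [[]] := branch_valid vroot ar m.+1.
  have mle k : (k <= m)%N -> 2 ^- m <= 2 ^- k :> R.
    by move=> km; rewrite lef_pV2 ?posrE// ler_eXn2l ?ltr1n.
  have : ball (q r).2.1 dl u.1.1.2.1.
    split => // i i'; rewrite /ball /= ord1; apply: le_lt_trans (hu.1 i') _.
    exact: le_lt_trans (mle _ m0m) hm0.
  move=> /hdl [_ /(_ ord0 l)]; rewrite /ball /= !mxE -(domA Du).2 -(domA Dq).2.
  have := hu.2 l; have := le_lt_trans (mle _ m1m) hm1.
  have := le_trans (enorm_coord_le _ l) hr; rewrite !mxE.
  move=> h1 h2 h3; have {h2}h3 := le_lt_trans h3 h2; move: h1 h3.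
  rewrite !ltr_norml !ler_norml.
  move=> /andP[h1 h2] /andP[h3 h4] /andP[h5 h6].
  by apply/andP; split; lra.
Qed.

End TreeMeasure.

Section SuslinMeasure.
Variables (R : realType) (n d b : nat) (s g : R).

Lemma baire_closedI (T : topologicalType) (Q : (nat -> nat) -> set T) (C : set T) :
  baire_closed Q -> closed C -> baire_closed (fun sg => Q sg `&` C).
Proof.
move=> cQ cC sg t h; split.
  by apply: cQ => k V /(h k)[sg' [t' [? ? []]]]; exists sg', t'.
by apply: cC => V /(h 0%N)[sg' [t' [_ Vt [_ Ct]]]]; exists t'.
Qed.

Definition frozen (J : {set 'I_d}) (c : 'rV[R]_d) : set ('rV[R]_n * 'rV[R]_d) :=
  [set p : 'rV[R]_n * 'rV[R]_d | forall l, l \notin J -> p.2 ord0 l = c ord0 l].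

Lemma frozen_closed J c : closed (frozen J c).
Proof.
move=> p h l lJ; apply/eqP; rewrite -subr_eq0 -normr_le0.
apply/ler_addgt0Pr => e e0; rewrite add0r.
have [q [hq [_ [_ /(_ ord0 l)]]]] := h _ (nbhsx_ballx p e e0).
by rewrite /ball /= hq// => /ltW.
Qed.

(* Freezing as many coordinates as possible makes every coordinate hyperplane
   small, so that the children of a node can be put in general position. *)
Lemma minimal_frozen (Q : (nat -> nat) -> set ('rV[R]_n * 'rV[R]_d)) :
  ~ psmall b s (dom Q) -> exists J c,
    ~ psmall b s (dom (fun sg => Q sg `&` frozen J c)) /\
    forall l x, l \in J -> psmall b s
      (dom (fun sg => Q sg `&` frozen J c) `&` [set p : point R n d | p.2.2 ord0 l = x]).
Proof.
move=> hQ.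
pose P k := `[< exists J : {set 'I_d}, #|J| = k /\ exists c,
  ~ psmall b s (dom (fun sg => Q sg `&` frozen J c)) >].
have exP : exists k, P k.
  exists #|[set: 'I_d]%SET|; apply/asboolP; exists [set: 'I_d]%SET; split => //; exists 0.
  apply: contra_not hQ; apply: psmallS => p Qp; split => // l.
  by rewrite finset.in_setT.
case: (ex_minnP exP) => k /asboolP[J [Jk [c hc]]] kmin.
exists J, c; split => // l x lJ; apply: contrapT => hno.
have : (k <= #|(J :\ l)%SET|)%N.
  apply: kmin; apply/asboolP; exists (J :\ l)%SET; split => //.
  exists (\row_i (if i == l then x else c ord0 i)).
  apply: contra_not hno; apply: psmallS => p [[Qp fp] px]; split => // i.
  rewrite finset.in_setD1 negb_and negbK !mxE; case: eqVneq => [->//|_] /=.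
  exact: fp.
by rewrite -Jk (cardsD1 l J) lJ add1n ltnn.
Qed.

(** The deterministic half of the argument. Finite weighted sets [L m] accompany [mu] because
    expectations will be taken of finite sums, each term involving the probability of one event. The
    last clause concerns all maps that differ from [z0] by a continuous one, as other paths do. *)
Lemma suslin_measure (S : set ('rV[R]_n * 'rV[R]_d)) (A : set 'rV[R]_n)
    (z0 : 'rV[R]_n -> 'rV[R]_d) :
  suslin S -> (forall p, S p -> A p.1 /\ p.2 = z0 p.1) ->
  ~ sigma_small b s (snd @` S) -> b.+1%:R * g < b%:R * s ->
  exists (mu : probability (borelRV R n) R) (K : set 'rV[R]_n)
    (L : nat -> seq (R * 'rV[R]_n)),
  [/\ Pc A mu, {ae mu, forall t, K t}, K `<=` A,
   (forall m, weighted (fun=> 1) (L m) <= 1 /\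
     forall wu, wu \in L m -> 0 <= wu.1 /\ A wu.2) &
   (forall t j, K t -> exists2 k, (j <= k)%N & forall m, (j < m)%N ->
     weighted (fun u => hkernel (2 ^- (b * k)) (z0 t - z0 u)) (L m) <=
     2 ^+ d * (2 ^- j * rate b g k)) /\
   (forall z : 'rV[R]_n -> 'rV[R]_d, continuous (fun t => z t - z0 t) ->
     forall (zt : 'rV[R]_d) (e : R), 0 < e ->
     (mu [set t : borelRV R n | (enorm (z t - zt) <= e)%R] <=
      limn_einf (fun m => (weighted (fun u => (hits z zt (2 * e) u)%:R)
        (L m))%:E))%E)].
Proof.
move=> [Q cQ SQ] hS nS gs.
have [|J [c [nJ hJ]]] := @minimal_frozen Q.
  apply: contra_not nS; apply: sigma_smallS => _ [p Sp <-].
  by move: Sp; rewrite SQ => -[sg Qp]; exists (sg, p).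
pose Q' := fun sg => Q sg `&` frozen J c.
have cQ' : baire_closed Q' by apply: baire_closedI => //; exact: frozen_closed.
have hI l x : l \in mem J ->
    psmall b s (dom Q' `&` [set p : point R n d | p.2.2 ord0 l = x]).
  exact: hJ.
have hc (p q : point R n d) : dom Q' p -> dom Q' q ->
    forall l, l \notin mem J -> p.2.2 ord0 l = q.2.2 ord0 l.
  by move=> hp hq l lJ; rewrite (hp.2 l lJ) (hq.2 l lJ).
have hA (p : point R n d) : dom Q' p -> A p.2.1 /\ p.2.2 = z0 p.2.1.
  by case=> Qp _; apply: (hS p.2); rewrite SQ; exists p.1.
have [p0 kp0] : exists p0, kernel b s (dom Q') p0.
  apply: contrapT => hno; apply: (@kernel_full _ _ _ b s (dom Q') (dom Q')) => //.
  apply: (@sigma_smallS _ _ _ _ _ set0); last exact/box_small_sigma/box_small0.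
  by move=> _ [p [_ kp] <-]; case: hno; exists p.
(* Level 1 bounds the tree; the gap 1 is arbitrary, as nothing has been split off yet. *)
pose root : node R n d := (p0, 1%N, 1).
have vroot : valid b s Q' root by split.
have [mu [h1 h2 h3]] := tree_measure_root cQ' hI hc gs hA vroot erefl.
exists mu, (limit_set hI hc gs root), (leaf_points hI hc gs root); split => //.
- exact: (limit_set_sub hA).
- move=> m; split=> [|wu hwu]; first exact: leaf_points_le1.
  split; first exact: (leaf_points_ge0 hwu).
  by have [p /hA[Ap _] <-] := leaf_points_dom vroot hwu.
- by split => // t j; exact: (leaf_points_bound hA vroot).
Qed.

End SuslinMeasure.

(** * Gaussian small balls and tails *)

Section NormalBounds.
Variable R : realType.
Local Notation mu := lebesgue_measure.

Lemma normal_peakE (s : R) : 0 < s -> normal_peak s <= (2 * s)^-1.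
Proof.
move=> s0; rewrite /normal_peak lef_pV2 ?posrE ?mulr_gt0//; last first.
  by rewrite sqrtr_gt0 mulrn_wgt0// mulr_gt0 ?pi_gt0// exprn_gt0.
rewrite -[leLHS]ger0_norm ?mulr_ge0 ?(ltW s0)// -sqrtr_sqr ler_sqrt; last first.
  by rewrite mulrn_wge0// mulr_ge0 ?pi_ge0 ?sqr_ge0.
have := ler_wpM2l (sqr_ge0 s) (pi_ge2 R); rewrite exprMn.
lra.
Qed.

Lemma normal_prob_itv (s a r : R) : 0 < s -> 0 < r ->
  (normal_prob 0 s [set x | (`|x + a| <= r)%R] <= (r / s)%:E)%E.
Proof.
move=> s0 r0; rewrite /normal_prob.
pose D : set R := `[(- a - r), (- a + r)]%classic.
have mD : measurable D by exact: measurable_itv.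
have -> : [set x | `|x + a| <= r] = D.
  by apply/seteqP; split=> x; rewrite /D /= in_itv/= ler_norml => /andP[h1 h2];
    apply/andP; split; lra.
apply: (@le_trans _ _ (\int[mu]_(x in D) (cst (normal_peak s)%:E x))%E).
  apply: ge0_le_integral => //=.
  - by move=> x _; rewrite lee_fin normal_pdf_ge0.
  - by apply: (measurable_funS measurableT (@subsetT _ _)) => //; apply/measurable_EFinP; exact: measurable_normal_pdf.
  - by move=> x _; rewrite lee_fin normal_pdf_ub// gt_eqF.
rewrite integral_cst//= /D lebesgue_measure_itv/= lte_fin ltrD2l gtrN// -EFinB -EFinM lee_fin.
have -> : - a + r - (- a - r) = 2 * r by ring.
apply: (@le_trans _ _ ((2 * s)^-1 * (2 * r))).
  by rewrite ler_wpM2r ?normal_peakE// mulr_ge0// ltW.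
by rewrite invfM mulrACA mulVf// mul1r mulrC.
Qed.

(* The density of variance [s^2] is dominated on the tail by that of variance
   [(2 s)^2], whose integral is known. *)
Lemma normal_prob_tail (s lam : R) : 0 < s -> 0 <= lam ->
  (normal_prob 0 s [set x | (lam * s < `|x|)%R] <= (2 * expR (- lam ^+ 2 / 4))%:E)%E.
Proof.
move=> s0 lam0; rewrite /normal_prob.
have s2 : 0 < 2 * s by rewrite mulr_gt0.
have mS : measurable [set x : R | lam * s < `|x|].
  have -> : [set x : R | lam * s < `|x|] = (fun x : R => `|x|) @^-1` `]lam * s, +oo[%classic.
    by apply/seteqP; split=> x /=; rewrite in_itv/= andbT.
  rewrite -[X in measurable X]setTI; exact: normr_measurable.
apply: (@le_trans _ _ (\int[mu]_(x in [set x | (lam * s < `|x|)%R])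
    ((2 * expR (- lam ^+ 2 / 4))%:E * (normal_pdf 0 (2 * s) x)%:E))%E).
  apply: ge0_le_integral => //=.
  - by move=> x _; rewrite lee_fin normal_pdf_ge0.
  - by apply: (measurable_funS measurableT (@subsetT _ _)) => //; apply/measurable_EFinP; exact: measurable_normal_pdf.
  - apply: (measurable_funS measurableT (@subsetT _ _)) => //; apply/measurable_EFinP/measurable_funM => //.
    exact: measurable_normal_pdf.
  move=> x /= hx; rewrite -EFinM lee_fin !normal_pdfE ?gt_eqF//.
  have -> : normal_peak (2 * s) = normal_peak s / 2 :> R.
    rewrite /normal_peak -invfM; congr (_^-1).
    have -> : (2 * s) ^+ 2 * pi *+ 2 = 2 ^+ 2 * (s ^+ 2 * pi *+ 2) by ring.
    by rewrite sqrtrM ?sqr_ge0// sqrtr_sqr ger0_norm// mulrC.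
  rewrite /normal_fun !subr0.
  have p0 := normal_peak_ge0 s.
  have -> : 2 * expR (- lam ^+ 2 / 4) * (normal_peak s / 2 *
      expR (- x ^+ 2 / ((2 * s) ^+ 2 *+ 2))) = normal_peak s *
      expR (- lam ^+ 2 / 4 + - x ^+ 2 / ((2 * s) ^+ 2 *+ 2)).
    by rewrite expRD; field.
  rewrite ler_wpM2l// ler_expR.
  have h2 : lam ^+ 2 <= x ^+ 2 / s ^+ 2.
    rewrite ler_pdivlMr ?exprn_gt0// -exprMn -[x ^+ 2]real_normK ?num_real//.
    by rewrite lerXn2r ?nnegrE ?mulr_ge0 ?(ltW s0)// ltW.
  have -> : - x ^+ 2 / (s ^+ 2 *+ 2) = - (x ^+ 2 / s ^+ 2) / 2.
    by field; rewrite gt_eqF.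
  have -> : - x ^+ 2 / ((2 * s) ^+ 2 *+ 2) = - (x ^+ 2 / s ^+ 2) / 8.
    by field; rewrite gt_eqF.
  have := sqr_ge0 lam; lra.
rewrite ge0_integralZl//=; last 2 first.
- apply: (measurable_funS measurableT (@subsetT _ _)) => //.
  by apply/measurable_EFinP; exact: measurable_normal_pdf.
- by move=> x _; rewrite lee_fin normal_pdf_ge0.
rewrite -[leRHS]mule1 lee_wpmul2l ?lee_fin ?mulr_ge0 ?expR_ge0//.
rewrite -(integral_normal_pdf 0 (2 * s)); apply: ge0_subset_integral => //=.
- by apply/measurable_EFinP; exact: measurable_normal_pdf.
- by move=> x _; rewrite lee_fin normal_pdf_ge0.
Qed.

End NormalBounds.

Section Gaussian.
Variables (R : realType) (dO : measure_display) (Omega : measurableType dO).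
Variable P : probability Omega R.
Implicit Types Y : Omega -> R.

Definition l2norm Y : R := Num.sqrt (fine (\int[P]_w ((Y w) ^+ 2)%:E)%E).

Lemma l2norm_ge0 Y : 0 <= l2norm Y.
Proof. exact: sqrtr_ge0. Qed.

Lemma measurable_abs_le Y (a r : R) : measurable_fun [set: Omega] Y ->
  measurable [set w | `|Y w + a| <= r].
Proof.
move=> mY.
have -> : [set w | `|Y w + a| <= r] = (fun w => `|Y w + a|) @^-1` `]-oo, r]%classic.
  by apply/seteqP; split=> w /=; rewrite in_itv.
rewrite -[X in measurable X]setTI; apply: measurableT_comp => //.
exact: measurable_funD.
Qed.

Lemma measurable_abs_gt Y (r : R) : measurable_fun [set: Omega] Y ->
  measurable [set w | r < `|Y w|].
Proof.
move=> mY; have -> : [set w | r < `|Y w|] = ~` [set w | `|Y w + 0| <= r].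
  by apply/seteqP; split=> w /=; rewrite addr0 ltNge => /negP.
exact/measurableC/measurable_abs_le.
Qed.

Lemma measurable_sqr Y : measurable_fun [set: Omega] Y ->
  measurable_fun [set: Omega] (fun w => ((Y w) ^+ 2)%:E).
Proof. by move=> mY; apply/measurable_EFinP; exact: measurable_funX. Qed.

Lemma expRN_le (x : R) : 0 < x -> expR (- x) <= 4 / x ^+ 2.
Proof.
move=> x0; rewrite expRN ler_pdivlMr ?exprn_gt0// mulrC ler_pdivrMr ?expR_gt0//.
have -> : expR x = expR (x / 2) ^+ 2 by rewrite expr2 -expRD; congr expR; field.
have := expR_ge1Dx (x / 2) => h.
have : (x / 2) ^+ 2 <= expR (x / 2) ^+ 2.
  by rewrite lerXn2r ?nnegrE ?expR_ge0//; lra.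
by rewrite exprMn; lra.
Qed.

(** From here on the normal law enters only through these two estimates; [second_moment_ge] and
    [second_moment_le] relate their parameter [s] to [l2norm] up to constants. *)
Lemma gaussian_law Y : centered_gaussian P Y ->
  measurable_fun [set: Omega] Y /\
  ((\int[P]_w ((Y w) ^+ 2)%:E = 0 /\ P [set w | (0 < `|Y w|)%R] = 0)%E \/
   exists s : R, [/\ 0 < s,
     forall a r, 0 < r -> (P [set w | (`|Y w + a| <= r)%R] <= (r / s)%:E)%E &
     forall lam, 0 <= lam ->
       (P [set w | (lam * s < `|Y w|)%R] <= (2 * expR (- lam ^+ 2 / 4))%:E)%E]).
Proof.
move=> [mY hY]; split => //; case: hY => [h|[s [s0 h]]]; [left|right].
  have P0 : P [set w | 0 < `|Y w|] = 0%E.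
    have -> : [set w | 0 < `|Y w|] = Y @^-1` (~` [set 0]).
      by apply/seteqP; split=> w /=; rewrite normr_gt0 => /eqP.
    rewrite h; last exact: measurableC.
    by rewrite diracE memNset//= => /(_ erefl).
  split => //; rewrite -[RHS](integral0 P setT).
  apply: ae_eq_integral => //; first exact: measurable_sqr.
  exists [set w | 0 < `|Y w|]; split => //; first exact: measurable_abs_gt.
  move=> w /= hw; rewrite normr_gt0; apply/eqP => Y0; apply: hw => _.
  by rewrite Y0 expr0n.
exists s; split => // [a r r0|lam lam0].
  have mB : measurable [set x : R | `|x + a| <= r].
    have -> : [set x : R | `|x + a| <= r] = `[(- a - r), (- a + r)]%classic.
      by apply/seteqP; split=> x /=; rewrite in_itv/= ler_norml => /andP[h1 h2];
        apply/andP; split; lra.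
    exact: measurable_itv.
  by rewrite (h _ mB); exact: normal_prob_itv.
have mB : measurable [set x : R | lam * s < `|x|].
  have -> : [set x : R | lam * s < `|x|] = (fun x : R => `|x|) @^-1` `]lam * s, +oo[%classic.
    by apply/seteqP; split=> x /=; rewrite in_itv/= andbT.
  by rewrite -[X in measurable X]setTI; exact: normr_measurable.
by rewrite (h _ mB); exact: normal_prob_tail.
Qed.

(** With [a = 0] and [r = s / 2] the small ball estimate says that [|Y| > s / 2] has probability at
    least 1/2. *)
Lemma second_moment_ge Y (s : R) : measurable_fun [set: Omega] Y -> 0 < s ->
  (forall a r, 0 < r -> (P [set w | (`|Y w + a| <= r)%R] <= (r / s)%:E)%E) ->
  ((s ^+ 2 / 8)%:E <= \int[P]_w ((Y w) ^+ 2)%:E)%E.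
Proof.
move=> mY s0 h.
have s2 : 0 < s / 2 by rewrite divr_gt0.
pose E := [set w | s / 2 < `|Y w|].
have mE : measurable E by exact: measurable_abs_gt.
have PE : ((1 / 2)%:E <= P E)%E.
  have -> : E = ~` [set w | `|Y w + 0| <= s / 2].
    by apply/seteqP; split=> w /=; rewrite /E /= addr0 ltNge => /negP.
  rewrite probability_setC; last exact: measurable_abs_le.
  have := h 0 (s / 2) s2; rewrite -mulrA mulrCA mulfV ?gt_eqF// mulr1 => hh.
  have e : ((1 / 2)%:E = 1 - (1 / 2)%:E :> \bar R)%E.
    by rewrite -EFinB; congr (_%:E); field.
  by rewrite [leLHS]e leeB// (le_trans hh)// lee_fin; lra.
apply: (@le_trans _ _ (\int[P]_w ((s / 2) ^+ 2 * \1_E w)%:E)%E); last first.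
  apply: ge0_le_integral => //=.
  - by move=> w _; rewrite lee_fin mulr_ge0 ?sqr_ge0.
  - by apply/measurable_EFinP/measurable_funM => //; exact: measurable_indic.
  - exact: measurable_sqr.
  move=> w _; rewrite lee_fin indicE; have [|] := boolP (w \in E).
    rewrite inE /E /= => /ltW hw; rewrite mulr1 -[leRHS]real_normK ?num_real//.
    by rewrite lerXn2r ?nnegrE ?(ltW s2).
  by rewrite mulr0 sqr_ge0.
under eq_integral do rewrite EFinM.
rewrite ge0_integralZl//=; last 2 first.
- by apply/measurable_EFinP; exact: measurable_indic.
- by rewrite lee_fin sqr_ge0.
rewrite integral_indic// setIT.
apply: (@le_trans _ _ (((s / 2) ^+ 2)%:E * (1 / 2)%:E)%E).
  by rewrite -EFinM lee_fin exprMn; lra.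
by rewrite lee_wpmul2l// lee_fin sqr_ge0.
Qed.

(** [Y^2] is at most [s^2] plus the sum of [4^(k+1) s^2] over the [k] with [|Y| > 2^k s]. Such an
    event has probability at most [2 exp(-4^k / 4) <= 128 / 16^k], so the expected sum is at most
    [512 s^2 / (1 - 1/4)], and [1 + 2048/3 <= 729 = 27^2]. *)
Lemma second_moment_le Y (s : R) : measurable_fun [set: Omega] Y -> 0 < s ->
  (forall lam, 0 <= lam ->
    (P [set w | (lam * s < `|Y w|)%R] <= (2 * expR (- lam ^+ 2 / 4))%:E)%E) ->
  (\int[P]_w ((Y w) ^+ 2)%:E <= (729 * s ^+ 2)%:E)%E.
Proof.
move=> mY s0 h.
pose E k := [set w | 2 ^+ k * s < `|Y w|].
have mE k : measurable (E k) by exact: measurable_abs_gt.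
pose c k : R := 4 ^+ k.+1 * s ^+ 2.
have c0 k : 0 <= c k by rewrite mulr_ge0 ?sqr_ge0// exprn_ge0.
pose G k w := ((c k)%:E * (\1_(E k) w)%:E)%E.
have G0 k w : (0 <= G k w)%E by rewrite mule_ge0 ?lee_fin.
have mG k : measurable_fun [set: Omega] (G k).
  apply/emeasurable_funM; first exact: measurable_cst.
  by apply/measurable_EFinP; exact: measurable_indic.
have s20 : 0 < s ^+ 2 by rewrite exprn_gt0.
apply: (@le_trans _ _ (\int[P]_w ((s ^+ 2)%:E + \sum_(k <oo) G k w))%E).
  apply: ge0_le_integral => //=.
  - by move=> w _; rewrite lee_fin sqr_ge0.
  - exact: measurable_sqr.
  - by apply: emeasurable_funD => //; exact: ge0_emeasurable_sum.
  move=> w _; have [hw|hw] := leP `|Y w| s.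
    apply: (@le_trans _ _ (s ^+ 2)%:E); last first.
      by rewrite leeDl// nneseries_ge0.
    by rewrite lee_fin -[leLHS]real_normK ?num_real// lerXn2r ?nnegrE ?(ltW s0).
  have exk : exists k, `|Y w| <= 2 ^+ k * s.
    exists (Num.bound (`|Y w| / s)); rewrite -ler_pdivrMr// ltW//.
    apply: lt_trans (ltr_nat_exp2 _ _); apply: archi_boundP.
    by rewrite divr_ge0 ?(ltW s0).
  case: (ex_minnP exk) => -[|k] hk1 hk2.
    by move: hk1; rewrite expr0 mul1r leNgt hw.
  have hk : 2 ^+ k * s < `|Y w|.
    by rewrite ltNge; apply/negP => /hk2; rewrite ltnn.
  apply: (@le_trans _ _ (G k w)).
    rewrite /G indicE mem_set// mule1 lee_fin /c -[leLHS]real_normK ?num_real//.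
    have -> : 4 ^+ k.+1 * s ^+ 2 = (2 ^+ k.+1 * s) ^+ 2.
      by rewrite exprMn -exprM mulnC exprM; congr (_ ^+ _ * _); ring.
    by rewrite lerXn2r ?nnegrE ?mulr_ge0 ?(ltW s0).
  apply: (@le_trans _ _ (\sum_(i <oo) G i w)%E); last first.
    by rewrite leeDr// lee_fin ltW.
  apply: (@le_trans _ _ (\sum_(0 <= i < k.+1) G i w)%E); last first.
    exact: nneseries_lim_ge.
  by rewrite big_nat_recr//= leeDr// sume_ge0.
rewrite ge0_integralD//=; last 3 first.
- by move=> w _; rewrite lee_fin ltW.
- by move=> w _; exact: nneseries_ge0.
- exact: ge0_emeasurable_sum.
rewrite integral_cst//= probability_setT mule1 integral_nneseries//.
have hG k : (\int[P]_w G k w <= (512 * s ^+ 2 * (1 / 4) ^+ k)%:E)%E.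
  rewrite ge0_integralZl//=; last 2 first.
  - by apply/measurable_EFinP; exact: measurable_indic.
  - by rewrite lee_fin.
  rewrite integral_indic// setIT.
  have x0 : 0 < 4 ^+ k / 4 :> R by rewrite divr_gt0// exprn_gt0.
  apply: (@le_trans _ _ ((c k)%:E * (2 * (4 / (4 ^+ k / 4) ^+ 2))%:E)%E).
    rewrite lee_wpmul2l ?lee_fin//.
    apply: le_trans (h (2 ^+ k) _) _; first by rewrite exprn_ge0.
    rewrite lee_fin ler_pM2l//; apply: le_trans (expRN_le x0).
    rewrite ler_expR mulNr lerN2 -exprM mulnC exprM.
    by rewrite ler_pM2r// (_ : 2 ^+ 2 = 4 :> R)//; ring.
  rewrite -EFinM lee_fin /c exprS.
  rewrite [leLHS](_ : _ = 512 * s ^+ 2 * (1 / 4 ^+ k)).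
    by rewrite !mul1r exprVn.
  by field; rewrite expf_neq0.
apply: (@le_trans _ _ ((s ^+ 2)%:E + (512 * s ^+ 2 / (1 - 1 / 4))%:E)%E); last first.
  rewrite -EFinD lee_fin.
  have -> : 512 * s ^+ 2 / (1 - 1 / 4) = (2048 / 3) * s ^+ 2 :> R by field.
  lra.
rewrite leeD2l//; apply: lime_le.
  by apply: is_cvg_nneseries => k _ _; apply: integral_ge0.
apply: nearW => m.
apply: (@le_trans _ _ (\sum_(0 <= k < m) (512 * s ^+ 2 * (1 / 4) ^+ k)%:E)%E).
  by apply: lee_sum => k _.
rewrite sumEFin lee_fin.
have a0 : 0 <= 512 * s ^+ 2 by apply: mulr_ge0; [exact: ler0n|exact: sqr_ge0].
have q0 : 0 < 1 / 4 :> R by rewrite divr_gt0.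
have q1 : `|1 / 4| < 1 :> R by rewrite gtr0_norm//; lra.
move: (512 * s ^+ 2) (1 / 4) a0 q0 q1 => x y x0 y0 y1.
have := geometric_le_lim m x0 y0 y1; apply: le_trans.
by rewrite seriesEnat/=; apply: ler_sum => i _.
Qed.

Lemma gaussian_second_moment Y : centered_gaussian P Y ->
  (\int[P]_w ((Y w) ^+ 2)%:E < +oo)%E.
Proof.
move=> /gaussian_law[mY [[-> _]|[s [s0 h1 h2]]]]; first exact: ltry.
exact: le_lt_trans (second_moment_le mY s0 h2) (ltry _).
Qed.

(** The factor 27 comes from [l2norm Y <= 27 s]; the maximum builds in the trivial bound by 1. *)
Lemma gaussian_small_ball Y (a r : R) : centered_gaussian P Y -> 0 < r ->
  (P [set w | (`|Y w + a| <= r)%R] <= (27 * (r / Num.max r (l2norm Y)))%:E)%E.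
Proof.
move=> gY r0; have [mY] := gaussian_law gY.
have m0 : 0 < Num.max r (l2norm Y) by rewrite lt_max r0.
have P1 : (P [set w | (`|Y w + a| <= r)%R] <= 1)%E.
  exact/probability_le1/measurable_abs_le.
have [rl|lr] := leP (l2norm Y) r.
  move=> _; apply: (le_trans P1); rewrite divff ?gt_eqF// mulr1 lee_fin.
  by rewrite ler1n.
case=> [[I0 _]|[s [s0 h1 h2]]].
  by move: lr; rewrite /l2norm I0 /= sqrtr0 ltNge (ltW r0).
apply: le_trans (h1 a r r0) _; rewrite lee_fin.
have l0 : 0 < l2norm Y by exact: lt_trans lr.
rewrite mulrCA ler_pM2l// ler_pdivlMr// mulrC ler_pdivrMr//.
rewrite -[leRHS]ger0_norm ?mulr_ge0 ?(ltW s0)// -sqrtr_sqr /l2norm ler_sqrt ?sqr_ge0//.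
rewrite -lee_fin fineK; last first.
  rewrite ge0_fin_numE; first exact: gaussian_second_moment.
  by apply: integral_ge0 => w _; rewrite lee_fin sqr_ge0.
rewrite exprMn (_ : 27 ^+ 2 = 729); first exact: second_moment_le.
by rewrite -natrX.
Qed.

(** [second_moment_ge] gives [s <= 3 * l2norm Y], and [(lam / 3)^2 / 4 = lam^2 / 36]. *)
Lemma gaussian_tail Y (lam : R) : centered_gaussian P Y -> 0 <= lam ->
  (P [set w | (lam * l2norm Y < `|Y w|)%R] <= (2 * expR (- lam ^+ 2 / 36))%:E)%E.
Proof.
move=> gY lam0; have [mY] := gaussian_law gY.
case=> [[I0 P0]|[s [s0 h1 h2]]].
  rewrite /l2norm I0 /= sqrtr0 mulr0 P0 lee_fin mulr_ge0// expR_ge0.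
have hs : s <= 3 * l2norm Y.
  rewrite -ler_pdivrMl// /l2norm -[leLHS]ger0_norm ?mulr_ge0 ?(ltW s0)//.
  rewrite -sqrtr_sqr ler_sqrt; last first.
    by apply/fine_ge0/integral_ge0 => w _; rewrite lee_fin sqr_ge0.
  rewrite -lee_fin fineK; last first.
    rewrite ge0_fin_numE; first exact: gaussian_second_moment.
    by apply: integral_ge0 => w _; rewrite lee_fin sqr_ge0.
  apply: le_trans (second_moment_ge mY s0 h1); rewrite lee_fin exprMn.
  have : 0 < s ^+ 2 by rewrite exprn_gt0.
  rewrite (_ : 3^-1 ^+ 2 = 1 / 9 :> R); first lra.
  by field.
apply: (@le_trans _ _ (P [set w | (lam / 3 * s < `|Y w|)%R])).
  apply: le_measure; rewrite ?inE; [exact: measurable_abs_gt|exact: measurable_abs_gt|].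
  move=> w /=; apply: le_lt_trans; rewrite -mulrA ler_wpM2l//; lra.
apply: le_trans (h2 _ _) _; first by rewrite divr_ge0.
rewrite lee_fin ler_pM2l// ler_expR exprMn.
rewrite (_ : 3^-1 ^+ 2 = 1 / 9 :> R); first lra.
by field.
Qed.

End Gaussian.

Section ProductRule.
Variables (R : realType) (dO : measure_display) (Omega : measurableType dO).
Variable P : probability Omega R.
Variables (d' : measure_display) (T : measurableType d') (G : set (set T)).
Hypothesis mG : (@measurable d' T) = <<s G >>.
Hypothesis GI : setI_closed G.
Hypothesis GT : G setT.
Variables (d : nat) (V : 'I_d -> Omega -> T).
Hypothesis mV : forall i, measurable_fun [set: Omega] (V i).

Definition all_in (D : 'I_d -> set T) : set Omega :=
  \bigcap_(i in [set: 'I_d]) V i @^-1` D i.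

Hypothesis indG : forall D, (forall i, G (D i)) ->
  P (all_in D) = (\prod_(i < d) P (V i @^-1` D i))%E.

Lemma measurable_preimageT i D : measurable D -> measurable (V i @^-1` D).
Proof. by move=> mD; rewrite -[X in measurable X]setTI; exact: mV. Qed.

(** The sets [D i] are released from [G] to the sigma-algebra one index at a time: with the others
    fixed, both sides are finite measures in [D i0] that agree on the pi-system [G]. *)
Lemma pisystem_product (D : 'I_d -> set T) : (forall i, measurable (D i)) ->
  P (all_in D) = (\prod_(i < d) P (V i @^-1` D i))%E.
Proof.
suff h m : forall D, (forall i, measurable (D i)) ->
    (forall i : 'I_d, (m <= i)%N -> G (D i)) ->
    P (all_in D) = (\prod_(i < d) P (V i @^-1` D i))%E.
  by move=> mD; apply: (h d) => // i; rewrite leqNgt ltn_ord.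
elim: m => [|m IH] {}D mD GD; first by apply: indG => i; exact: GD.
have [dm|md] := leqP d m.
  apply: IH => // i mi; exfalso.
  by have := leq_trans dm mi; rewrite leqNgt ltn_ord.
pose i0 := Ordinal md.
pose E := \bigcap_(i in [set i | i != i0]) V i @^-1` D i.
have mE : measurable E.
  apply: fin_bigcap_measurable; first exact: finite_finset.
  by move=> i _; exact: measurable_preimageT.
pose upd B i := if i == i0 then B else D i.
have updE B : all_in (upd B) = V i0 @^-1` B `&` E.
  apply/seteqP; split=> w.
    move=> h; split; first by have := h i0 Logic.I; rewrite /upd eqxx.
    by move=> i /= ii0; have := h i Logic.I; rewrite /upd (negbTE ii0).
  move=> [h1 h2] i _; rewrite /upd; case: eqVneq => [->//|ii0].
  exact: h2.
pose c := \prod_(i < d | i != i0) fine (P (V i @^-1` D i)).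
have c0 : 0 <= c by apply: prodr_ge0 => i _; exact: fine_ge0.
have cE : (\prod_(i < d | i != i0) P (V i @^-1` D i))%E = c%:E.
  rewrite /c -prodEFin; apply: eq_bigr => i _; rewrite fineK//.
  exact/fin_num_measure/measurable_preimageT.
have prodE B : (\prod_(i < d) P (V i @^-1` upd B i))%E =
    (P (V i0 @^-1` B) * c%:E)%E.
  rewrite (bigD1 i0)//= {1}/upd eqxx -cE; congr (_ * _)%E.
  by apply: eq_bigr => i ii0; rewrite /upd (negbTE ii0).
pose m1 := pushforward (mrestr P mE) (V i0).
pose m2f := mscale (NngNum c0) (pushforward P (V i0)).
pose m2 := m2f (mV i0).
have m1E B : m1 B = P (V i0 @^-1` B `&` E) by [].
have m2E B : m2 B = (c%:E * P (V i0 @^-1` B))%E by [].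
have key B : measurable B -> m1 B = m2 B.
  apply: (measure_unique G (fun=> setT)) => //.
  - by rewrite bigcup_const.
  - move=> A GA; change (m1 A = m2 A); rewrite m1E m2E -updE IH.
    + by rewrite prodE muleC.
    + by move=> i; rewrite /upd; case: ifP => // _; rewrite mG; exact: sub_sigma_algebra.
    + move=> i mi; rewrite /upd; case: eqVneq => // ii0; apply: GD.
      by rewrite ltn_neqAle mi andbT; apply: contra_neq ii0 => mi'; apply: val_inj.
  - move=> _; change (m1 setT < +oo)%E; rewrite m1E; apply: le_lt_trans (ltry 1).
    apply: probability_le1; apply: measurableI => //; exact: measurable_preimageT.
have Dupd : D = upd (D i0) by apply/funext => i; rewrite /upd; case: eqVneq => [->|].
rewrite {1}Dupd updE -m1E key// m2E muleC -prodE.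
by apply: eq_bigr => i _; rewrite -Dupd.
Qed.

End ProductRule.

Section Field.
Variables (R : realType) (n d : nat) (dO : measure_display).
Variables (Omega : measurableType dO) (P : probability Omega R).
Variable X : Omega -> 'rV[R]_n -> 'rV[R]_d.
Hypothesis hG : forall i : 'I_d, centered_gaussian_field P (fun w t => X w t ord0 i).

Lemma field_measurable i t : measurable_fun [set: Omega] (fun w => X w t ord0 i).
Proof.
have [+ _] := hG i (fun _ : 'I_1 => t) (fun=> 1).
by under eq_fun do rewrite big_ord1 mul1r.
Qed.

Lemma increment_gaussian i t u :
  centered_gaussian P (fun w => X w t ord0 i - X w u ord0 i).
Proof.
have := hG i (fun j : 'I_2 => if j == ord0 then t else u)
  (fun j => if j == ord0 then 1 else -1).
rewrite (_ : (fun w => _) = (fun w => X w t ord0 i - X w u ord0 i))//.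
by apply/funext => w; rewrite !big_ord_recl big_ord0 /= addr0 mul1r mulN1r.
Qed.

Lemma rho_l2norm i t u :
  rho P X i t u = l2norm P (fun w => X w t ord0 i - X w u ord0 i).
Proof. by []. Qed.

Lemma rho_ge0 i t u : 0 <= rho P X i t u.
Proof. exact: sqrtr_ge0. Qed.

Hypothesis hI : independent_components P X.

(** Independence is given on rectangles; [pisystem_product], applied to the pairs
    [(X_i(t), X_i(u))], extends it to events about increments. *)
Lemma increments_small_ball (a : 'I_d -> R) (r : R) t u : 0 < r ->
  (P (\bigcap_(i in [set: 'I_d])
     [set w | (`|X w t ord0 i - X w u ord0 i + a i| <= r)%R]) <=
   (\prod_(i < d) (27 * (r / Num.max r (rho P X i t u))))%:E)%E.
Proof.
move=> r0.
pose V i w : R * R := (X w t ord0 i, X w u ord0 i).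
pose D i : set (R * R) := [set p | `|p.1 - p.2 + a i| <= r].
have mV i : measurable_fun [set: Omega] (V i).
  by apply: measurable_fun_pair; exact: field_measurable.
have mD i : measurable (D i).
  have mf : measurable_fun [set: R * R] (fun p : R * R => p.1 - p.2).
    by apply: measurable_funB; [exact: measurable_fst|exact: measurable_snd].
  exact: (measurable_abs_le (a i) r mf).
have -> : \bigcap_(i in [set: 'I_d])
    [set w | `|X w t ord0 i - X w u ord0 i + a i| <= r] = all_in V D by [].
rewrite (pisystem_product (measurable_prod_measurableType R R)) //.
- have fP i : P (V i @^-1` D i) \is a fin_num.
    exact/fin_num_measure/measurable_preimageT.
  under eq_bigr do rewrite -(fineK (fP _)).
  rewrite prodEFin lee_fin; apply: ler_prod => i _; rewrite fine_ge0//=.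
  rewrite -lee_fin fineK// rho_l2norm.
  exact: (gaussian_small_ball (a i) (increment_gaussian i t u) r0).
- move=> _ _ [A mA [B mB <-]] [A' mA' [B' mB' <-]]; rewrite -setXI.
  by exists (A `&` A'); [exact: measurableI|exists (B `&` B') => //; exact: measurableI].
- by exists setT => //; exists setT => //; rewrite setXTT.
move=> E hE.
have /choice[B1 hB1] i : exists B1, exists B2, [/\ measurable B1, measurable B2 &
    B1 `*` B2 = E i] by have [A mA [B mB <-]] := hE i; exists A, B.
have {hB1}/choice[B2 hB] := hB1.
pose ts (j : 'I_2) := if j == ord0 then t else u.
pose B i (j : 'I_2) : set R := if j == ord0 then B1 i else B2 i.
have BE i : \bigcap_(j in [set: 'I_2]) [set w | B i j (X w (ts j) ord0 i)] =
    V i @^-1` E i.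
  have [_ _ <-] := hB i; apply/seteqP; split=> w.
    by move=> h; split; [exact: (h ord0)|exact: (h ord_max)].
  by move=> [h1 h2] j _; rewrite /= /B /ts; case: ifP.
have := @hI 2 ts B; rewrite /all_in.
under eq_bigcapr do rewrite BE.
under [in X in _ -> X]eq_bigr do rewrite -BE.
by apply=> i j; rewrite /B; have [? ? _] := hB i; case: ifP.
Qed.

Variable f : 'rV[R]_n -> 'rV[R]_d.

Definition stay (r : R) t u : set Omega := \bigcap_(i in [set: 'I_d])
  [set w | `|(X w u + f u) ord0 i - (X w t + f t) ord0 i| <= r].

Lemma measurable_stay r t u : measurable (stay r t u).
Proof.
apply: fin_bigcap_measurable; first exact: finite_finset.
move=> i _.
have mf : measurable_fun [set: Omega] (fun w => X w u ord0 i - X w t ord0 i).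
  by apply: measurable_funB; exact: field_measurable.
have := measurable_abs_le (f u ord0 i - f t ord0 i) r mf.
by congr (measurable _); apply/seteqP; split=> w /=; rewrite !mxE opprD addrACA.
Qed.

(* If the drift moves much further than the field can, staying close is a large
   deviation; otherwise the increments of the good path [w0] bound those of the
   field from below, and the kernel of [w0] dominates the small ball. *)
Lemma stay_le w0 (T r : R) t u : 0 < r -> 2 <= T ->
  (forall i, `|X w0 t ord0 i - X w0 u ord0 i| <= T * Num.max r (rho P X i t u)) ->
  (P (stay r t u) <= (27 ^+ d * hkernel (2 * T * r) ((X w0 t + f t) - (X w0 u + f u)) +
    2 * expR (- (T / 2) ^+ 2 / 36))%:E)%E.
Proof.
move=> r0 T2 hw.
have mx0 i : 0 < Num.max r (rho P X i t u) by rewrite lt_max r0.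
have T0 : 0 < T by lra.
have th0 : 0 < 2 * T * r by rewrite !mulr_gt0.
have stayE : stay r t u = \bigcap_(i in [set: 'I_d])
    [set w | `|X w t ord0 i - X w u ord0 i + (f t ord0 i - f u ord0 i)| <= r].
  apply: eq_bigcapr => i _; apply/seteqP; split=> w /=; rewrite !mxE distrC;
  by rewrite (_ : _ + _ - _ = X w t ord0 i - X w u ord0 i + (f t ord0 i - f u ord0 i))//; ring.
have [hf|/existsNP[i /negP]] := pselect (forall i,
    `|f t ord0 i - f u ord0 i| <= T * Num.max r (rho P X i t u)).
  apply: (@le_trans _ _ (\prod_(i < d) (27 * (r / Num.max r (rho P X i t u))))%:E).
    rewrite stayE; exact: increments_small_ball.
  rewrite lee_fin -[leLHS]addr0 lerD ?mulr_ge0 ?expR_ge0//.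
  rewrite big_split/= prodr_const card_ord ler_pM2l ?exprn_gt0//.
  apply: ler_prod => i _; rewrite divr_ge0 ?(ltW r0) ?(ltW (mx0 i))//=.
  set z := _ ord0 i.
  (* The path [w0] and the drift each move by at most [T max(r, rho)], so the kernel factor of width
     [2 T r] is at least [r / max(r, rho)]. *)
  have hz : `|z| <= 2 * T * Num.max r (rho P X i t u).
    rewrite /z !mxE.
    rewrite (_ : _ + _ - _ = (X w0 t ord0 i - X w0 u ord0 i) + (f t ord0 i - f u ord0 i));
      last by ring.
    apply: (le_trans (ler_normD _ _)); have := hw i; have := hf i; lra.
  have m0 : 0 < Num.max (2 * T * r) `|z| by rewrite lt_max th0.
  rewrite ler_pdivrMr// mulrAC ler_pdivlMr// mulrC.
  rewrite -[2 * T * r * _]mulrA [r * _]mulrC mulrA ler_pM2r//.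
  rewrite ge_max hz andbT ler_pM2l ?mulr_gt0//.
  by rewrite le_max lexx.
rewrite -ltNge => hi.
apply: (@le_trans _ _ (2 * expR (- (T / 2) ^+ 2 / 36))%:E); last first.
  by rewrite lee_fin lerDr mulr_ge0 ?exprn_ge0 ?hkernel_ge0 ?(ltW th0).
have gY := increment_gaussian i t u.
have T20 : 0 <= T / 2 by lra.
apply: le_trans (gaussian_tail gY T20).
apply: le_measure; rewrite ?inE.
- exact: measurable_stay.
- by apply: measurable_abs_gt; have [] := gY.
(* As [T >= 2], staying within [r] while the drift exceeds [T max(r, rho)] forces an increment of
   the field above [(T / 2) rho]. *)
rewrite stayE => w /(_ i Logic.I) /= hY; rewrite -rho_l2norm.
have h1 : r <= Num.max r (rho P X i t u) by rewrite le_max lexx.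
have h2 : rho P X i t u <= Num.max r (rho P X i t u) by rewrite le_max lexx orbT.
have h3 : `|f t ord0 i - f u ord0 i| <= r + `|X w t ord0 i - X w u ord0 i|.
  set a := X w t ord0 i - _ in hY *; set c := f t ord0 i - _ in hY *.
  have -> : c = (a + c) - a by ring.
  by apply: (le_trans (ler_normB _ _)); rewrite lerD2r.
have h4 : T / 2 * rho P X i t u <= T / 2 * Num.max r (rho P X i t u).
  by rewrite ler_wpM2l.
have h5 : 2 * Num.max r (rho P X i t u) <= T * Num.max r (rho P X i t u).
  by rewrite ler_wpM2r ?(ltW (mx0 i)).
lra.
Qed.

End Field.

(** * Chaining and regularity *)

Section Nets.
Variables (R : realType) (n : nat).

Definition near_pts (e : R) (t u : 'rV[R]_n) : Prop :=
  forall i, `|t ord0 i - u ord0 i| <= e.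

(** One point of [C] is picked in each occupied cell of a cubic grid. The net must lie in [C], where
    the increments are controlled. *)
Lemma bounded_net (C : set 'rV[R]_n) (M e : R) : C !=set0 -> 0 < M -> 0 < e <= 1 ->
  (forall t, C t -> forall i, `|t ord0 i| <= M) ->
  exists (F : finType) (net : F -> 'rV[R]_n),
    [/\ #|F|%:R <= ((2 * M + 1) / e) ^+ n, forall x, C (net x) &
        forall t, C t -> exists x, near_pts e t (net x)].
Proof.
move=> [c0 Cc0] M0 /andP[e0 e1] hM.
pose L := (Num.truncn (2 * M / e)).+1.
have hL : L%:R <= (2 * M + 1) / e :> R.
  have h : 0 <= 2 * M / e by rewrite divr_ge0 ?(ltW e0)// mulr_ge0 ?(ltW M0).
  have := truncn_itv h => /andP[h1 _].
  have -> : L%:R = (Num.truncn (2 * M / e))%:R + 1 :> R by rewrite natr1.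
  rewrite [leRHS]mulrDl div1r lerD//.
  by rewrite -[leLHS]invr1 lef_pV2 ?posrE.
pose idx (t : 'rV[R]_n) : {ffun 'I_n -> 'I_L} :=
  [ffun i => inord (Num.truncn ((t ord0 i + M) / e))].
have idxE t i : C t -> nat_of_ord (idx t i) = Num.truncn ((t ord0 i + M) / e).
  move=> Ct; rewrite ffunE inordK// ltnS.
  have := hM t Ct i; rewrite ler_norml => /andP[h1 h2].
  apply: le_truncn => //; rewrite ler_pM2r ?invr_gt0//; lra.
have /choice[net hnet] (x : {ffun 'I_n -> 'I_L}) : exists v, C v /\
    ((exists2 t, C t & idx t = x) -> idx v = x).
  have [[t Ct tx]|h] := pselect (exists2 t, C t & idx t = x).
    by exists t; split.
  by exists c0.
exists {ffun 'I_n -> 'I_L}, net; split.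
- rewrite card_ffun !card_ord natrX lerXn2r ?nnegrE//.
  by rewrite divr_ge0 ?(ltW e0)//; lra.
- by move=> x; have [] := hnet x.
- move=> t Ct; exists (idx t) => i.
  have [Cv /(_ (ex_intro2 _ _ t Ct erefl)) hv] := hnet (idx t).
  have := congr1 (fun x : {ffun _} => nat_of_ord (x i)) hv; rewrite !idxE//.
  have h1 (v : 'rV[R]_n) : C v -> 0 <= (v ord0 i + M) / e.
    move=> /hM /(_ i); rewrite ler_norml => /andP[h1 h2].
    by rewrite divr_ge0 ?(ltW e0)//; lra.
  have := truncn_itv (h1 _ Ct); have := truncn_itv (h1 _ Cv).
  rewrite ler_pdivlMr// ler_pdivlMr// ltr_pdivrMr// ltr_pdivrMr//.
  move=> + + hh; rewrite hh -[(Num.truncn _).+1%:R]natr1 => /andP[h2 h3] /andP[h4 h5].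
  by rewrite ler_norml; apply/andP; split; lra.
Qed.

End Nets.

Section L2.
Variables (R : realType) (dO : measure_display) (Omega : measurableType dO).
Variable P : probability Omega R.

(** A form of Minkowski's inequality with a constant: [(x + y + z)^2 <= 3 (x^2 + y^2 + z^2)], and
    [3 (a^2 + b^2 + c^2) <= (2 (a + b + c))^2]. *)
Lemma l2norm_add3 (U V W : Omega -> R) :
  centered_gaussian P U -> centered_gaussian P V -> centered_gaussian P W ->
  l2norm P (fun w => U w + V w + W w) <= 2 * (l2norm P U + l2norm P V + l2norm P W).
Proof.
move=> gU gV gW.
have m2 Y : centered_gaussian P Y -> measurable_fun [set: Omega] (fun w => ((Y w) ^+ 2)%:E).
  by move=> [mY _]; exact: measurable_sqr.
have fin Y : centered_gaussian P Y -> (\int[P]_w ((Y w) ^+ 2)%:E)%E \is a fin_num.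
  move=> gY; rewrite ge0_fin_numE; first exact: gaussian_second_moment.
  by apply: integral_ge0 => w _; rewrite lee_fin sqr_ge0.
have l2E Y : centered_gaussian P Y ->
    (\int[P]_w ((Y w) ^+ 2)%:E)%E = ((l2norm P Y) ^+ 2)%:E.
  move=> gY; rewrite /l2norm sqr_sqrtr ?fineK//; first exact: fin.
  by apply/fine_ge0/integral_ge0 => w _; rewrite lee_fin sqr_ge0.
set a := l2norm P U; set b := l2norm P V; set c := l2norm P W.
have a0 : 0 <= a by exact: l2norm_ge0.
have b0 : 0 <= b by exact: l2norm_ge0.
have c0 : 0 <= c by exact: l2norm_ge0.
have key : (\int[P]_w ((U w + V w + W w) ^+ 2)%:E <=
    (3 * (a ^+ 2 + b ^+ 2 + c ^+ 2))%:E)%E.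
  apply: (@le_trans _ _ (\int[P]_w (3%:E * (((U w) ^+ 2)%:E + ((V w) ^+ 2)%:E + ((W w) ^+ 2)%:E)))%E).
    apply: ge0_le_integral => //=.
    - by move=> w _; rewrite lee_fin sqr_ge0.
    - apply: measurable_sqr; apply: measurable_funD; last exact: gW.1.
      by apply: measurable_funD; [exact: gU.1|exact: gV.1].
    - apply: emeasurable_funM; first exact: measurable_cst.
      by apply: emeasurable_funD; [apply: emeasurable_funD|]; exact: m2.
    move=> w _; rewrite -!EFinD -EFinM lee_fin.
    have := sqr_ge0 (U w - V w); have := sqr_ge0 (V w - W w).
    have := sqr_ge0 (U w - W w); rewrite !expr2; nra.
  rewrite ge0_integralZl//=; last 2 first.
  - by apply: emeasurable_funD; [apply: emeasurable_funD|]; exact: m2.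
  - by move=> w _; rewrite -!EFinD lee_fin !addr_ge0 ?sqr_ge0.
  rewrite ge0_integralD//=; last 4 first.
  - by move=> w _; rewrite -EFinD lee_fin addr_ge0 ?sqr_ge0.
  - by apply: emeasurable_funD; exact: m2.
  - by move=> w _; rewrite lee_fin sqr_ge0.
  - exact: m2.
  rewrite ge0_integralD//=; last 4 first.
  - by move=> w _; rewrite lee_fin sqr_ge0.
  - exact: m2.
  - by move=> w _; rewrite lee_fin sqr_ge0.
  - exact: m2.
  by rewrite !l2E// -!EFinD -EFinM lee_fin.
have S0 : 0 <= 2 * (a + b + c) by lra.
rewrite -[leRHS]ger0_norm// -sqrtr_sqr ler_sqrt ?sqr_ge0//.
apply: (@le_trans _ _ (3 * (a ^+ 2 + b ^+ 2 + c ^+ 2))).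
  rewrite -lee_fin fineK// ge0_fin_numE; first exact: le_lt_trans key (ltry _).
  by apply: integral_ge0 => w _; rewrite lee_fin sqr_ge0.
rewrite !expr2; nra.
Qed.

End L2.

Section Chaining.
Variables (R : realType) (n d : nat) (dO : measure_display).
Variables (Omega : measurableType dO) (P : probability Omega R).
Variable X : Omega -> 'rV[R]_n -> 'rV[R]_d.
Hypothesis hG : forall i : 'I_d, centered_gaussian_field P (fun w t => X w t ord0 i).
Local Notation rho := (rho P X).

(* If [|t - u|] is about [exp (- 2^k)], then [2^k] is about [log (1 / |t - u|)]. *)
Definition log_regular (C : set 'rV[R]_n) : Prop :=
  forall N, exists (c : R) (k0 : nat), 0 < c /\ forall k, (k0 <= k)%N -> forall t u, C t -> C u ->
    near_pts (expR (- 2 ^+ k)) t u -> forall l, rho l t u <= c * 2 ^- (k * N).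

Lemma rho_add3 l p t u q :
  rho l p q <= 2 * (rho l p t + rho l t u + rho l u q).
Proof.
rewrite !rho_l2norm.
have -> : (fun w => X w p ord0 l - X w q ord0 l) = (fun w =>
    (X w p ord0 l - X w t ord0 l) + (X w t ord0 l - X w u ord0 l) +
    (X w u ord0 l - X w q ord0 l)) by apply/funext => w; ring.
by apply: l2norm_add3; exact: increment_gaussian.
Qed.

Lemma near_pts_sym (e : R) (t u : 'rV[R]_n) : near_pts e t u -> near_pts e u t.
Proof. by move=> h i; rewrite distrC. Qed.

Lemma near_pts_le (e e' : R) (t u : 'rV[R]_n) : e <= e' ->
  near_pts e t u -> near_pts e' t u.
Proof. by move=> ee' h i; apply: le_trans ee'. Qed.

Lemma expRN2_double k : 2 * expR (- 2 ^+ k.+1) <= expR (- 2 ^+ k) :> R.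
Proof.
have -> : expR (- 2 ^+ k.+1) = expR (- 2 ^+ k) * expR (- 2 ^+ k) :> R.
  by rewrite -expRD; congr expR; rewrite exprS; ring.
rewrite mulrA ler_piMl ?expR_ge0//.
rewrite expRN ler_pdivrMr ?expR_gt0// mul1r.
have := expR_ge1Dx (2 ^+ k : R); have := exp2_ge1 R k; lra.
Qed.

Section OnePath.
Variables (w : Omega) (C : set 'rV[R]_n) (vs : nat -> seq 'rV[R]_n) (k0 : nat).
Hypothesis cw : forall l : 'I_d, continuous (fun t => X w t ord0 l).
Hypothesis regC : log_regular C.
Hypothesis vsC : forall k v, v \in vs k -> C v.
Hypothesis net : forall k t, C t -> exists2 v, v \in vs k & near_pts (expR (- 2 ^+ k)) t v.
Hypothesis incr : forall k p q l, (k0 <= k)%N ->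
  p \in vs k ++ vs k.+1 -> q \in vs k ++ vs k.+1 ->
  `|X w p ord0 l - X w q ord0 l| <= 2 ^+ k / 8 * rho l p q.

(** Along net points tending to [t], step [j] moves the path by at most [2^j / 8] times [rho], and
    [rho] is of order [2^-(j (N+2))]. The steps sum geometrically to order [2^-(k (N+1))]: the
    exponent [N+2] pays for the factor [2^j]. Continuity reaches [t] itself. *)
Lemma chain_approx N : exists (c : R) (k1 : nat), 0 < c /\ forall k t, (k1 <= k)%N -> C t ->
  exists v, [/\ v \in vs k, near_pts (expR (- 2 ^+ k)) t v &
    forall l, `|X w t ord0 l - X w v ord0 l| <= c * 2 ^- (k * N.+1)].
Proof.
have [c [k1 [c0 hc]]] := regC N.+2.
exists (c * 2 ^+ N.+2), (maxn k0 k1).+1; split; first by rewrite mulr_gt0.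
move=> k t + Ct; rewrite gtn_max => /andP[k0k k1k].
have /choice[v hv] j : exists v, v \in vs j /\ near_pts (expR (- 2 ^+ j)) t v.
  by have [v] := net j Ct; exists v.
exists (v k); split; [exact: (hv k).1|exact: (hv k).2|move=> l].
pose D : R := c * 2 ^+ N.+2 / 8.
have D0 : 0 <= D.
  by apply: divr_ge0 => //; apply: mulr_ge0; [exact: ltW|exact: exprn_ge0].
have step j : (k <= j)%N ->
    `|X w (v j) ord0 l - X w (v j.+1) ord0 l| <= D * 2 ^- (j * N.+1).
  move=> kj; have jk0 : (k0 <= j)%N by rewrite (leq_trans _ kj)// ltnW.
  case: j kj jk0 => [|j] kj jk0.
    by move: kj; rewrite leqn0 => /eqP k0'; rewrite k0' in k0k.
  apply: le_trans (incr l jk0 _ _) _.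
  - by rewrite mem_cat (hv j.+1).1.
  - by rewrite mem_cat (hv j.+2).1 orbT.
  (* Consecutive net points are within [exp(-2^j)] of each other by [expRN2_double], so regularity
     is used one level below. *)
  have nv : near_pts (expR (- 2 ^+ j)) (v j.+1) (v j.+2).
    move=> i; have := (hv j.+1).2 i; have := (hv j.+2).2 i.
    have := expRN2_double j; have := expRN2_double j.+1.
    have := expR_ge0 (- 2 ^+ j.+2 : R).
    rewrite !ler_norml => h0 h1 h2 /andP[h3 h4] /andP[h5 h6].
    by apply/andP; split; lra.
  have jk1 : (k1 <= j)%N by rewrite -ltnS (leq_trans k1k).
  have := hc j jk1 _ _ (vsC (hv j.+1).1) (vsC (hv j.+2).1) nv l.
  move=> h; apply: (@le_trans _ _ (2 ^+ j.+1 / 8 * (c * 2 ^- (j * N.+2)))).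
    by rewrite ler_wpM2l ?divr_ge0 ?exprn_ge0.
  rewrite /D le_eqVlt; apply/orP; left; apply/eqP.
  have e1 : 2 ^- (j * N.+2) = 2 ^+ N.+2 * 2 ^- (j.+1 * N.+2) :> R.
    by rewrite mulSn exprD invfM mulrA mulfV ?mul1r// expf_neq0.
  have e2 : 2 ^- (j.+1 * N.+1) = 2 ^+ j.+1 * 2 ^- (j.+1 * N.+2) :> R.
    by rewrite [in RHS]mulnS exprD invfM mulrA mulfV ?mul1r// expf_neq0.
  by rewrite e1 e2; ring.
(* Subtracting the tail of the geometric series makes the bound inductive. *)
have tel m : `|X w (v k) ord0 l - X w (v (k + m)%N) ord0 l| <=
    2 * D * 2 ^- (k * N.+1) - 2 * D * 2 ^- ((k + m) * N.+1).
  elim: m => [|m IH]; first by rewrite addn0 !subrr normr0.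
  have := step (k + m)%N (leq_addr _ _); rewrite -addnS.
  have : 2 * 2 ^- ((k + m.+1) * N.+1) <= 2 ^- ((k + m) * N.+1) :> R.
    rewrite addnS mulSn exprD invfM mulrA ler_piMl ?invr_ge0 ?exprn_ge0//.
    by rewrite ler_pdivrMr// mul1r exprS ler_peMr// exp2_ge1.
  move=> h1 h2.
  rewrite -[X w (v k) _ _](subrK (X w (v (k + m)%N) ord0 l)) -addrA.
  apply: (le_trans (ler_normD _ _)).
  have := ler_wpM2l D0 h1; move: IH h2; lra.
have Ddef : 2 * D <= c * 2 ^+ N.+2.
  rewrite /D; have : 0 <= c * 2 ^+ N.+2; last by lra.
  by apply: mulr_ge0; [exact: ltW|exact: exprn_ge0].
apply/ler_addgt0Pr => e e0.
have := @cw l t; move=> /cvgrPdist_lt /(_ e e0) /nbhs_ballP[dl dl0 hdl].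
have [m hm] := exp2N_lt dl0.
have : ball t dl (v (k + m)%N).
  split => // i j; rewrite /ball /= ord1; apply: le_lt_trans ((hv _).2 j) _.
  apply: le_lt_trans hm; rewrite expRN lef_pV2 ?posrE ?expR_gt0//.
  have := expR_ge1Dx (2 ^+ (k + m) : R).
  have : 2 ^+ m <= 2 ^+ (k + m) :> R by rewrite ler_eXn2l ?ltr1n// leq_addl.
  lra.
move=> /hdl /= h.
apply: (@le_trans _ _ (`|X w t ord0 l - X w (v (k + m)%N) ord0 l| +
    `|X w (v k) ord0 l - X w (v (k + m)%N) ord0 l|)).
  rewrite (distrC (X w (v k) ord0 l)); apply: le_trans (ler_normD _ _).
  by rewrite addrA subrK.
have hm' := tel m; have h' := ltW h.
have q0 : 0 <= 2 ^- (k * N.+1) :> R by rewrite invr_ge0 exprn_ge0.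
have := ler_wpM2r q0 Ddef.
have : 0 <= 2 * D * 2 ^- ((k + m) * N.+1).
  by apply: mulr_ge0; [exact: mulr_ge0|rewrite invr_ge0 exprn_ge0].
lra.
Qed.

(** [t] and [u] are replaced by net points of level [k]. The approximation errors, and [2^k] times
    the [rho]-distances to the net points, are constants times the radius, which [2^k] absorbs; the
    1/8 in [incr] leaves room for the factor 2 of [rho_add3]. *)
Lemma chain_path b : exists k1, forall k, (k1 <= k)%N -> forall t u, C t -> C u ->
  forall l, `|X w t ord0 l - X w u ord0 l| <=
    2 ^+ k * Num.max (2 ^- (b.+1 * k) / 2) (rho l t u).
Proof.
have [c [k1 [c0 hc]]] := chain_approx b.
have [c' [k2 [c'0 hc']]] := regC b.+2.
pose E := 2 * c + c'.
have [k3 hk3] : exists k3, E <= 2 ^+ k3 / 4.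
  exists (Num.bound (4 * E)); rewrite ler_pdivlMr// mulrC.
  apply/ltW/lt_trans/(ltr_nat_exp2 R); apply: archi_boundP.
  by rewrite mulr_ge0// addr_ge0 ?mulr_ge0 ?(ltW c0) ?(ltW c'0).
exists (maxn (maxn k0 k1) (maxn k2 k3)) => k.
rewrite !geq_max => /andP[/andP[k0k k1k] /andP[k2k k3k]] t u Ct Cu l.
have [v [vv tv hv]] := hc k t k1k Ct; have [v' [vv' uv' hv']] := hc k u k1k Cu.
have r1 := hc' k k2k _ _ (vsC vv) Ct (near_pts_sym tv) l.
have r2 := hc' k k2k _ _ Cu (vsC vv') uv' l.
have i1 : `|X w v ord0 l - X w v' ord0 l| <= 2 ^+ k / 8 * rho l v v'.
  by apply: incr => //; rewrite mem_cat ?vv ?vv'.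
have r3 := rho_add3 l v t u v'.
set r := 2 ^- (b.+1 * k) / 2; set m := Num.max r (rho l t u).
have rm : r <= m by rewrite le_max lexx.
have pm : rho l t u <= m by rewrite le_max lexx orbT.
have x0 : 0 <= 2 ^+ k / 8 :> R by rewrite divr_ge0 ?exprn_ge0.
have i2 := le_trans i1 (ler_wpM2l x0 r3).
have i3 : `|X w t ord0 l - X w u ord0 l| <=
    `|X w t ord0 l - X w v ord0 l| + `|X w v ord0 l - X w v' ord0 l| +
    `|X w u ord0 l - X w v' ord0 l|.
  rewrite [X in _ <= _ + _ + X]distrC.
  rewrite (_ : X w t ord0 l - _ = (X w t ord0 l - X w v ord0 l) +
    (X w v ord0 l - X w v' ord0 l) + (X w v' ord0 l - X w u ord0 l)); last by ring.
  apply: (le_trans (ler_normD _ _)); rewrite lerD2r; exact: ler_normD.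
have := hv l; have := hv' l => h1 h2.
have e1 : 2 ^+ k * (c' * 2 ^- (k * b.+2)) = c' * 2 ^- (k * b.+1).
  rewrite mulrCA; congr (_ * _).
  by rewrite [(k * b.+2)%N]mulnS exprD invfM mulrA mulfV ?mul1r// expf_neq0.
have rE : 2 ^- (k * b.+1) = 2 * r by rewrite /r mulnC; field; rewrite expf_neq0.
rewrite rE in e1 h1 h2.
have r0 : 0 < r by rewrite divr_gt0// invr_gt0.
have g1 : E * r <= 2 ^+ k / 4 * r.
  rewrite ler_pM2r//; apply: le_trans hk3 _.
  by rewrite ler_pM2r ?invr_gt0// ler_eXn2l ?ltr1n.
have g2 : 2 ^+ k * r <= 2 ^+ k * m by rewrite ler_pM2l.
have g3 : 2 ^+ k * rho l t u <= 2 ^+ k * m by rewrite ler_pM2l.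
have g4 : 2 ^+ k * rho l v t <= c' * (2 * r) by rewrite -e1 ler_pM2l.
have g5 : 2 ^+ k * rho l u v' <= c' * (2 * r) by rewrite -e1 ler_pM2l.
rewrite /E in g1.
clear -i2 i3 h1 h2 g1 g2 g3 g4 g5 r0 c0 c'0.
have : 0 < c * r by rewrite mulr_gt0.
have : 0 < c' * r by rewrite mulr_gt0.
lra.
Qed.

End OnePath.
End Chaining.

Section GoodPaths.
Variables (R : realType) (n d : nat) (dO : measure_display).
Variables (Omega : measurableType dO) (P : probability Omega R).
Variable X : Omega -> 'rV[R]_n -> 'rV[R]_d.
Hypothesis hG : forall i : 'I_d, centered_gaussian_field P (fun w t => X w t ord0 i).
Hypothesis hC : {ae P, forall w, forall i : 'I_d, continuous (fun t => X w t ord0 i)}.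
Local Notation rho := (rho P X).

Lemma prob_bigsetU_le (I : eqType) (s : seq I) (A : I -> set Omega) (c : R) :
  (forall x, x \in s -> measurable (A x) /\ (P (A x) <= c%:E)%E) ->
  measurable (\big[setU/set0]_(x <- s) A x) /\
  (P (\big[setU/set0]_(x <- s) A x) <= ((size s)%:R * c)%:E)%E.
Proof.
elim: s => [|x s IH] h; first by rewrite big_nil measure0 mul0r.
have [h1 h2] := h x (mem_head _ _).
have [|h3 h4] := IH; first by move=> y ys; apply: h; rewrite inE ys orbT.
rewrite big_cons; split; first exact: measurableU.
apply: (le_trans (measureU2 _ h1 h3)).
by rewrite /= -natr1 mulrDl mul1r addrC EFinD leeD.
Qed.

(** The first Borel-Cantelli lemma. *)
Lemma eventually_not (F : nat -> set Omega) (D : R) :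
  (forall k, measurable (F k)) -> (forall k, (P (F k) <= (D * (1 / 2) ^+ k)%:E)%E) ->
  {ae P, forall w, exists k0, forall k, (k0 <= k)%N -> ~ F k w}.
Proof.
move=> mF hF; exists (lim_sup_set F); split.
- apply: bigcapT_measurable => k; apply: bigcup_measurable => j _; exact: mF.
- apply: lim_sup_set_cvg0 => //.
  have D0 : 0 <= D.
    have := hF 0%N; rewrite expr0 mulr1 => h0; rewrite -lee_fin.
    exact: le_trans (measure_ge0 _ _) h0.
  apply: (@le_lt_trans _ _ (D / (1 - 1 / 2))%:E); last exact: ltry.
  apply: lime_le; first exact: is_cvg_nneseries.
  apply: nearW => m.
  apply: (@le_trans _ _ (\sum_(0 <= k < m) (D * (1 / 2) ^+ k)%:E)%E).
    by apply: lee_sum => k _; exact: hF.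
  rewrite sumEFin lee_fin.
  have q0 : 0 < 1 / 2 :> R by rewrite divr_gt0.
  have q1 : `|1 / 2| < 1 :> R by rewrite gtr0_norm//; lra.
  have := geometric_le_lim m D0 q0 q1; apply: le_trans.
  by rewrite seriesEnat/=; apply: ler_sum => i _.
- move=> w /= hw k0 _; apply: contrapT => hno; apply: hw; exists k0 => k k0k Fk.
  by apply: hno; exists k.
Qed.

(** Level [k] has at most a constant times [exp(4 n 2^k)] increments between net points, and each
    exceeds [2^k / 8] times its [rho] with probability at most [2 exp(-(2^k / 8)^2 / 36)]. The
    square of [2^k] wins. These events do not involve [b], so one null set serves all [b]. *)
Lemma good_paths (C : set 'rV[R]_n) (M : R) :
  (forall t, C t -> forall i, `|t ord0 i| <= M) -> log_regular P X C ->
  {ae P, forall w, forall b : nat, exists k1, forall k, (k1 <= k)%N ->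
    forall t u, C t -> C u -> forall l, `|X w t ord0 l - X w u ord0 l| <=
      2 ^+ k * Num.max (2 ^- (b.+1 * k) / 2) (rho l t u)}.
Proof.
move=> hM regC.
have [-> |/set0P Cn] := eqVneq C set0.
  by apply: aeW => w b; exists 0%N.
pose M' := `|M| + 1.
have M0 : 0 < M' by rewrite ltr_wpDl.
have {}hM t : C t -> forall i, `|t ord0 i| <= M'.
  by move=> Ct i; apply: (le_trans (hM t Ct i)); rewrite (le_trans (ler_norm _))// lerDl.
have /choice[vs hvs] k : exists vs : seq 'rV[R]_n,
    [/\ (size vs)%:R <= ((2 * M' + 1) / expR (- 2 ^+ k)) ^+ n,
        forall v, v \in vs -> C v &
        forall t, C t -> exists2 v, v \in vs & near_pts (expR (- 2 ^+ k)) t v].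
  have [|F [net [h1 h2 h3]]] := @bounded_net R n C M' (expR (- 2 ^+ k)) Cn M0 _ hM.
    by rewrite expR_gt0 -expR0 ler_expR oppr_le0 exprn_ge0.
  exists [seq net x | x <- enum F]; split.
  - by rewrite size_map -cardE.
  - by move=> v /mapP[x _ ->].
  - by move=> t /h3[x hx]; exists (net x) => //; apply: map_f; rewrite mem_enum.
(* Two consecutive nets: a chain step joins level [k] to [k.+1], a comparison joins two points of
   level [k]. *)
pose pts k := vs k ++ vs k.+1.
pose ix k := [seq (pq, l) | pq <- [seq (p, q) | p <- pts k, q <- pts k], l <- enum 'I_d].
pose Ev k (x : 'rV[R]_n * 'rV[R]_n * 'I_d) : set Omega :=
  [set w | 2 ^+ k / 8 * rho x.2 x.1.1 x.1.2 <
    `|X w x.1.1 ord0 x.2 - X w x.1.2 ord0 x.2|].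
pose B k := \big[setU/set0]_(x <- ix k) Ev k x.
pose x k : R := 2 ^+ k.
have hB k : measurable (B k) /\ (P (B k) <=
    ((size (ix k))%:R * (2 * expR (- (x k / 8) ^+ 2 / 36)))%:E)%E.
  apply: prob_bigsetU_le => -[[p q] l] _ /=.
  have gY := increment_gaussian hG l p q.
  split; first by apply: measurable_abs_gt; have [] := gY.
  by apply: (gaussian_tail gY); rewrite divr_ge0 ?exprn_ge0.
pose K := (2 * M' + 1) ^+ n.
have K0 : 0 <= K by rewrite exprn_ge0// addr_ge0// mulr_ge0 ?(ltW M0).
have szvs k : (size (vs k))%:R <= K * expR (n%:R * x k).
  have [h _ _] := hvs k; apply: (le_trans h).
  by rewrite exprMn /K expRN invrK -expRM_natl mulr_natl.
have szpts k : (size (pts k))%:R <= 2 * K * expR (2 * n%:R * x k).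
  rewrite size_cat natrD.
  have e1 := szvs k; have e2 := szvs k.+1.
  have xS : x k.+1 = 2 * x k by rewrite /x exprS.
  have x0 : 0 <= n%:R * x k by rewrite mulr_ge0// exprn_ge0.
  have e3 : K * expR (n%:R * x k) <= K * expR (2 * n%:R * x k).
    by rewrite ler_wpM2l// ler_expR; lra.
  rewrite xS mulrCA mulrA in e2; lra.
pose D := 8 * d%:R * K ^+ 2.
have D0 : 0 <= D by rewrite /D !mulr_ge0// sqr_ge0.
have hsz k : (size (ix k))%:R * (2 * expR (- (x k / 8) ^+ 2 / 36)) <=
    D * expR (4 * n%:R * x k - (x k / 8) ^+ 2 / 36).
  rewrite !size_allpairs size_enum_ord !natrM.
  apply: (@le_trans _ _ ((2 * K * expR (2 * n%:R * x k)) ^+ 2 * d%:R *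
      (2 * expR (- (x k / 8) ^+ 2 / 36)))).
    rewrite ler_wpM2r ?mulr_ge0 ?expR_ge0// ler_wpM2r// expr2.
    by apply: ler_pM => //; exact: szpts.
  have -> : 4 * n%:R * x k - (x k / 8) ^+ 2 / 36 =
    2 * n%:R * x k + 2 * n%:R * x k + - (x k / 8) ^+ 2 / 36 by field.
  rewrite !expRD /D le_eqVlt; apply/orP; left; apply/eqP; ring.
have [k1 hk1] : exists k1, forall k, (k1 <= k)%N ->
    expR (4 * n%:R * x k - (x k / 8) ^+ 2 / 36) <= (1 / 2) ^+ k.
  pose a : R := 64 * 36 * (4 * n%:R + 1).
  exists (Num.bound a) => k hk.
  have a0 : 0 <= a by rewrite /a !mulr_ge0// addr_ge0// mulr_ge0.
  have ax : a <= x k.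
    apply: (le_trans (ltW (archi_boundP a0))).
    apply: (@le_trans _ _ k%:R); first by rewrite ler_nat.
    exact/ltW/ltr_nat_exp2.
  have x0 : 0 < x k by exact: exp2_gt0.
  have h1 : 4 * n%:R * x k - (x k / 8) ^+ 2 / 36 <= - x k.
    have := ler_wpM2r (ltW x0) ax.
    have -> : (x k / 8) ^+ 2 / 36 = (x k * x k) / (64 * 36) by field.
    rewrite /a => h.
    have h' : (4 * n%:R + 1) * x k <= x k * x k / (64 * 36).
      by rewrite ler_pdivlMr ?mulr_gt0//; lra.
    move: h'; rewrite mulrDl mul1r; lra.
  apply: (@le_trans _ _ (expR (- x k))); first by rewrite ler_expR.
  rewrite expRN expr_div_n expr1n div1r lef_pV2 ?posrE ?expR_gt0//.
  by have := expR_ge1Dx (x k); rewrite /x; lra.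
pose F k := if (k1 <= k)%N then B k else set0.
have mF k : measurable (F k) by rewrite /F; case: ifP => // _; exact: (hB k).1.
have hF k : (P (F k) <= (D * (1 / 2) ^+ k)%:E)%E.
  rewrite /F; case: ifP => [kk|_]; last first.
    by rewrite measure0 lee_fin mulr_ge0 ?exprn_ge0 ?divr_ge0.
  apply: (le_trans (hB k).2); rewrite lee_fin; apply: (le_trans (hsz k)).
  by rewrite ler_wpM2l// hk1.
apply: filterS2 hC (eventually_not mF hF) => w cw [k0 hk0] b.
apply: (@chain_path R n d dO Omega P X hG w C vs (maxn k0 k1)) => //.
- by move=> k v hv; have [_ h _] := hvs k; exact: h.
- by move=> k t Ct; have [_ _ h] := hvs k; exact: h.
- move=> k p q l; rewrite geq_max => /andP[k0k k1k] hp hq.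
  rewrite leNgt; apply/negP => hlt; apply: (hk0 k k0k).
  rewrite /F k1k /B -bigcup_seq; exists (p, q, l) => //=.
  by apply/allpairsP; exists ((p, q), l); split => //; rewrite ?mem_enum//;
    apply/allpairsP; exists (p, q).
Qed.

End GoodPaths.

Section AeMonotone.
Import HBNNSimple.
Variables (R : realType) (dO : measure_display) (Omega : measurableType dO).
Variable P : {measure set Omega -> \bar R}.

(* No measurability is assumed: the integrand of the definition of [dimPZ_mu] is
   only controlled off a null set. *)
Lemma ae_ge0_le_integral_nonmeas (f1 f2 : Omega -> \bar R) :
  (forall w, 0 <= f1 w)%E -> (forall w, 0 <= f2 w)%E ->
  {ae P, forall w, (f1 w <= f2 w)%E} ->
  (\int[P]_w f1 w <= \int[P]_w f2 w)%E.
Proof.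
move=> f10 f20 [N [mN PN hN]].
rewrite !ge0_integralTE//; apply: ge_ereal_sup => _ [h hf <-].
(* Set to zero on the null set, the simple function lies below [f2] and keeps its integral. *)
pose h' := proj_nnsfun h (measurableC mN).
have h'E w : h' w = h w * \1_(~` N) w by [].
apply: (@le_trans _ _ (sintegral P h')); last first.
  apply: ereal_sup_ubound; exists h' => // w; rewrite [h' w]h'E indicE.
  have [|] := boolP (w \in ~` N); last by rewrite mulr0.
  rewrite inE mulr1 => Nw; apply: le_trans (hf w) _; apply: contrapT => hno.
  by apply: Nw; apply: hN.
rewrite -!integralT_nnsfun le_eqVlt; apply/orP; left; apply/eqP.
apply: ae_eq_integral => //; [exact/measurable_EFinP|exact/measurable_EFinP|].
exists N; split => // w /= hw; apply: contrapT => Nw; apply: hw => _.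
have e : h' w = h w by rewrite h'E indicE mem_set// mulr1.
exact: (congr1 EFin (esym e)).
Qed.

End AeMonotone.

Section Regularity.
Variables (R : realType) (n d : nat) (dO : measure_display).
Variables (Omega : measurableType dO) (P : probability Omega R).
Variable X : Omega -> 'rV[R]_n -> 'rV[R]_d.
Hypothesis hG : forall i : 'I_d, centered_gaussian_field P (fun w t => X w t ord0 i).
Hypothesis hC : {ae P, forall w, forall i : 'I_d, continuous (fun t => X w t ord0 i)}.

(** Almost sure continuity and Fatou's lemma make [rho] lower semicontinuous. *)
Lemma rho_closure (c : R) l t u : 0 <= c ->
  (forall j, exists t' u', [/\ near_pts (2 ^- j) t t', near_pts (2 ^- j) u u' &
    rho P X l t' u' <= c]) -> rho P X l t u <= c.
Proof.
move=> c0 /choice[t' /choice[u' h]].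
pose f j w := (((X w (t' j) ord0 l - X w (u' j) ord0 l) ^+ 2)%:E : \bar R).
have mf j : measurable_fun [set: Omega] (f j).
  by apply: measurable_sqr; have [] := increment_gaussian hG l (t' j) (u' j).
have f0 j w : (0 <= f j w)%E by rewrite lee_fin sqr_ge0.
have hint : (\int[P]_w ((X w t ord0 l - X w u ord0 l) ^+ 2)%:E <= (c ^+ 2)%:E)%E.
  apply: (@le_trans _ _ (\int[P]_w limn_einf (f^~ w))%E).
    apply: ae_ge0_le_integral_nonmeas.
    - by move=> w; rewrite lee_fin sqr_ge0.
    - move=> w; rewrite limn_einf_lim; apply: lime_ge; first exact: is_cvg_einfs.
      by apply: nearW => k; apply: le_ereal_inf_tmp => _ [j _ <-].
    apply: filterS hC => w cw.
    have cv (v : 'rV[R]_n) (v' : nat -> 'rV[R]_n) :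
        (forall j, near_pts (2 ^- j) v (v' j)) ->
        X w (v' j) ord0 l @[j --> \oo] --> X w v ord0 l.
      move=> hv; apply: (cvg_comp v' (fun t => X w t ord0 l)); last exact: cw.
      apply/cvg_ballP => e e0; have [m hm] := exp2N_lt e0.
      exists m => // j /= mj; split => // i i'; rewrite /ball /= ord1.
      apply: le_lt_trans (hv j i') _; apply: le_lt_trans hm.
      by rewrite lef_pV2 ?posrE// ler_eXn2l ?ltr1n.
    have c1 := cv t t' (fun j => let: And3 h1 _ _ := h j in h1).
    have c2 := cv u u' (fun j => let: And3 _ h1 _ := h j in h1).
    have : f j w @[j --> \oo] --> ((X w t ord0 l - X w u ord0 l) ^+ 2)%:E.
      apply: cvg_EFin; first exact: nearW.
      by rewrite /comp /=; apply: (@cvgM R) ; apply: cvgB.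
    by move=> /cvg_limn_einf_sup[-> _].
  apply: (le_trans (fatou _ measurableT mf _)) => //.
  apply: (@limn_einf_le _ _ _ 0) => j _; have [_ _ hj] := h j.
  have fin : (\int[P]_w f j w)%E \is a fin_num.
    rewrite ge0_fin_numE; first exact/gaussian_second_moment/increment_gaussian.
    by apply: integral_ge0.
  rewrite -(fineK fin) lee_fin.
  have <- : rho P X l (t' j) (u' j) ^+ 2 = fine (\int[P]_w f j w)%E.
    by rewrite /rho sqr_sqrtr//; apply/fine_ge0/integral_ge0 => w _; exact: f0.
  by rewrite lerXn2r ?nnegrE// rho_ge0.
rewrite /rho -[leRHS]ger0_norm// -sqrtr_sqr ler_sqrt ?sqr_ge0//.
rewrite -lee_fin fineK// ge0_fin_numE; first exact: le_lt_trans hint (ltry _).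
by apply: integral_ge0 => w _; rewrite lee_fin sqr_ge0.
Qed.

Lemma closure_near (C : set 'rV[R]_n) t (e : R) : 0 < e -> closure C t ->
  exists2 t', C t' & near_pts e t t'.
Proof.
move=> e0 ct; have [t' [Ct' [_ ht']]] := ct _ (nbhsx_ballx t e e0).
by exists t' => // i; have := ht' ord0 i; rewrite /ball /= => /ltW.
Qed.

(** Pieces have to be closed for the graph over them to be Suslin. Approximating points of the
    closure doubles the distance at most, which costs one level of [k]. *)
Lemma log_regular_closure C : log_regular P X C -> log_regular P X (closure C).
Proof.
move=> regC N; have [c [k0 [c0 hc]]] := regC N.
exists (c * 2 ^+ N), k0.+1; split; first by rewrite mulr_gt0.
move=> [//|k] k0k t u ct cu ntu l.
have e2 : 0 < expR (- 2 ^+ k.+1) / 2 :> R by rewrite divr_gt0// expR_gt0.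
rewrite (_ : c * 2 ^+ N * _ = c * 2 ^- (k * N)); last first.
  by rewrite mulSn exprD; field; rewrite !expf_neq0.
apply: rho_closure => [|j].
  by rewrite mulr_ge0 ?(ltW c0)// invr_ge0 exprn_ge0.
pose e := Num.min (2 ^- j) (expR (- 2 ^+ k.+1) / 2) : R.
have e0 : 0 < e by rewrite lt_min invr_gt0 exp2_gt0.
have [t' Ct' ht'] := closure_near e0 ct; have [u' Cu' hu'] := closure_near e0 cu.
exists t', u'; split.
- by apply: near_pts_le ht'; rewrite ge_min lexx.
- by apply: near_pts_le hu'; rewrite ge_min lexx.
- apply: hc => // i; have := ht' i; have := hu' i; have := ntu i.
  have : e <= expR (- 2 ^+ k.+1) / 2 by rewrite ge_min lexx orbT.
  have := expRN2_double R k.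
  rewrite !ler_norml => h0 h1 /andP[h2 h3] /andP[h4 h5] /andP[h6 h7].
  by apply/andP; split; lra.
Qed.

Lemma regular_log (C : set 'rV[R]_n) :
  (forall N, (0 < N)%N -> exists c : R, 0 < c /\
    forall t s, C t -> C s -> forall i, rho P X i t s <= c * (ln (enorm (t - s))^-1) ^- N) ->
  log_regular P X C.
Proof.
move=> h N; have [c [c0 hc]] := h N.+1 isT.
(* The threshold [n.+2] absorbs the factor [n + 1] between the Euclidean norm and the largest
   coordinate. *)
exists (c * 2 ^+ N.+1), n.+2; split; first by rewrite mulr_gt0.
move=> [//|k] nk t u Ct Cu ntu l; apply: (le_trans (hc t u Ct Cu l)).
rewrite -mulrA ler_pM2l//.
apply: (@le_trans _ _ (2 ^- (k * N.+1))); last first.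
  rewrite -ler_pdivrMl// -invfM -exprD lef_pV2 ?posrE// ler_eXn2l ?ltr1n//.
  rewrite mulSn; nia.
(* At distance 0 the conventions [0^-1 = 0] and [ln 0 = 0] make the hypothesis read [rho <= 0]. *)
have [e0|e0] := eqVneq (enorm (t - u)) 0.
  by rewrite e0 invr0 ln0// expr0n invr0 invr_ge0 exprn_ge0.
have e1 : 0 < enorm (t - u) by rewrite lt_neqAle eq_sym e0 enorm_ge0.
have hen : enorm (t - u) <= n.+1%:R * expR (- 2 ^+ k.+1).
  by apply: enorm_le_coord => [|i]; [exact: expR_ge0|rewrite !mxE].
have hL : 2 ^+ k <= ln (enorm (t - u))^-1.
  rewrite -ler_expR lnK ?posrE ?invr_gt0// -[leLHS]invrK lef_pV2 ?posrE ?invr_gt0 ?expR_gt0//.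
  rewrite -expRN; apply: (le_trans hen).
  have -> : expR (- 2 ^+ k.+1) = expR (- 2 ^+ k) * expR (- 2 ^+ k) :> R.
    by rewrite -expRD; congr expR; rewrite exprS; ring.
  rewrite mulrA ler_piMl ?expR_ge0// expRN ler_pdivrMr ?expR_gt0// mul1r.
  have := expR_ge1Dx (2 ^+ k : R); apply: le_trans.
  have : n.+1%:R <= 2 ^+ k :> R.
    apply: (le_trans (ltW (ltr_nat_exp2 R _))); rewrite ler_eXn2l ?ltr1n//; exact: nk.
  lra.
rewrite exprM lef_pV2 ?posrE ?exprn_gt0//; last exact: lt_le_trans hL.
by rewrite lerXn2r ?nnegrE ?exprn_ge0//; exact: le_trans hL.
Qed.

(** The given pieces are cut by cubes, which provides finite nets, and then closed. Closing may
    leave [A], hence a covering. *)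
Lemma regular_pieces (A : set 'rV[R]_n) : regular_on P X A ->
  exists (C : nat -> set 'rV[R]_n) (M : nat -> R), A `<=` \bigcup_k C k /\
  forall k, [/\ closed (C k), forall t, C k t -> forall i, `|t ord0 i| <= M k &
    log_regular P X (C k)].
Proof.
move=> [Ak [-> hA]].
pose B (km : nat * nat) := Ak km.1 `&` [set t | forall i, `|t ord0 i| <= km.2%:R].
pose dec k : nat * nat := odflt (0%N, 0%N) (unpickle k).
exists (fun k => closure (B (dec k))), (fun k => (dec k).2%:R + 1); split.
  move=> t [k _ Akt]; have [m hm] : exists m : nat, forall i, `|t ord0 i| <= m%:R.
    exists (Num.bound `|t|) => i; apply/ltW/le_lt_trans/archi_boundP => //.
    rewrite [leRHS]/Num.Def.normr /= mx_normrE.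
    exact: (le_bigmax _ (fun ij : 'I_1 * 'I_n => `|t ij.1 ij.2|) (ord0, i)).
  exists (pickle (k, m)) => //; rewrite /dec pickleK /=; apply: subset_closure.
  by split.
move=> k; split; first exact: closed_closure.
  move=> t ct i; have [t' [_ ht'] /(_ i) h'] := closure_near ltr01 ct.
  have h'' := ht' i; rewrite -[t ord0 i](subrK (t' ord0 i)).
  by apply: (le_trans (ler_normD _ _)); rewrite addrC lerD.
apply/log_regular_closure/regular_log => N N0; have [c [c0 hc]] := hA (dec k).1 N N0.
by exists c; split => // t s [At _] [As _]; exact: hc.
Qed.

End Regularity.

(** * The dimension bound *)

Section LowerLimit.
Variable R : realType.

Lemma limf_einf_eq0 (h : R -> \bar R) : (forall r, 0 <= h r)%E ->
  (forall e dl : R, 0 < e -> 0 < dl -> exists2 r, 0 < r < dl & (h r <= e%:E)%E) ->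
  limf_einf h (0 : R)^'+ = 0%E.
Proof.
move=> h0 hle; rewrite limf_einfE; apply/eqP; rewrite eq_le; apply/andP; split.
  apply: ge_ereal_sup => _ [V V0 <-]; apply/lee_addgt0Pr => e e0; rewrite add0e.
  move: V0 => [dl /= dl0 hdl]; have [r /andP[r0 rdl] hr] := hle e dl e0 dl0.
  apply: le_trans hr; apply: ereal_inf_lbound; exists r => //; apply: hdl => //.
  by rewrite /ball /= sub0r normrN gtr0_norm.
apply: (@le_trans _ _ (ereal_inf (h @` setT))).
  by apply: le_ereal_inf_tmp => _ [r _ <-].
by apply: ereal_sup_ubound; exists setT => //; exact: filterT.
Qed.

(** The Gaussian error beats every power of the radius: [4^k / 144] exceeds [D k] once
    [2^k >= 144 D]. *)
Lemma expR_exp2_decay (a : R) : exists k0, forall k, (k0 <= k)%N ->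
  2 `^ (a * k%:R) * expR (- (2 ^+ k / 2) ^+ 2 / 36) <= 2 ^- k.
Proof.
pose D := (`|a| + 1) * ln 2.
have ln2 : 0 < ln 2 :> R by rewrite ln_gt0 ?ltr1n.
have D0 : 0 <= D by rewrite mulr_ge0 ?(ltW ln2)// addr_ge0.
exists (Num.bound (144 * D)) => k hk.
have hD : 144 * D <= 2 ^+ k.
  have h0 : 0 <= 144 * D by apply: mulr_ge0 => //; exact: ler0n.
  apply: (le_trans (ltW (archi_boundP h0))).
  apply: (@le_trans _ _ k%:R); first by rewrite ler_nat.
  exact/ltW/ltr_nat_exp2.
have hx : D * k%:R <= (2 ^+ k / 2) ^+ 2 / 36.
  have h1 := ltW (ltr_nat_exp2 R k).
  have := ler_pM (mulr_ge0 (ler0n R 144) D0) (ler0n R k) hD h1.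
  have -> : (2 ^+ k / 2) ^+ 2 / 36 = 2 ^+ k * 2 ^+ k / 144 :> R by field.
  move: (2 ^+ k * 2 ^+ k) => y; lra.
apply: (@le_trans _ _ (2 `^ (`|a| * k%:R) * expR (- (D * k%:R)))).
  apply: ler_pM; rewrite ?powR_ge0 ?expR_ge0//.
    by rewrite ler_powR ?ler1n// ler_wpM2r// ler_norm.
  by rewrite ler_expR mulNr lerN2.
have -> : expR (- (D * k%:R)) = 2 `^ (- ((`|a| + 1) * k%:R)).
  by rewrite /powR pnatr_eq0/=; congr expR; rewrite /D; ring.
rewrite -powR2D exp2N_powR ler_powR ?ler1n//; lra.
Qed.

End LowerLimit.

Lemma row_continuous (R : realType) (T : topologicalType) (d : nat)
    (F : T -> 'rV[R]_d) :
  (forall i, continuous (fun t => F t ord0 i)) -> continuous F.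
Proof.
move=> h t; apply/cvg_ballP => e e0.
have : \forall t' \near t, forall i, ball (F t ord0 i) e (F t' ord0 i).
  apply: filter_forall => i.
  by have /cvg_ballP/(_ e e0) := h i t.
by apply: filterS => t' ht'; split => // i j; rewrite ord1.
Qed.

Section Main.
Variables (R : realType) (n d : nat) (dO : measure_display).
Variables (Omega : measurableType dO) (P : probability Omega R).
Variables (X : Omega -> 'rV[R]_n -> 'rV[R]_d) (f : 'rV[R]_n -> 'rV[R]_d).
Hypothesis hG : forall i : 'I_d, centered_gaussian_field P (fun w t => X w t ord0 i).
Hypothesis hI : independent_components P X.
Hypothesis hC : {ae P, forall w, forall i : 'I_d, continuous (fun t => X w t ord0 i)}.
Hypothesis sf : suslin [set p : 'rV[R]_n * 'rV[R]_d | p.2 = f p.1].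

Local Notation Z := (fun w t => X w t + f t).

Definition good_on (C : set 'rV[R]_n) (w : Omega) : Prop :=
  forall b : nat, exists k1, forall k, (k1 <= k)%N ->
    forall t u, C t -> C u -> forall l, `|X w t ord0 l - X w u ord0 l| <=
      2 ^+ k * Num.max (2 ^- (b.+1 * k) / 2) (rho P X l t u).

(** Subtracting the continuous path is a continuous map that carries this graph into the graph of
    [f], which is Suslin. *)
Lemma graph_piece_suslin (A C : set 'rV[R]_n) w : suslin A -> closed C ->
  (forall i : 'I_d, continuous (fun t => X w t ord0 i)) ->
  suslin [set p : 'rV[R]_n * 'rV[R]_d | (A p.1 /\ C p.1) /\ p.2 = Z w p.1].
Proof.
move=> sA cC cw.
pose psi (p : 'rV[R]_n * 'rV[R]_d) := (p.1, p.2 - X w p.1).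
have cpsi : continuous psi.
  move=> p.
  have c0 : (fun q : 'rV[R]_n * 'rV[R]_d => q.1) @ p --> p.1 by exact: cvg_fst.
  have c1 : (fun q : 'rV[R]_n * 'rV[R]_d => q.2) @ p --> p.2 by exact: cvg_snd.
  have c2 : (fun q : 'rV[R]_n * 'rV[R]_d => X w q.1) @ p --> X w p.1.
    by apply: (cvg_comp fst (X w)); [exact: cvg_fst|exact: (row_continuous cw)].
  exact: (cvg_pair c0 (cvgB c1 c2)).
have -> : [set p : 'rV[R]_n * 'rV[R]_d | (A p.1 /\ C p.1) /\ p.2 = Z w p.1] =
    fst @^-1` (A `&` C) `&` psi @^-1` [set p | p.2 = f p.1].
  apply/seteqP; split=> p /= [h1 h2]; split => //=.
    by rewrite h2 addrAC subrr add0r.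
  by rewrite -h2 addrC subrK.
apply: suslin_setI; last exact: suslin_preimage.
apply: suslin_preimage; first by move=> p; exact: cvg_fst.
by apply: suslin_setI => //; exact: suslin_closed.
Qed.

Lemma hits_indic w t (r : R) u :
  (hits (Z w) (Z w t) r u)%:R = \1_(stay X f r t u) w :> R.
Proof.
rewrite indicE; congr (_%:R); congr nat_of_bool; apply/forallP/idP.
  by move=> h; rewrite inE => i _; exact: h.
by rewrite inE => h i; exact: (h i Logic.I).
Qed.

Lemma weighted_integral (L : seq (R * 'rV[R]_n)) t r :
  (forall wu, wu \in L -> 0 <= wu.1) ->
  measurable_fun [set: Omega]
    (fun w => (weighted (fun u => (hits (Z w) (Z w t) r u)%:R) L)%:E) /\
  (\int[P]_w (weighted (fun u => (hits (Z w) (Z w t) r u)%:R) L)%:E =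
   (weighted (fun u => fine (P (stay X f r t u))) L)%:E)%E.
Proof.
move=> L0.
(* The absolute value makes the summands nonnegative for all pairs; it changes nothing on [L]. *)
pose G (wu : R * 'rV[R]_n) w := (`|wu.1|%:E * (\1_(stay X f r t wu.2) w)%:E : \bar R)%E.
have mS u : measurable_fun [set: Omega] (fun w => (\1_(stay X f r t u) w)%:E : \bar R).
  by apply/measurable_EFinP; exact/measurable_indic/measurable_stay.
have mG wu : measurable_fun [set: Omega] (G wu).
  by apply: emeasurable_funM => //; exact: measurable_cst.
have GE : (fun w => (weighted (fun u => (hits (Z w) (Z w t) r u)%:R) L)%:E) =
    (fun w => \sum_(wu <- L) G wu w)%E.
  apply/funext => w; rewrite /weighted -sumEFin big_seq [RHS]big_seq.
  by apply: eq_bigr => wu hwu; rewrite hits_indic EFinM /G ger0_norm ?L0.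
rewrite GE; split; first exact: emeasurable_sum.
rewrite ge0_integral_sum//; last by move=> wu w _; rewrite mule_ge0 ?lee_fin.
rewrite /weighted -sumEFin big_seq [RHS]big_seq; apply: eq_bigr => wu hwu.
rewrite ge0_integralZl//=.
rewrite integral_indic//; last exact: measurable_stay.
rewrite setIT ger0_norm ?L0// EFinM fineK//; apply: fin_num_measure.
exact: measurable_stay.
Qed.

(** For almost every [w] the mass of the ball is at most the lower limit of finite sums over [L m].
    Fatou's lemma moves the expectation to these sums, and their terms are probabilities of [stay],
    bounded by [stay_le] with [T = 2^k]. *)
Lemma expected_mass_le (C : set 'rV[R]_n) w0 (b : nat) (g : R)
    (mu : probability (borelRV R n) R) (K : set 'rV[R]_n)
    (L : nat -> seq (R * 'rV[R]_n)) :
  (forall i : 'I_d, continuous (fun t => X w0 t ord0 i)) -> good_on C w0 ->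
  K `<=` C ->
  (forall m, weighted (fun=> 1) (L m) <= 1 /\
     forall wu, wu \in L m -> 0 <= wu.1 /\ C wu.2) ->
  (forall t j, K t -> exists2 k, (j <= k)%N & forall m, (j < m)%N ->
     weighted (fun u => hkernel (2 ^- (b * k)) (Z w0 t - Z w0 u)) (L m) <=
     2 ^+ d * (2 ^- j * rate b g k)) ->
  (forall z : 'rV[R]_n -> 'rV[R]_d, continuous (fun t => z t - Z w0 t) ->
     forall (zt : 'rV[R]_d) (e : R), 0 < e ->
     (mu [set t : borelRV R n | (enorm (z t - zt) <= e)%R] <=
      limn_einf (fun m => (weighted (fun u => (hits z zt (2 * e) u)%:R)
        (L m))%:E))%E) ->
  forall t, K t -> exists j0, forall j, (j0 <= j)%N -> exists2 k, (j <= k)%N &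
    (\int[P]_w (mu [set u : borelRV R n | eball (Z w t) (2 ^- (b.+1 * k) / 4) (Z w u)])
     <= (27 ^+ d * (2 ^+ d * (2 ^- j * rate b g k)) +
         2 * expR (- (2 ^+ k / 2) ^+ 2 / 36))%:E)%E.
Proof.
move=> cw0 good KC hL hbd hmu t Kt; have [k1 hk1] := good b.
exists (maxn 1 k1) => j; rewrite geq_max => /andP[j1 k1j].
have [k jk hk] := hbd t j Kt; exists k => //.
(* With [T = 2^k] this [r] gives the kernel width [2 T r = 2^-(bk)]. The ball has radius [r / 2],
   since [hits] doubles it. *)
pose r : R := 2 ^- (b.+1 * k) / 2.
have r0 : 0 < r by rewrite divr_gt0// invr_gt0.
have r4 : 2 ^- (b.+1 * k) / 4 = r / 2 by rewrite /r; field; rewrite expf_neq0.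
rewrite r4; have r20 : 0 < r / 2 by rewrite divr_gt0.
have rE : 2 * (r / 2) = r by field.
pose F m w := ((weighted (fun u => (hits (Z w) (Z w t) r u)%:R) (L m))%:E : \bar R).
have L0 m wu : wu \in L m -> 0 <= wu.1 by move=> /(hL m).2[].
have F0 m w : (0 <= F m w)%E.
  rewrite lee_fin /weighted big_seq; apply: sumr_ge0 => wu /L0 h.
  by rewrite mulr_ge0.
apply: (@le_trans _ _ (\int[P]_w limn_einf (F^~ w))%E).
  apply: ae_ge0_le_integral_nonmeas => [w|w|].
  - exact: measure_ge0.
  - rewrite limn_einf_lim; apply: lime_ge; first exact: is_cvg_einfs.
    by apply: nearW => i; apply: le_ereal_inf_tmp => _ [m _ <-].
  apply: filterS hC => w cw.
  have cz : continuous (fun u => Z w u - Z w0 u).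
    have -> : (fun u => Z w u - Z w0 u) = (fun u => X w u - X w0 u).
      by apply/funext => u; rewrite opprD addrACA subrr addr0.
    move=> u; have c1 : X w @ u --> X w u by exact: (row_continuous cw).
    have c2 : X w0 @ u --> X w0 u by exact: (row_continuous cw0).
    exact: (cvgB c1 c2).
  have := hmu (Z w) cz (Z w t) (r / 2) r20; rewrite rE; exact.
apply: (le_trans (fatou _ measurableT _ _)) => //.
  by move=> m; have [] := weighted_integral t r (L0 m).
apply: (@limn_einf_le _ _ _ j.+1) => m jm.
rewrite (weighted_integral t r (L0 m)).2 lee_fin.
set e := 2 * expR _.
have e0 : 0 <= e by rewrite mulr_ge0 ?expR_ge0.
apply: (@le_trans _ _ (27 ^+ d * weighted (fun u => hkernel (2 ^- (b * k))
    (Z w0 t - Z w0 u)) (L m) + e * weighted (fun=> 1) (L m))); last first.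
  apply: lerD; first by rewrite ler_pM2l ?exprn_gt0//; exact: hk.
  by rewrite ler_piMr//; exact: (hL m).1.
rewrite /weighted !mulr_sumr -big_split/= big_seq [leRHS]big_seq.
apply: ler_sum => wu hwu.
rewrite mulrCA [e * _]mulrCA mulr1 -mulrDr ler_wpM2l ?(L0 m)//.
have Cwu : C wu.2 by have [_ /(_ _ hwu)[]] := hL m.
rewrite -lee_fin fineK; last exact/fin_num_measure/measurable_stay.
have T2 : 2 <= 2 ^+ k :> R.
  by rewrite -[leLHS]expr1 ler_eXn2l ?ltr1n// (leq_trans j1).
have := @stay_le R n d dO Omega P X hG hI f w0 (2 ^+ k) r t wu.2 r0 T2.
have -> : 2 * 2 ^+ k * r = 2 ^- (b * k).
  rewrite /r mulSn exprD; field; rewrite !expf_neq0//.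
apply=> l; apply: hk1 => //; first exact: leq_trans jk.
exact: KC.
Qed.

Lemma dimPZ_mu_ge (A C : set 'rV[R]_n) w0 (b : nat) (s g : R) :
  (forall i : 'I_d, continuous (fun t => X w0 t ord0 i)) -> good_on C w0 ->
  suslin A -> closed C -> b.+1%:R * g < b%:R * s ->
  ~ sigma_small b s (Z w0 @` (A `&` C)) ->
  (g%:E <= dimPZ P Z A)%E.
Proof.
move=> cw0 good sA cC gs ns.
have sS := graph_piece_suslin sA cC cw0.
set S := [set p | _] in sS.
have S1 p : S p -> (A `&` C) p.1 /\ p.2 = Z w0 p.1 by [].
have S2 : ~ sigma_small b s (snd @` S).
  apply: contra_not ns; apply: sigma_smallS => _ [t [At Ct] <-].
  by exists (t, Z w0 t).
have [mu [K [L [[cmu smu] aeK KAC hL [hbd hmu]]]]] :=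
  @suslin_measure R n d b s g S (A `&` C) (fun t => X w0 t + f t) sS S1 S2 gs.
apply: (@le_trans _ _ (dimPZ_mu P Z mu)); last first.
  apply: ereal_sup_ubound; exists mu => //; split => //.
  by move=> t /smu[].
apply: ereal_sup_ubound; exists g => //=.
case: aeK => N [mN muN KN]; exists N; split => //.
apply: subset_trans KN => t /= nt Kt; apply: nt.
have hL' m : weighted (fun=> 1) (L m) <= 1 /\
    forall wu, wu \in L m -> 0 <= wu.1 /\ C wu.2.
  by have [h1 h2] := hL m; split => // wu /h2[? []].
have [j0 hj0] := @expected_mass_le C w0 b g mu K L cw0 good
  (fun t Kt => (KAC t Kt).2) hL' hbd hmu t Kt.
have [k0 hk0] := expR_exp2_decay (b.+1%:R * g).
apply: limf_einf_eq0 => [r|e dl e0 dl0].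
  apply: mule_ge0; first by rewrite lee_fin powR_ge0.
  by apply: integral_ge0 => w _; exact: measure_ge0.
(* [4^g] stems from the factor 1/4 in the radius, the other terms from the kernel and the Gaussian
   error. *)
pose D : R := 4 `^ g * (27 ^+ d * 2 ^+ d + 2).
have D0 : 0 <= D by rewrite mulr_ge0 ?powR_ge0// addr_ge0// mulr_ge0 ?exprn_ge0.
have [j1 hj1] := exp2N_lt (divr_gt0 e0 (ltr_pwDr ltr01 D0)).
have [j2 hj2] := exp2N_lt dl0.
pose j := (j0 + k0 + j1 + j2)%N.
have [|k jk hk] := hj0 j; first by rewrite /j -!addnA leq_addr.
have mono i i' : (i <= i')%N -> 2 ^- i' <= 2 ^- i :> R.
  by move=> h; rewrite lef_pV2 ?posrE// ler_eXn2l ?ltr1n.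
exists (2 ^- (b.+1 * k) / 4).
  rewrite divr_gt0 ?invr_gt0//=; apply: le_lt_trans hj2.
  apply: (@le_trans _ _ (2 ^- (b.+1 * k))).
    by rewrite ler_pdivrMr// ler_peMr ?invr_ge0 ?exprn_ge0// ler1n.
  apply: mono; apply: (@leq_trans j); first by rewrite /j leq_addl.
  by rewrite (leq_trans jk)// leq_pmull.
have -> : (2 ^- (b.+1 * k) / 4) `^ (- g) = 4 `^ g / rate b g k.
  rewrite powRM ?invr_ge0 ?exprn_ge0//; rewrite mulrC; congr (_ * _).
    by rewrite -powR_inv1// -powRrM mulN1r opprK.
  rewrite exp2N_powR -powRrM /rate -powRN natrM; congr (_ `^ _); ring.
have rt0 : 0 < rate b g k by exact: powR2_gt0.
have c0 : (0 <= (4 `^ g / rate b g k)%:E)%E.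
  by rewrite lee_fin divr_ge0 ?powR_ge0 ?(ltW rt0).
apply: (le_trans (lee_wpmul2l c0 hk)); rewrite -EFinM lee_fin.
set x := expR _.
have hx : x / rate b g k <= 2 ^- k.
  have := hk0 k; rewrite -/x /rate powRN invrK mulrC; apply.
  by apply: leq_trans jk; rewrite /j -!addnA (leq_trans (leq_addr _ _) (leq_addl _ _)).
have kj : 2 ^- k <= 2 ^- j :> R by exact: mono.
have jj1 : 2 ^- j <= 2 ^- j1 :> R by apply: mono; rewrite /j (leq_trans (leq_addl _ _) (leq_addr _ _)).
have -> : 4 `^ g / rate b g k * (27 ^+ d * (2 ^+ d * (2 ^- j * rate b g k)) + 2 * x) =
    4 `^ g * (27 ^+ d * 2 ^+ d * 2 ^- j + 2 * (x / rate b g k)).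
  by field; rewrite gt_eqF// expf_neq0.
apply: (@le_trans _ _ (D * 2 ^- j1)).
  rewrite /D -[leRHS]mulrA ler_wpM2l ?powR_ge0// [leRHS]mulrDl lerD//.
    by rewrite ler_wpM2l// mulr_ge0 ?exprn_ge0.
  rewrite ler_pM2l//; apply: (le_trans hx); exact: le_trans jj1.
have D1 : 0 < D + 1 by lra.
move: hj1; rewrite ltr_pdivlMr// => /ltW; apply: le_trans.
rewrite mulrC ler_wpM2l ?invr_ge0 ?exprn_ge0//; lra.
Qed.

(** The null set is discarded before [s'], [g], [s] and [b] are chosen: [good_on] covers all [b],
    and the pieces are countably many. *)
Theorem dimP_le_dimPZ (A : set 'rV[R]_n) (C : nat -> set 'rV[R]_n) (M : nat -> R) :
  analytic A -> A `<=` \bigcup_k C k ->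
  (forall k, [/\ closed (C k), forall t, C k t -> forall i, `|t ord0 i| <= M k &
    log_regular P X (C k)]) ->
  {ae P, forall w, (dimP (Z w @` A) <= dimPZ P Z A)%E}.
Proof.
move=> /analytic_suslin sA AC hCk.
have hgood : {ae P, forall w, forall k, good_on (C k) w}.
  apply: ae_foralln => k; have [_ hM regC] := hCk k.
  exact: (good_paths hG hC hM regC).
apply: filterS2 hC hgood => w cw good.
apply: ge_ereal_sup => _ [s' hs' <-]; rewrite leNgt; apply/negP => hlt.
have [g [s [hg gs ss']]] : exists g s : R, [/\ (dimPZ P Z A < g%:E)%E, g < s & s < s'].
  move: hlt; case: (dimPZ P Z A) => [x| |].
  - rewrite lte_fin => xs; exists (x + (s' - x) / 3), (x + (s' - x) / 2).
    by rewrite lte_fin; split; lra.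
  - by [].
  - by move=> _; exists (s' - 2), (s' - 1); split; [exact: ltNyr|lra|lra].
have sg : 0 < s - g by lra.
(* [(b+1) g < b s] amounts to [g < b (s - g)]. *)
pose b := (Num.bound (`|g| / (s - g))).+1.
have hb : b.+1%:R * g < b%:R * s.
  have h0 : 0 <= `|g| / (s - g) by rewrite divr_ge0 ?(ltW sg).
  have : `|g| / (s - g) < b%:R.
    by apply: (lt_le_trans (archi_boundP h0)); rewrite ler_nat.
  rewrite ltr_pdivrMr// => h; have := ler_norm g; rewrite -[b.+1%:R]natr1.
  move: h; move: (b%:R) => y; lra.
have [k hk] : exists k, ~ sigma_small b s (Z w @` (A `&` C k)).
  apply: contrapT => /forallNP hno.
  have : sigma_small b s (Z w @` A).
    apply: (@sigma_smallS _ _ _ _ _ (\bigcup_k (Z w @` (A `&` C k)))).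
      by move=> _ [t At <-]; have [k _ Ckt] := AC t At; exists k => //; exists t.
    by apply: sigma_small_bigcup => k; exact: contrapT (hno k).
  move=> /(sigma_small_packing (ltn0Sn _) ss'); by rewrite hs' ltxx.
have [cC _ _] := hCk k.
have := dimPZ_mu_ge cw (good k) sA cC hb hk.
by rewrite leNgt hg.
Qed.

End Main.

(** * Graphs as images *)

Section Graph.
Variables (R : realType) (n d : nat) (dO : measure_display).
Variables (Omega : measurableType dO) (P : probability Omega R).
Variables (X : Omega -> 'rV[R]_n -> 'rV[R]_d).

(* The graph of [X + f] is the range of the field [(0, X)] with drift [(id, f)]. *)
Definition padded (w : Omega) (t : 'rV[R]_n) : 'rV[R]_(n + d) := row_mx 0 (X w t).

Lemma padded_l w t i : padded w t ord0 (lshift d i) = 0.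
Proof. by rewrite row_mxEl mxE. Qed.

Lemma padded_r w t i : padded w t ord0 (rshift n i) = X w t ord0 i.
Proof. by rewrite row_mxEr. Qed.

Lemma padded_gaussian :
  (forall i : 'I_d, centered_gaussian_field P (fun w t => X w t ord0 i)) ->
  forall i, centered_gaussian_field P (fun w t => padded w t ord0 i).
Proof.
move=> hG i k ts a; case: (split_ordP i) => l ->.
  have -> : (fun w => \sum_(j < k) a j * padded w (ts j) ord0 (lshift d l)) = cst 0.
    by apply/funext => w; rewrite big1// => j _; rewrite padded_l mulr0.
  split; first exact: measurable_cst.
  left=> B _; rewrite preimage_cst diracE; case: ifPn => _.
    exact: probability_setT.
  exact: measure0.
under eq_fun do under eq_bigr do rewrite padded_r.
exact: hG.
Qed.

(** An event on a zero coordinate is sure or empty: either all of them are sure and drop out, or one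
    is empty and both sides vanish. *)
Lemma padded_independent : independent_components P X ->
  independent_components P padded.
Proof.
move=> hI k ts B mB; rewrite big_split_ord/=.
rewrite [Y in (_ * Y)%E](_ : _ = P (\bigcap_(i in [set: 'I_d])
    \bigcap_(j in [set: 'I_k]) [set w | B (rshift n i) j (X w (ts j) ord0 i)])); last first.
  rewrite (hI k ts (fun i => B (rshift n i))) //; apply: eq_bigr => i _; congr (P _).
  by apply: eq_bigcapr => j _; apply/seteqP; split=> w /=; rewrite padded_r.
have [h|/existsNP[i /existsNP[j hij]]] := pselect (forall i j, B (lshift d i) j 0).
  rewrite big1 ?mul1e => [|i _].
    congr (P _); apply/seteqP; split=> w hw.
      by move=> i _ j _; have := hw (rshift n i) Logic.I j Logic.I; rewrite /= padded_r.
    move=> i _ j _; case: (split_ordP i) => l ->; rewrite /= ?padded_l ?padded_r//.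
    exact: (hw l Logic.I j Logic.I).
  rewrite (_ : \bigcap_(j in _) _ = setT); first exact: probability_setT.
  by apply/seteqP; split=> // w _ j _ /=; rewrite padded_l.
have e0 (S : set Omega) : S `<=` set0 -> P S = 0%E.
  by rewrite subset0 => ->; rewrite measure0.
rewrite e0; last first.
  by move=> w /(_ (lshift d i) Logic.I j Logic.I) /=; rewrite padded_l.
rewrite (bigD1 i)//= e0 ?mul0e//.
by move=> w /(_ j Logic.I) /=; rewrite padded_l.
Qed.

Lemma padded_continuous :
  {ae P, forall w, forall i : 'I_d, continuous (fun t => X w t ord0 i)} ->
  {ae P, forall w, forall i : 'I_(n + d), continuous (fun t => padded w t ord0 i)}.
Proof.
apply: filterS => w cw i; case: (split_ordP i) => l ->.
  under eq_fun do rewrite padded_l.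
  exact: cst_continuous.
under eq_fun do rewrite padded_r.
exact: cw.
Qed.

Lemma padded_log_regular C : log_regular P X C -> log_regular P padded C.
Proof.
move=> regC N; have [c [k0 [c0 hc]]] := regC N; exists c, k0; split => //.
move=> k kk t u Ct Cu ntu i; case: (split_ordP i) => l ->.
  rewrite /rho; under eq_integral do rewrite !padded_l subrr expr0n.
  rewrite integral0 sqrtr0 mulr_ge0 ?(ltW c0)// invr_ge0 exprn_ge0//.
rewrite /rho; under eq_integral do rewrite !padded_r.
exact: hc.
Qed.

Lemma graph_map_suslin (f : 'rV[R]_n -> 'rV[R]_d) :
  suslin [set p : 'rV[R]_n * 'rV[R]_d | p.2 = f p.1] ->
  suslin [set p : 'rV[R]_n * 'rV[R]_(n + d) | p.2 = row_mx p.1 (f p.1)].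
Proof.
move=> sf.
pose psi (p : 'rV[R]_n * 'rV[R]_(n + d)) := (p.1, rsubmx p.2).
pose chi (p : 'rV[R]_n * 'rV[R]_(n + d)) := lsubmx p.2 - p.1.
have cf (p : 'rV[R]_n * 'rV[R]_(n + d)) : fst @ p --> p.1 by exact: cvg_fst.
have cr (p : 'rV[R]_n * 'rV[R]_(n + d)) :
    (fun q : 'rV[R]_n * 'rV[R]_(n + d) => rsubmx q.2) @ p --> rsubmx p.2.
  by apply: (cvg_comp snd rsubmx); [exact: cvg_snd|exact: continuous_rsubmx].
have cl (p : 'rV[R]_n * 'rV[R]_(n + d)) :
    (fun q : 'rV[R]_n * 'rV[R]_(n + d) => lsubmx q.2) @ p --> lsubmx p.2.
  by apply: (cvg_comp snd lsubmx); [exact: cvg_snd|exact: continuous_lsubmx].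
have -> : [set p : 'rV[R]_n * 'rV[R]_(n + d) | p.2 = row_mx p.1 (f p.1)] =
    psi @^-1` [set p | p.2 = f p.1] `&` chi @^-1` [set 0].
  apply/seteqP; split=> p /=; rewrite /chi.
    by move=> ->; rewrite row_mxKr row_mxKl subrr.
  by move=> [<- /subr0_eq <-]; rewrite hsubmxK.
apply: suslin_setI; apply: suslin_preimage => //.
- by move=> p; exact: (cvg_pair (cf p) (cr p)).
- by move=> p; exact: (cvgB (cl p) (cf p)).
- apply: suslin_closed => v cv; apply/rowP => i; apply/eqP.
  rewrite mxE -normr_le0; apply/ler_addgt0Pr => e e0; rewrite add0r.
  have [q [-> [_ /(_ ord0 i)]]] := cv _ (nbhsx_ballx v e e0).
  by rewrite /ball /= mxE subr0 => /ltW.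
Qed.

End Graph.

Theorem theorem3p6 (R : realType) (n d : nat) (dO : measure_display)
    (Omega : measurableType dO) (P : probability Omega R)
    (X : Omega -> 'rV[R]_n -> 'rV[R]_d) (f : 'rV[R]_n -> 'rV[R]_d)
    (A : set 'rV[R]_n) :
  (forall i : 'I_d, centered_gaussian_field P (fun w t => X w t ord0 i)) ->
  independent_components P X ->
  {ae P, forall w, forall i : 'I_d, continuous (fun t => X w t ord0 i)} ->
  measurable_fun [set: borelRV R n] (f : borelRV R n -> borelRV R d) ->
  analytic A ->
  regular_on P X A ->
  {ae P, forall w,
     (dimP ((fun t => (X w t + f t)%R) @` A)
       <= dimPZ P (fun w' t => (X w' t + f t)%R) A)%E} /\
  {ae P, forall w,
     (dimP ((fun t => row_mx t (X w t + f t)%R) @` A)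
       <= dimPZ P (fun w' t => row_mx t (X w' t + f t)%R) A)%E}.
Proof.
move=> hG hI hC mf aA regA.
have sf := graph_suslin mf.
have [C [M [AC hCk]]] := regular_pieces hG hC regA.
split; first exact: (dimP_le_dimPZ (f := f) hG hI hC sf aA AC hCk).
have hCk' k : [/\ closed (C k), forall t, C k t -> forall i, `|t ord0 i| <= M k &
    log_regular P (padded X) (C k)].
  by have [h1 h2 h3] := hCk k; split => //; exact: padded_log_regular.
have := @dimP_le_dimPZ R n (n + d) dO Omega P (padded X) (fun t => row_mx t (f t))
  (padded_gaussian hG) (padded_independent hI) (padded_continuous hC)
  (graph_map_suslin (f := f) sf) A C M aA AC hCk'.
have E : (fun w t => padded X w t + row_mx t (f t)) =
    (fun w t => row_mx t (X w t + f t)).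
  by apply/funext => w; apply/funext => t; rewrite add_row_mx add0r.
rewrite E; apply: filterS => w.
by have -> : (fun t => padded X w t + row_mx t (f t)) =
  (fun t => row_mx t (X w t + f t)) by exact: (congr1 (fun F => F w) E).
Qed.
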